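(* Let $\eta\in[0,1]$, let $n\le9$, and let $\bar\psi$ be the $\mathcal{H}^1$-elliptic envelope of $\psi(b,t)=|b|^2+\eta(b\cdot t)^2$, $\psi:\mathbb{Z}^n\times\mathcal{S}^{n-1}\to\mathbb{R}$. Let $\psi_{\rm e}(b,t)=|t|\,\psi(b,t/|t|)$ for $t\in\mathbb{R}^n$ (with $\psi_{\rm e}(b,0)=0$). Then for all $\beta\in\mathbb{Z}$, $t\in\mathcal{S}^{n-1}$, $i\ne j\in\{1,\dots,n\}$ we have $$\bar\psi(\beta(e_i+e_j),t)=|\beta|\min\Big\{\psi_{\rm e}(e_i,z_1)+\psi_{\rm e}(e_j,z_2)+\psi_{\rm e}\Big(e_i-e_j,\frac{z_2-z_1}{2}\Big)+\psi_{\rm e}\Big(e_i+e_j,t-\frac{z_1+z_2}{2}\Big):\ z_1,z_2\in\mathbb{R}^n\Big\},$$ and correspondingly $$\bar\psi(\beta(e_i-e_j),t)=|\beta|\min\Big\{\psi_{\rm e}(e_i,z_1)+\psi_{\rm e}(-e_j,z_2)+\psi_{\rm e}\Big(e_i+e_j,\frac{z_2-z_1}{2}\Big)+\psi_{\rm e}\Big(e_i-e_j,t-\frac{z_1+z_2}{2}\Big):\ z_1,z_2\in\mathbb{R}^n\Big\}.$$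
   Context: $e_1,\dots,e_n$ is the canonical basis of $\mathbb{R}^n$. For $\Omega\subset\mathbb{R}^n$ open, $\mathcal{M}_{\rm df}^{(n)}(\Omega)$ is the set of finite $\mathbb{R}^{n\times n}$-valued Radon measures on $\Omega$ of the form $\mu=\theta\otimes\tau\,\mathcal{H}^1\llcorner\gamma$, where $\gamma\subset\Omega$ is $1$-rectifiable, $\tau:\gamma\to\mathcal{S}^{n-1}$ is its unit tangent vector, $\theta:\gamma\to\mathbb{Z}^n$ is $\mathcal{H}^1$-integrable, and $\mu$ is divergence-free, i.e. $\sum_{j=1}^n\int_\Omega\partial_j\varphi\,d\mu_{ij}=0$ for all $\varphi\in C_c^\infty(\Omega)$ and $i=1,\dots,n$. The $\mathcal{H}^1$-elliptic envelope of $\psi$ is, for $b\in\mathbb{Z}^n$, $t\in\mathcal{S}^{n-1}$, $$\bar\psi(b,t)=\inf\Big\{\int_\gamma\psi(\theta,\tau)\,d\mathcal{H}^1:\ \mu=\theta\otimes\tau\,\mathcal{H}^1\llcorner\gamma\in\mathcal{M}_{\rm df}^{(n)}(B_{1/2}),\ \mathrm{supp}\big(\mu-b\otimes t\,\mathcal{H}^1\llcorner(\mathbb{R}t\cap B_{1/2})\big)\subset B_{1/2}\Big\},$$ where $B_{1/2}\subset\mathbb{R}^n$ is the ball of radius $1/2$ centered at $0$; the support condition means that there is a ball $B'\subset\subset B_{1/2}$ with $\mu=b\otimes t\,\mathcal{H}^1\llcorner\mathbb{R}t$ on $B_{1/2}\setminus B'$. *)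

(* Defs.v *)
(* Points of R^n are row vectors; the library's norm `|x|
   on 'rV[R]_n is the sup norm (it gives the right topology, and the right
   notions of derivative and Lipschitz map), so the Euclidean norm is defined
   here separately. *)
From HB Require Import structures.
From mathcomp Require Import all_boot all_order all_algebra.
From mathcomp Require Import all_classical all_reals all_analysis.
Set Implicit Arguments.
Unset Strict Implicit.
Unset Printing Implicit Defensive.
Import Order.TTheory GRing.Theory Num.Theory.
Import numFieldNormedType.Exports.
Local Open Scope classical_set_scope.
Local Open Scope ring_scope.

Section euclidean.
Context {R : realType} {n : nat}.
Implicit Types x y : 'rV[R]_n.

Definition dot x y : R := \sum_(i < n) x 0 i * y 0 i.

Definition enorm x : R := Num.sqrt (dot x x).

Definition eball (c : 'rV[R]_n) (r : R) : set 'rV[R]_n :=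
  [set x | enorm (x - c) < r].

Definition line (t : 'rV[R]_n) : set 'rV[R]_n := [set s *: t | s in [set: R]].

(* The element 0 only matters for the empty set, whose diameter is 0. *)
Definition ediam (A : set 'rV[R]_n) : \bar R :=
  ereal_sup ([set 0%E] `|` [set (enorm (x - y))%:E | x in A & y in A]).

End euclidean.

(* The one-dimensional Hausdorff measure, first as an outer measure.  No
   normalising constant is needed in dimension one: segments have H^1-measure
   equal to their length. *)
Section hausdorff.
Context {R : realType} {n : nat}.
Local Notation E := 'rV[R]_n.
Local Open Scope ereal_scope.

Definition fine_cover (d : R) (A : set E) : set ((set E)^nat) :=
  [set F | A `<=` \bigcup_k F k /\ forall k, ediam (F k) <= d%:E].

Definition hausdorff1_pre (d : R) (A : set E) : \bar R :=
  ereal_inf [set \sum_(k <oo) ediam (F k) | F in fine_cover d A].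

Definition hausdorff1 (A : set E) : \bar R :=
  ereal_sup [set hausdorff1_pre d A | d in [set d : R | (0 < d)%R]].

Lemma ediam_ge0 (A : set E) : 0 <= ediam A.
Proof. by apply: ereal_sup_ubound; left. Qed.

Lemma ediam0 : ediam (set0 : set E) = 0.
Proof.
apply/eqP; rewrite eq_le ediam_ge0 andbT; apply: ge_ereal_sup => z [/= ->//|].
by move=> [x []].
Qed.

Lemma hausdorff1_pre_ge0 d A : 0 <= hausdorff1_pre d A.
Proof.
apply: le_ereal_inf_tmp => _ [F _ <-].
by apply: nneseries_ge0 => *; exact: ediam_ge0.
Qed.

Lemma hausdorff1_pre_le d A : (0 < d)%R -> hausdorff1_pre d A <= hausdorff1 A.
Proof. by move=> d0; apply: ereal_sup_ubound; exists d. Qed.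

Lemma hausdorff1_ge0 A : 0 <= hausdorff1 A.
Proof.
by apply: le_trans (hausdorff1_pre_ge0 1 A) (hausdorff1_pre_le _ ltr01).
Qed.

Lemma hausdorff1_0 : hausdorff1 set0 = 0.
Proof.
apply/eqP; rewrite eq_le hausdorff1_ge0 andbT.
apply: ge_ereal_sup => _ [d /= d0 <-]; apply: ereal_inf_lbound.
exists (fun=> set0); last by rewrite eseries0// => *; exact: ediam0.
by split => // k; rewrite ediam0 lee_fin ltW.
Qed.

Lemma le_hausdorff1 : {homo hausdorff1 : A B / A `<=` B >-> A <= B}.
Proof.
move=> A B AB; apply: ge_ereal_sup => _ [d /= d0 <-].
apply: le_trans (hausdorff1_pre_le B d0).
apply/ereal_inf_le_tmp => _ [F [BF dF] <-]; exists F => //.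
by split => //; exact: subset_trans BF.
Qed.

Lemma hausdorff1_pre_sigma_subadditive d : sigma_subadditive (hausdorff1_pre d).
Proof.
move=> A; have [[i ioo]|] := pselect (exists i, hausdorff1_pre d (A i) = +oo).
  rewrite (eseries_pinfty _ _ ioo) ?leey// => k _.
  by rewrite -ltNye (lt_le_trans _ (hausdorff1_pre_ge0 _ _)).
rewrite -forallNE => Aoo.
suff add2e (e : {posnum R}) : hausdorff1_pre d (\bigcup_k A k) <=
    \sum_(i <oo) hausdorff1_pre d (A i) + e%:num%:E.
  by apply/lee_addgt0Pr => _/posnumP[].
rewrite (le_trans _ (epsilon_trick _ _ _))//; last first.
  by move=> k; exact: hausdorff1_pre_ge0.
pose P k (B : (set E)^nat) := fine_cover d (A k) B /\
  \sum_(l <oo) ediam (B l) <=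
    hausdorff1_pre d (A k) + (e%:num / (2 ^ k.+1)%:R)%:E.
have [G PG] : {G : ((set E)^nat)^nat & forall k, P k (G k)}.
  apply: (@choice _ _ P) => k; rewrite /P /hausdorff1_pre.
  set S := (X in ereal_inf X); move infS : (ereal_inf S) => iS.
  case: iS infS => [r Sr|Soo|Soo].
  - have en1 : (0 < e%:num / (2 ^ k.+1)%:R)%R by [].
    have /(lb_ereal_inf_adherent en1) : ereal_inf S \is a fin_num by rewrite Sr.
    move=> [x [B cB muBx] xS].
    by exists B; split => //; rewrite muBx -Sr; exact/ltW.
  - by have := Aoo k; rewrite /hausdorff1_pre Soo.
  - by have := hausdorff1_pre_ge0 d (A k); rewrite /hausdorff1_pre Soo.
have G_ge0 x : 0 <= (ediam \o uncurry G) x by exact: ediam_ge0.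
apply: (@le_trans _ _ (\esum_(i in setT) (ediam \o uncurry G) i)).
  apply: ereal_inf_lbound => /=.
  have /card_esym/ppcard_eqP[f] := card_nat2.
  exists (uncurry G \o f).
    split => [x [k _ /((PG k).1.1)] [l _ Gx]|k]; last first.
      by rewrite /=; case: (f k) => a b; exact: (PG a).1.2.
    by exists (f^-1%FUN (k, l)) => //=; rewrite invK ?inE.
  rewrite -(esum_pred_image (ediam \o uncurry G) _ xpredT) ?[fun=> _]set_true//.
  by rewrite image_eq.
rewrite (_ : esum _ _ = \sum_(i <oo) \sum_(j <oo ) ediam (G i j)); last first.
  pose J : nat -> set (nat * nat) := fun i => [set (i, j) | j in setT].
  rewrite (_ : setT = \bigcup_k J k); last first.
    by rewrite predeqE => -[a b]; split => // _; exists a => //; exists b.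
  rewrite esum_bigcupT /=; last 2 first.
    - apply/trivIsetP => i j _ _ ij.
      rewrite predeqE => -[k m] /=; split => //= -[] [_] _ [<-{k} _].
      by move=> [m' _] [] /esym/eqP; rewrite (negbTE ij).
    - by move=> [k m]; exact: ediam_ge0.
  rewrite -(image_id [set: nat]) -fun_true esum_pred_image//; last first.
    by move=> k _; apply: esum_ge0 => *; exact: ediam_ge0.
  apply: eq_eseriesr => /= j _.
  rewrite -(esum_pred_image (ediam \o uncurry G) (pair j) predT)//=; last 2 first.
  - by move=> *; exact: ediam_ge0.
  - by move=> ? ? _ _; exact: (@can_inj _ _ _ snd).
  by congr esum; rewrite predeqE => -[a b]; split; move=> [i _ <-]; exists i.
apply: lee_lim.
- apply: is_cvg_nneseries => k *.
  by apply: nneseries_ge0 => m *; exact: (G_ge0 (k, m)).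
- apply: is_cvg_nneseries => k *; apply: adde_ge0 => //.
  exact: hausdorff1_pre_ge0.
- by near=> k; apply: lee_sum => i _; exact: (PG i).2.
Unshelve. all: by end_near. Qed.

Lemma hausdorff1_sigma_subadditive : sigma_subadditive hausdorff1.
Proof.
move=> A; apply: ge_ereal_sup => _ [d /= d0 <-].
apply: le_trans (hausdorff1_pre_sigma_subadditive d A) _.
apply: lee_nneseries => k *; first exact: hausdorff1_pre_ge0.
exact: hausdorff1_pre_le.
Qed.

HB.instance Definition _ := isOuterMeasure.Build R E hausdorff1
  hausdorff1_0 hausdorff1_ge0 le_hausdorff1 hausdorff1_sigma_subadditive.

End hausdorff.

(* R^n with the sigma-algebra of the H^1-measurable (Caratheodory) sets, and
   H^1 as a measure on it. *)
Definition H1space (R : realType) (n : nat) :=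
  caratheodory_type (@hausdorff1 R n).

Definition H1 (R : realType) (n : nat) (A : set (H1space R n)) : \bar R :=
  hausdorff1 A.

HB.instance Definition _ (R : realType) (n : nat) :=
  isMeasure.Build _ (H1space R n) R (@H1 R n)
    (@caratheodory_measure0 R 'rV[R]_n (@hausdorff1 R n))
    (@caratheodory_measure_ge0 R 'rV[R]_n (@hausdorff1 R n))
    (@caratheodory_measure_sigma_additive R 'rV[R]_n (@hausdorff1 R n)).

Section measures.
Context {R : realType} {n : nat}.
Local Notation E := (H1space R n).
Local Notation H1 := (@H1 R n).

(* H^1-measurable, and covered up to an H^1-null set by countably many Lipschitz
   curves. *)
Definition rectifiable1 (g : set E) : Prop :=
  measurable g /\
  exists c : nat -> R -> 'rV[R]_n,
    (forall k, lipschitz (c k)) /\ H1 (g `\` \bigcup_k range (c k)) = 0%E.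

Definition C1_curve (c : R -> 'rV[R]_n) : Prop :=
  (forall s, derivable c s 1) /\ continuous (derive1 c).

(* The tangent of a rectifiable set is determined H^1-a.e. by locality: every
   C^1 curve is tangent to it at H^1-a.e. common point.  The requirement on one
   curve is void where its derivative vanishes, but (Sard) this is an H^1-null
   part of its image. The orientation is free up to measurability. *)
Definition unit_tangent (g : set E) (tau : E -> 'rV[R]_n) : Prop :=
  [/\ forall j, measurable_fun g (fun x => tau x 0 j),
      forall x, g x -> enorm (tau x) = 1
    & forall c : R -> 'rV[R]_n, C1_curve c ->
        H1 [set x | g x /\
          exists s, c s = x /\ ~ line (tau x) (derive1 c s)] = 0%E].

(* The density of theta (x) tau, entry (i, j). *)
Definition tensor (b : 'rV[int]_n) (t : 'rV[R]_n) : 'M[R]_n :=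
  \matrix_(i, j) ((b 0 i)%:~R * t 0 j).

(* The matrix-valued measure theta (x) tau H^1 restricted to g. *)
Definition line_measure (g : set E) (theta : E -> 'rV[int]_n)
    (tau : E -> 'rV[R]_n) (A : set E) : 'M[R]_n :=
  \matrix_(i, j) \int[H1]_(x in g `&` A) tensor (theta x) (tau x) i j.

Definition pderiv (j : 'I_n) (phi : 'rV[R]_n -> R) : 'rV[R]_n -> R :=
  derive phi ^~ (delta_mx 0 j).

Fixpoint Ck (k : nat) (phi : 'rV[R]_n -> R) : Prop :=
  continuous phi /\
  if k is k'.+1 then
    forall j, (forall x, derivable phi x (delta_mx 0 j)) /\ Ck k' (pderiv j phi)
  else True.

(* C_c^oo(Omega), its elements being extended by zero to the whole space. *)
Definition test_function (Omega : set 'rV[R]_n) (phi : 'rV[R]_n -> R) : Prop :=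
  let supp := closure [set x | phi x != 0] in
  [/\ forall k, Ck k phi, compact supp & supp `<=` Omega].

(* M_df(Omega), through the triples (g, theta, tau) that represent its elements.
   Outside g the values of theta and tau are irrelevant. *)
Definition Mdf (Omega : set 'rV[R]_n) (g : set E) (theta : E -> 'rV[int]_n)
    (tau : E -> 'rV[R]_n) : Prop :=
  [/\ g `<=` Omega,
      rectifiable1 g,
      unit_tangent g tau,
      forall i, H1.-integrable g (fun x => ((theta x 0 i)%:~R)%:E)
    & forall phi, test_function Omega phi -> forall i,
        \sum_(j < n) \int[H1]_(x in g)
          (pderiv j phi x * tensor (theta x) (tau x) i j) = 0].

(* theta (x) tau H^1|_g and b (x) t H^1|_(Rt) agree on Omega minus a ball that
   is relatively compact in Omega. *)
Definition agrees_near_boundary (Omega : set 'rV[R]_n) (g : set E)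
    (theta : E -> 'rV[int]_n) (tau : E -> 'rV[R]_n)
    (b : 'rV[int]_n) (t : 'rV[R]_n) : Prop :=
  exists (c : 'rV[R]_n) (r : R), [/\ 0 < r, closure (eball c r) `<=` Omega
    & forall A : set 'rV[R]_n, <<s open >> A -> A `<=` Omega `\` eball c r ->
        line_measure g theta tau A =
        line_measure (line t `&` Omega) (cst b) (cst t) A].

Definition H1_elliptic_envelope (psi : 'rV[int]_n -> 'rV[R]_n -> R)
    (b : 'rV[int]_n) (t : 'rV[R]_n) : \bar R :=
  let B := eball 0 2^-1 in
  ereal_inf [set e | exists g theta tau,
    [/\ Mdf B g theta tau, agrees_near_boundary B g theta tau b t
      & e = (\int[H1]_(x in g) (psi (theta x) (tau x))%:E)%E]].

Definition psi (eta : R) (b : 'rV[int]_n) (t : 'rV[R]_n) : R :=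
  let b' := map_mx intr b in enorm b' ^+ 2 + eta * dot b' t ^+ 2.

(* The positively one-homogeneous extension of f from unit vectors. *)
Definition homog_ext (f : 'rV[int]_n -> 'rV[R]_n -> R)
    (b : 'rV[int]_n) (t : 'rV[R]_n) : R :=
  if t == 0 then 0 else enorm t * f b ((enorm t)^-1 *: t).

End measures.

Definition is_min (R : realType) (A : set R) (m : R) : Prop := A m /\ lbound A m.

Definition basis_vec (n : nat) (i : 'I_n) : 'rV[int]_n := delta_mx 0 i.

(* Main.v *)
(* Lower bound.  Writing b1 = e_i and b2 = +-e_j, the components of theta along
   b1 and b2 are split as c1 b1 + c2 b2 + c3 (b1 - b2) + c4 (b1 + b2) in such a
   way that psi (theta, tau) >= sum_k |c_k| psi (b_k, tau) pointwise.  Since psi_e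
   is convex in its second argument, the energy of a competitor is at least
   sum_k psi_e (b_k, z_k), where z_k is the integral of c_k tau.  Testing the
   divergence condition with linear functions, cut off near the boundary, gives
   z1 + z4 + z3 = z2 + z4 - z3 = beta t, which is the form of the minimisation
   problem.

   Upper bound.  A competitor carries the charge beta (b1 + b2) along the diameter,
   except in a central part where it separates into |beta| chains of N small cells.
   A cell is a planar diagram with four vertices whose edges, with multipliers b1,
   b2, b1 - b2, b1 + b2, realise one copy of the minimisation problem.  The vertices
   are perturbed so that no three of them are collinear: the edges then overlap in
   H^1-null sets only, and the result is an admissible measure. *)
Require Import Defs.
From HB Require Import structures.
From mathcomp Require Import all_boot all_order all_algebra.
From mathcomp Require Import all_classical all_reals all_analysis.
From mathcomp Require Import measurable_realfun.
From mathcomp Require Import ring lra zify.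
Set Implicit Arguments.
Unset Strict Implicit.
Unset Printing Implicit Defensive.
Import Order.TTheory GRing.Theory Num.Theory.
Import numFieldNormedType.Exports.
Local Open Scope classical_set_scope.
Local Open Scope ring_scope.

(** The bound [eta <= 1] enters twice. It makes psi_e convex in its second argument, because |b|^2
    dominates eta (b . u)^2 for unit u, and it reduces the pointwise inequality, affine in eta, to
    eta = 0 and eta = 1. That inequality compares a quadratic function of theta with a
    one-homogeneous one and fails for small real vectors; integrality of theta rescues it. The
    moment identities are two equations for four vectors, so z1 and z2 remain free: they are the
    variables of the minimum.

    In the upper bound, many small cells keep the network close to the diameter and thus inside the
    ball, while homogeneity makes the energy of a chain independent of N. The end pieces cannot be
    perturbed, since the support condition prescribes them; general position is therefore meant
    relative to a fixed collinear set of anchors.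

    Much of the development serves to compute with H^1, which is given as an outer measure: Borel
    sets are measurable, and along a line H^1 is Lebesgue measure. *)

Section euclidean_theory.
Context {R : realType} {n : nat}.
Implicit Types x y z : 'rV[R]_n.

Lemma dotC x y : dot x y = dot y x.
Proof. by apply: eq_bigr => i _; rewrite mulrC. Qed.

Lemma dotDl x y z : dot (x + y) z = dot x z + dot y z.
Proof. by rewrite -big_split; apply: eq_bigr => i _; rewrite mxE mulrDl. Qed.

Lemma dotZl a x y : dot (a *: x) y = a * dot x y.
Proof. by rewrite [RHS]mulr_sumr; apply: eq_bigr => i _; rewrite mxE mulrA. Qed.

Lemma dotNl x y : dot (- x) y = - dot x y.
Proof. by rewrite -scaleN1r dotZl mulN1r. Qed.

Lemma dotBl x y z : dot (x - y) z = dot x z - dot y z.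
Proof. by rewrite dotDl dotNl. Qed.

Lemma dotDr x y z : dot z (x + y) = dot z x + dot z y.
Proof. by rewrite dotC dotDl !(dotC z). Qed.

Lemma dotZr a x y : dot x (a *: y) = a * dot x y.
Proof. by rewrite dotC dotZl dotC. Qed.

Lemma dotNr x y : dot x (- y) = - dot x y.
Proof. by rewrite dotC dotNl dotC. Qed.

Lemma dotBr x y z : dot z (x - y) = dot z x - dot z y.
Proof. by rewrite dotDr dotNr. Qed.

Lemma dot0l x : dot 0 x = 0.
Proof. by rewrite -(scale0r 0) dotZl mul0r. Qed.

Lemma dot0r x : dot x 0 = 0.
Proof. by rewrite dotC dot0l. Qed.

Lemma dot_ge0 x : 0 <= dot x x.
Proof. by apply: sumr_ge0 => i _; rewrite -expr2 sqr_ge0. Qed.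

Lemma enorm_ge0 x : 0 <= enorm x.
Proof. exact: sqrtr_ge0. Qed.

Lemma sqr_enorm x : enorm x ^+ 2 = dot x x.
Proof. by rewrite sqr_sqrtr// dot_ge0. Qed.

Lemma coord_le_enorm x i : `|x 0 i| <= enorm x.
Proof.
rewrite -(ger0_norm (enorm_ge0 x)) -ler_sqr ?nnegrE// !real_normK ?num_real//.
rewrite sqr_enorm /dot (bigD1 i)//= -expr2 lerDl.
by apply: sumr_ge0 => k _; rewrite -expr2 sqr_ge0.
Qed.

Lemma enorm_eq0 x : (enorm x == 0) = (x == 0).
Proof.
apply/eqP/eqP => [x0|->]; last by rewrite /enorm dot0l sqrtr0.
apply/rowP => i; rewrite mxE; apply/eqP.
by rewrite -normr_eq0 eq_le normr_ge0 andbT -x0 coord_le_enorm.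
Qed.

Lemma enorm0 : enorm (0 : 'rV[R]_n) = 0.
Proof. by apply/eqP; rewrite enorm_eq0. Qed.

Lemma enorm_gt0 x : (0 < enorm x) = (x != 0).
Proof. by rewrite lt_neqAle enorm_ge0 andbT eq_sym enorm_eq0. Qed.

Lemma enormZ a x : enorm (a *: x) = `|a| * enorm x.
Proof.
by rewrite /enorm dotZl dotZr mulrA -expr2 sqrtrM ?sqr_ge0// sqrtr_sqr.
Qed.

Lemma enormN x : enorm (- x) = enorm x.
Proof. by rewrite -scaleN1r enormZ normrN normr1 mul1r. Qed.

Lemma cauchy_schwarz_sum (P : pred 'I_n) (u v : 'I_n -> R) :
  (\sum_(i | P i) u i * v i) ^+ 2 <=
  (\sum_(i | P i) u i ^+ 2) * (\sum_(i | P i) v i ^+ 2).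
Proof.
set a := \sum_(i | P i) u i ^+ 2; set b := \sum_(i | P i) u i * v i.
set c := \sum_(i | P i) v i ^+ 2.
have [a0|a0] := eqVneq a 0.
  have /psumr_eq0P u0 := a0.
  rewrite [b]big1 ?expr0n ?a0 ?mul0r// => i Pi.
  have /eqP := u0 (fun i _ => sqr_ge0 _) i Pi.
  by rewrite sqrf_eq0 => /eqP ->; rewrite mul0r.
have {}a0 : 0 < a by rewrite lt_neqAle eq_sym a0 sumr_ge0// => i _; exact: sqr_ge0.
(* The sum equals a (a c - b^2). *)
have : 0 <= \sum_(i | P i) (b * u i - a * v i) ^+ 2.
  by apply: sumr_ge0 => i _; exact: sqr_ge0.
rewrite (eq_bigr (fun i => b ^+ 2 * u i ^+ 2 +
    (- (a * b *+ 2) * (u i * v i) + a ^+ 2 * v i ^+ 2))); last first.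
  by move=> i _; ring.
rewrite !big_split/= -!mulr_sumr -/a -/b -/c => h.
by rewrite -subr_ge0 -(pmulr_rge0 _ a0); apply: le_trans h _; lra.
Qed.

Lemma dot_sqr_le x y : dot x y ^+ 2 <= dot x x * dot y y.
Proof.
have E z : \sum_(i < n) z 0 i ^+ 2 = dot z z.
  by apply: eq_bigr => i _; rewrite expr2.
by have := cauchy_schwarz_sum xpredT (x 0) (y 0); rewrite !E.
Qed.

Lemma dot_le x y : `|dot x y| <= enorm x * enorm y.
Proof.
rewrite -[leRHS]ger0_norm ?mulr_ge0 ?enorm_ge0//.
rewrite -ler_sqr ?nnegrE// !real_normK ?num_real//.
by rewrite exprMn !sqr_enorm dot_sqr_le.
Qed.

Lemma enormD x y : enorm (x + y) <= enorm x + enorm y.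
Proof.
rewrite -ler_sqr ?nnegrE ?addr_ge0 ?enorm_ge0//.
rewrite sqr_enorm sqrrD !sqr_enorm dotDl !dotDr (dotC y x).
have := le_trans (ler_norm _) (dot_le x y); rewrite -mulr_natr; lra.
Qed.

Lemma enorm_triangle x y z : enorm (x - z) <= enorm (x - y) + enorm (y - z).
Proof. by rewrite (le_trans _ (enormD _ _))// subrKA. Qed.

Lemma le_norm_enorm x : `|x| <= enorm x.
Proof.
rewrite [leLHS]/Num.norm/= mx_normrE; apply/bigmax_leP; split=> [|[i j] _ /=].
  exact: enorm_ge0.
by rewrite ord1 coord_le_enorm.
Qed.

Lemma coord_le_norm x i : `|x 0 i| <= `|x|.
Proof.
by rewrite [leRHS]/Num.norm/= mx_normrE; apply/bigmax_geP; right; exists (0, i).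
Qed.

Lemma enorm_le_norm x : enorm x <= n%:R * `|x|.
Proof.
rewrite -ler_sqr ?nnegrE ?mulr_ge0 ?enorm_ge0// sqr_enorm exprMn.
apply: (@le_trans _ _ (\sum_(i < n) `|x| ^+ 2)).
  apply: ler_sum => i _; rewrite -expr2 -real_normK ?num_real//.
  by rewrite ler_sqr ?nnegrE// coord_le_norm.
rewrite sumr_const card_ord -[leLHS]mulr_natl ler_wpM2r ?sqr_ge0//.
by rewrite -natrX ler_nat; case: (n) => // m; rewrite expnS leq_pmulr.
Qed.

End euclidean_theory.

(** * The pointwise inequality for integer multipliers *)

Section reduction.
Context {R : realType}.
Implicit Types eta a b d q k : R.

(* [x], [y] are the components of an integer vector along b1 and b2, [k] is the
   squared norm of the others and [q] their product with the unit tangent, whose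
   components are [a], [b], the rest having squared norm [d].  Integrality enters
   through [nat] and [k = 0 \/ 1 <= k]. *)
Lemma reduction_eta1 a b d q k (x y : nat) :
  a ^+ 2 + b ^+ 2 + d = 1 -> 0 <= d -> q ^+ 2 <= k * d -> k = 0 \/ 1 <= k ->
  (y <= x)%N ->
  x%:R + y%:R + ((x%:R - y%:R) * a ^+ 2 + y%:R * (a + b) ^+ 2) <=
  x%:R ^+ 2 + y%:R ^+ 2 + k + (x%:R * a + y%:R * b + q) ^+ 2.
Proof.
move=> abd d0 qkd k01 yx.
have k0 : 0 <= k by case: k01 => [->//|]; exact: le_trans.
have d1 : d <= 1 by have := sqr_ge0 a; have := sqr_ge0 b; lra.
have qk : q ^+ 2 <= k by apply: le_trans qkd _; rewrite ler_piMr.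
(* Only [x = 1] uses that [k] skips the interval (0, 1); for [x = 0] and [x >= 2] it is enough that
   [k] is nonnegative and bounds [q ^+ 2]. *)
case: x yx => [|[|x]]; first by rewrite leqn0 => /eqP ->; have := sqr_ge0 q; nra.
- case: y => [_|[_|//]]; case: k01 qkd => [->|k1] qkd.
  + have -> : q = 0 by apply/eqP; rewrite -sqrf_eq0 eq_le sqr_ge0 andbT; lra.
    lra.
  + have := sqr_ge0 (a + q); have := sqr_ge0 b; nra.
  + have -> : q = 0 by apply/eqP; rewrite -sqrf_eq0 eq_le sqr_ge0 andbT; lra.
    lra.
  + (* [2(a+b)q >= -((a+b)^2/2 + 2q^2)], which is sharp for some tangents *)
    have h1 := sqr_ge0 (a + b + 2 * q); have h2 := sqr_ge0 (a - b).
    have h3 : 0 <= (k - 1) * (1 - d) by apply: mulr_ge0; lra.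
    nra.
- rewrite -!natr1; set X := _ + 1; set Y : R := y%:R => yx.
  have X2 : 2 <= X by rewrite /X; have := ler0n R x; lra.
  have Y0 : 0 <= Y := ler0n _ _.
  have Y1 : 0 <= Y * (Y - 1).
    rewrite /Y; case: (y) => [|m]; first by rewrite mul0r.
    by rewrite -natr1 mulr_ge0//; have := ler0n R m; lra.
  have YX : Y <= X by rewrite /X /Y !natr1 ler_nat.
  set p := X * a + Y * b.
  (* Together with q^2 <= k this eliminates [q] and [k]; what remains is an inequality in [a], [b],
     [X >= 2] and [Y]. *)
  have h1 : p ^+ 2 / 2 <= (p + q) ^+ 2 + q ^+ 2.
    by have := sqr_ge0 (p + 2 * q); lra.
  suff : X * a ^+ 2 + Y * b ^+ 2 + 2 * Y * a * b <=
         X ^+ 2 - X + (Y ^+ 2 - Y) + p ^+ 2 / 2 by nra.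
  have ab1 : a ^+ 2 + b ^+ 2 <= 1 by lra.
  have a0 := sqr_ge0 a; have b0 := sqr_ge0 b.
  have h2 : 0 <= (X - 2) * X * a ^+ 2 by apply/mulr_ge0/a0/mulr_ge0; lra.
  have h3 : 0 <= (Y - 1) ^+ 2 * b ^+ 2 by apply/mulr_ge0/b0/sqr_ge0.
  have XY : 0 <= (X - 2) * Y by apply: mulr_ge0 => //; lra.
  have h4 : 0 <= (X - 2) * Y * (a + b) ^+ 2 by apply/mulr_ge0/sqr_ge0.
  have h5 : 0 <= (X - 2) * Y * (1 - (a ^+ 2 + b ^+ 2)) by apply: mulr_ge0 XY _; lra.
  have h6 : 0 <= (X - 2) * (X - Y) by apply: mulr_ge0; lra.
  rewrite /p; nra.
Qed.

Lemma reduction_le eta a b d q k (x y : nat) : 0 <= eta <= 1 ->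
  a ^+ 2 + b ^+ 2 + d = 1 -> 0 <= d -> q ^+ 2 <= k * d -> k = 0 \/ 1 <= k ->
  (y <= x)%N ->
  x%:R + y%:R + eta * ((x%:R - y%:R) * a ^+ 2 + y%:R * (a + b) ^+ 2) <=
  x%:R ^+ 2 + y%:R ^+ 2 + k + eta * (x%:R * a + y%:R * b + q) ^+ 2.
Proof.
(* Both sides are affine in [eta]. *)
move=> /andP[eta0 eta1] abd d0 qkd k01 yx.
have h1 := reduction_eta1 abd d0 qkd k01 yx.
have k0 : 0 <= k by case: k01 => [->//|]; exact: le_trans.
(* This gives the end point [eta = 0]; [h1] is the end point [eta = 1]. *)
have h (m : nat) : m%:R <= m%:R ^+ 2 :> R.
  by case: m => [|m]; rewrite ?expr0n// expr2 ler_peMl// ler1n.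
have h0 := h x; have h0' := h y.
set A := (_ * a ^+ 2 + _) in h1 *; set B := (_ + q) ^+ 2 in h1 *.
set X := x%:R in h0 h1 *; set Y := y%:R in h0' h1 *.
nra.
Qed.

(* [0] if [u] and [v] have opposite signs, and otherwise the one that is closest
   to [0]. *)
Definition median0 (u v : R) : R := Num.max (Num.min u v) (Num.min 0 (Num.max u v)).

(* (x, y) = c1 (1, 0) + c2 (0, 1) + c3 (1, -1) + c4 (1, 1), with c3 and c4 as
   large as the signs allow: a diagonal costs no more than the sum of its two
   components. *)
Definition dcoef4 (x y : R) : R := median0 x y.
Definition dcoef3 (x y : R) : R := median0 x (- y).
Definition dcoef1 (x y : R) : R := x - dcoef4 x y - dcoef3 x y.
Definition dcoef2 (x y : R) : R := y - dcoef4 x y + dcoef3 x y.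

(** Domination that makes the coefficients integrable once [u] and [v] are integrable functions. *)
Lemma norm_median0 u v : `|median0 u v| <= `|u| + `|v|.
Proof.
rewrite /median0 ler_norml /Num.max /Num.min.
have := ler_norm u; have := ler_norm v; have := ler_norm (- u).
have := ler_norm (- v); rewrite !normrN => ? ? ? ?.
by case: ltP => ?; case: ltP => ?; case: ltP => ?; apply/andP; split; lra.
Qed.

(** This is sum_k |c_k| psi (b_k, s) for orthonormal b1, b2 and a vector s with components [a], [b]
    along them; the constants 2 are the squared norms of b1 - b2 and b1 + b2. *)
Definition weight eta a b (x y : R) :=
  `|dcoef1 x y| * (1 + eta * a ^+ 2) + `|dcoef2 x y| * (1 + eta * b ^+ 2) +
  `|dcoef3 x y| * (2 + eta * (a - b) ^+ 2) + `|dcoef4 x y| * (2 + eta * (a + b) ^+ 2).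

(** The fundamental sector for the symmetries of [weight]: here (x, y) splits into x - y copies of
    (1, 0) and y copies of (1, 1). *)
Lemma norm_dcoefE (x y : R) : 0 <= y -> y <= x ->
  [/\ `|dcoef1 x y| = x - y, `|dcoef2 x y| = 0, `|dcoef3 x y| = 0 &
      `|dcoef4 x y| = y].
Proof.
move=> y0 yx.
have m4 : dcoef4 x y = y.
  by rewrite /dcoef4 /median0 (min_r yx) (max_l yx) min_l ?max_l //; lra.
have m3 : dcoef3 x y = 0.
  have yx' : - y <= x by lra.
  by rewrite /dcoef3 /median0 (min_r yx') (max_l yx') min_l ?max_r //; lra.
rewrite /dcoef1 /dcoef2 m3 m4 subr0 addr0 subrr normr0.
by split=> //; rewrite ger0_norm//; lra.
Qed.

Lemma median0C u v : median0 u v = median0 v u.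
Proof. by rewrite /median0 minC (maxC u). Qed.

Lemma median0N u v : median0 (- u) (- v) = - median0 u v.
Proof.
wlog uv : u v / u <= v.
  by move=> h; have [/h//|/ltW/h] := leP u v; rewrite median0C (median0C u).
have vu : - v <= - u by rewrite lerN2.
rewrite /median0 (min_l uv) (max_r uv) (min_r vu) (max_l vu).
rewrite !minEle !maxEle.
by do 2 (case: (leP 0 _) => ?); do 2 (case: leP => ?); lra.
Qed.

(** With the next three lemmas: the symmetries of the square, acting on (x, y) and on (a, b), leave
    [weight] invariant. *)
Lemma weightN eta a b x y : weight eta a b (- x) (- y) = weight eta a b x y.
Proof.
rewrite /weight /dcoef1 /dcoef2 /dcoef3 /dcoef4 !median0N.
by rewrite -!opprD !normrN.
Qed.

Lemma weightNab eta a b x y : weight eta (- a) (- b) x y = weight eta a b x y.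
Proof. by rewrite /weight -!opprD !sqrrN. Qed.

Lemma weightNr eta a b x y : weight eta a (- b) x (- y) = weight eta a b x y.
Proof.
rewrite /weight /dcoef1 /dcoef2 /dcoef3 /dcoef4 !opprK sqrrN.
rewrite (_ : - y - median0 x (- y) + median0 x y =
  - (y - median0 x y + median0 x (- y))); last by ring.
rewrite normrN (_ : x - _ - _ = x - median0 x y - median0 x (- y)); last by ring.
by ring.
Qed.

Lemma weightC eta a b x y : weight eta b a y x = weight eta a b x y.
Proof.
rewrite /weight /dcoef1 /dcoef2 /dcoef3 /dcoef4 (median0C y x).
have -> : median0 y (- x) = - median0 x (- y).
  by rewrite -[y in LHS]opprK median0N median0C.
by rewrite opprK normrN (addrC b a) -(sqrrN (b - a)) opprB; ring.
Qed.

(** A symmetry applied to (x, y) and (a, b) together preserves x a + y b, hence the right-hand side,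
    so [reduction_le] on the sector 0 <= y <= x suffices. *)
Lemma weight_le eta a b d q k (x y : int) : 0 <= eta <= 1 ->
  a ^+ 2 + b ^+ 2 + d = 1 -> 0 <= d -> q ^+ 2 <= k * d -> k = 0 \/ 1 <= k ->
  weight eta a b x%:~R y%:~R <=
  x%:~R ^+ 2 + y%:~R ^+ 2 + k + eta * (x%:~R * a + y%:~R * b + q) ^+ 2.
Proof.
move=> eta01 + d0 qkd k01.
have main (a' b' : R) (m l : nat) : a' ^+ 2 + b' ^+ 2 + d = 1 ->
    weight eta a' b' m%:R l%:R <=
    m%:R ^+ 2 + l%:R ^+ 2 + k + eta * (m%:R * a' + l%:R * b' + q) ^+ 2.
  wlog : a' b' m l / (l <= m)%N.
    move=> h abd; have [lm|/ltnW ml] := leqP l m; first exact: h.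
    rewrite -weightC; have := h b' a' l m ml; rewrite (addrC (b' ^+ 2)).
    by move=> /(_ abd) /le_trans; apply; rewrite le_eqVlt; apply/orP; left; apply/eqP; ring.
  move=> lm abd; have := reduction_le eta01 abd d0 qkd k01 lm.
  apply: le_trans; rewrite /weight.
  by have [|-> -> -> ->] := norm_dcoefE (ler0n R l) (_ : _ <= m%:R); [rewrite ler_nat|lra].
have abs (z : int) : z%:~R = `|z|%N%:R :> R \/ z%:~R = - `|z|%N%:R :> R.
  by case: (intP z) => [|m|m]; [left|left|right; rewrite mulrNz abszN].
move=> abd.
have [->|->] := abs x; have [->|->] := abs y.
- exact: main.
- rewrite -[b in leLHS]opprK weightNr.
  have := main a (- b) `|x|%N `|y|%N; rewrite !sqrrN => /(_ abd) /le_trans; apply.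
  by rewrite le_eqVlt; apply/orP; left; apply/eqP; ring.
- rewrite -[X in weight _ _ _ _ X]opprK weightN.
  rewrite -[b in leLHS]opprK weightNr -weightNab opprK.
  have := main (- a) b `|x|%N `|y|%N; rewrite !sqrrN => /(_ abd) /le_trans; apply.
  by rewrite le_eqVlt; apply/orP; left; apply/eqP; ring.
- rewrite weightN -weightNab.
  have := main (- a) (- b) `|x|%N `|y|%N; rewrite !sqrrN => /(_ abd) /le_trans; apply.
  by rewrite le_eqVlt; apply/orP; left; apply/eqP; ring.
Qed.

End reduction.

(** * Convexity of psi_e and the vector form of the pointwise inequality *)

Section psi_theory.
Context {R : realType} {n : nat}.
Implicit Types (eta : R) (b : 'rV[int]_n) (z w s : 'rV[R]_n).

Definition toR b : 'rV[R]_n := map_mx intr b.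

Lemma toRD b c : toR (b + c) = toR b + toR c.
Proof. by rewrite /toR raddfD. Qed.

Lemma toRN b : toR (- b) = - toR b.
Proof. by rewrite /toR raddfN. Qed.

Lemma toRZ (a : int) b : toR (a *: b) = a%:~R *: toR b.
Proof. by apply/rowP => i; rewrite !mxE rmorphM. Qed.

Lemma dot_toR b c : exists k : int, dot (toR b) (toR c) = k%:~R.
Proof.
exists (\sum_i b 0 i * c 0 i); rewrite rmorph_sum; apply: eq_bigr => i _.
by rewrite !mxE rmorphM.
Qed.

Lemma psiE eta b s : psi eta b s = dot (toR b) (toR b) + eta * dot (toR b) s ^+ 2.
Proof. by rewrite /psi sqr_enorm. Qed.

Lemma psi_ge0 eta b s : 0 <= eta -> 0 <= psi eta b s.
Proof. by move=> e0; rewrite psiE addr_ge0 ?dot_ge0// mulr_ge0 ?sqr_ge0. Qed.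

Local Notation psie eta := (homog_ext (psi eta)).

(** The formula covers [z = 0] because the inverse of 0 is 0. *)
Lemma psieE eta b z : psie eta b z =
  dot (toR b) (toR b) * enorm z + eta * dot (toR b) z ^+ 2 / enorm z.
Proof.
rewrite /homog_ext; case: eqVneq => [->|z0].
  by rewrite enorm0 mulr0 invr0 mulr0 addr0.
rewrite psiE dotZr exprMn.
have : enorm z != 0 by rewrite enorm_eq0.
by move=> h; field.
Qed.

Lemma psieE_unit eta b s : enorm s = 1 -> psie eta b s = psi eta b s.
Proof. by move=> s1; rewrite psieE s1 mulr1 divr1 psiE. Qed.

Lemma psie0 eta b : psie eta b 0 = 0.
Proof. by rewrite psieE enorm0 mulr0 invr0 mulr0 addr0. Qed.

Lemma psie_ge0 eta b z : 0 <= eta -> 0 <= psie eta b z.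
Proof.
move=> e0; rewrite psieE; apply: addr_ge0.
  by rewrite mulr_ge0 ?enorm_ge0 ?dot_ge0.
by rewrite mulr_ge0 ?invr_ge0 ?enorm_ge0// mulr_ge0// sqr_ge0.
Qed.

Lemma psieZ eta b a z : psie eta b (a *: z) = `|a| * psie eta b z.
Proof.
have [->|a0] := eqVneq a 0; first by rewrite scale0r psie0 normr0 mul0r.
have [->|z0] := eqVneq z 0; first by rewrite scaler0 psie0 mulr0.
rewrite !psieE enormZ dotZr.
have h : enorm z != 0 by rewrite enorm_eq0.
have h' : `|a| != 0 by rewrite normr_eq0.
rewrite exprMn -(real_normK (num_real a)). by field; rewrite h h'.
Qed.

Lemma psieN eta b z : psie eta b (- z) = psie eta b z.
Proof. by rewrite -scaleN1r psieZ normrN normr1 mul1r. Qed.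

Lemma psieNl eta b z : psie eta (- b) z = psie eta b z.
Proof. by rewrite !psieE toRN dotNl dotNr opprK dotNl sqrrN. Qed.

(** Cauchy-Schwarz bounds the second term by eta |b|^2 |z|, and 1 + eta <= 2. *)
Lemma psie_le eta b z : 0 <= eta <= 1 ->
  psie eta b z <= 2 * dot (toR b) (toR b) * enorm z.
Proof.
move=> /andP[e0 e1]; have [->|z0] := eqVneq z 0.
  by rewrite psie0 enorm0 mulr0.
have h : 0 < enorm z by rewrite enorm_gt0.
rewrite psieE -[_ * _ * enorm z]mulrA mulrDl mul1r lerD2l ler_pdivrMr//.
rewrite -mulrA -expr2 sqr_enorm.
have := dot_sqr_le (toR b) z; have := sqr_ge0 (dot (toR b) z); nra.
Qed.

Lemma psie_ge eta b z : 0 <= eta -> dot (toR b) (toR b) * enorm z <= psie eta b z.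
Proof.
move=> e0; rewrite psieE lerDl mulr_ge0 ?invr_ge0 ?enorm_ge0//.
by rewrite mulr_ge0// sqr_ge0.
Qed.

Lemma polar z : z != 0 -> exists2 u, enorm u = 1 & z = enorm z *: u.
Proof.
rewrite -enorm_gt0 => z0; exists ((enorm z)^-1 *: z).
  by rewrite enormZ gtr0_norm ?invr_gt0// mulVf// gt_eqF.
by rewrite scalerA mulfV ?gt_eqF// scale1r.
Qed.

(** Convexity in the form needed for Jensen's inequality: a linear function below psi_e that touches
    it at [z]. [G] is the gradient of psi_e at [z]; at the origin 0 serves. *)
Lemma psie_subgrad eta b z : 0 <= eta <= 1 ->
  exists2 G : 'rV[R]_n, dot G z = psie eta b z &
    forall w, dot G w <= psie eta b w.
Proof.
move=> /andP[e0 e1].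
have [->|z0] := eqVneq z 0.
  by exists 0; [rewrite dot0l psie0|move=> w; rewrite dot0l psie_ge0].
have nz : 0 < enorm z by rewrite enorm_gt0.
have [u u1 zu] := polar z0.
set B := toR b; set p := dot B u.
set G := dot B B *: u + (2 * eta * p) *: B - (eta * p ^+ 2) *: u.
have uu : dot u u = 1 by rewrite -sqr_enorm u1 expr1n.
exists G => [|w].
  rewrite zu psieZ dotZr gtr0_norm// psieE_unit// psiE -/B -/p /G.
  by rewrite dotBl dotDl !dotZl uu -/p; congr (_ * _); ring.
have [->|w0] := eqVneq w 0; first by rewrite dot0r psie0.
have nw : 0 < enorm w by rewrite enorm_gt0.
have [v v1 ->] := polar w0.
rewrite psieZ dotZr gtr0_norm// ler_wpM2l ?enorm_ge0// psieE_unit// psiE -/B.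
rewrite /G dotBl dotDl !dotZl; set r := dot B v; set k := dot u v.
have k1 : k <= 1 by have := le_trans (ler_norm _) (dot_le u v); rewrite u1 v1 mulr1.
have pB : p ^+ 2 <= dot B B by have := dot_sqr_le B u; rewrite uu mulr1.
(* The gap between psi (b, v) and G . v is eta (r - p)^2 + (|B|^2 - eta p^2) (1 - k), nonnegative
   because eta <= 1 and p^2 <= |B|^2. *)
have h1 : 0 <= eta * (r - p) ^+ 2 by rewrite mulr_ge0// sqr_ge0.
have h2 : 0 <= (dot B B - p ^+ 2) * (1 - k) by apply: mulr_ge0; lra.
have h3 : 0 <= p ^+ 2 * (1 - k) * (1 - eta).
  by apply: mulr_ge0; [apply: mulr_ge0; [exact: sqr_ge0|lra]|lra].
nra.
Qed.

Lemma psieD eta b z w : 0 <= eta <= 1 ->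
  psie eta b (z + w) <= psie eta b z + psie eta b w.
Proof.
move=> e01; have [G <- hG] := psie_subgrad b (z + w) e01.
by rewrite dotDr lerD.
Qed.

Lemma psie_lipschitz eta b z w : 0 <= eta <= 1 ->
  psie eta b w <= psie eta b z + 2 * dot (toR b) (toR b) * enorm (w - z).
Proof.
move=> e01; rewrite -[w in leLHS](subrK z) addrC (le_trans (psieD _ _ _ e01))//.
by rewrite lerD2l psie_le.
Qed.

(** Apply [weight_le] with [b'] and [s'], the parts of [b] and [s] orthogonal to b1 and b2. The
    squared norm of [b'] is an integer, being a polynomial in integer inner products; hence it is 0
    or at least 1. *)
Lemma psi_ge_weight eta b b1 b2 s : 0 <= eta <= 1 -> enorm s = 1 ->
  dot (toR b1) (toR b1) = 1 -> dot (toR b2) (toR b2) = 1 ->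
  dot (toR b1) (toR b2) = 0 ->
  forall x y, x = dot (toR b1) (toR b) -> y = dot (toR b2) (toR b) ->
  `|dcoef1 x y| * psi eta b1 s + `|dcoef2 x y| * psi eta b2 s +
  `|dcoef3 x y| * psi eta (b1 - b2) s + `|dcoef4 x y| * psi eta (b1 + b2) s
  <= psi eta b s.
Proof.
move=> e01 s1 b11 b22 b12 x y x_def y_def.
have ss : dot s s = 1 by rewrite -sqr_enorm s1 expr1n.
set a := dot (toR b1) s; set c := dot (toR b2) s.
set b' := toR b - x *: toR b1 - y *: toR b2.
set s' := s - a *: toR b1 - c *: toR b2.
have b21 : dot (toR b2) (toR b1) = 0 by rewrite dotC.
have bb1 : dot (toR b) (toR b1) = x by rewrite x_def dotC.
have bb2 : dot (toR b) (toR b2) = y by rewrite y_def dotC.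
have sb1 : dot s (toR b1) = a by rewrite dotC.
have sb2 : dot s (toR b2) = c by rewrite dotC.
have kE : dot b' b' = dot (toR b) (toR b) - x ^+ 2 - y ^+ 2.
  rewrite /b' !(dotBl, dotBr, dotZl, dotZr) b11 b22 b12 b21 bb1 bb2 -x_def -y_def.
  by ring.
have dE : dot s' s' = 1 - a ^+ 2 - c ^+ 2.
  rewrite /s' !(dotBl, dotBr, dotZl, dotZr) ss b11 b22 b12 b21 sb1 sb2 -/a -/c.
  by ring.
have qE : dot b' s' = dot (toR b) s - x * a - y * c.
  rewrite /b' /s' !(dotBl, dotBr, dotZl, dotZr) b11 b22 b12 b21 bb1 bb2 -?x_def -?y_def -/a -/c.
  by ring.
have [X xE] := dot_toR b1 b; have [Y yE] := dot_toR b2 b.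
have [K KE] := dot_toR b b.
have k01 : dot b' b' = 0 \/ 1 <= dot b' b'.
  have := dot_ge0 b'; rewrite kE KE x_def y_def xE yE.
  rewrite -!rmorphXn -!rmorphB/= (ler_int R 0) => k0.
  have [k1|k1] := leP 1 (K - X ^+ 2 - Y ^+ 2); first by right; rewrite (ler_int R 1).
  by left; rewrite (_ : _ - _ - _ = 0)//; lia.
have := weight_le X Y e01 _ (dot_ge0 s') (dot_sqr_le b' s') k01.
move=> /(_ a c); rewrite -xE -yE -x_def -y_def dE => /(_ ltac:(lra)).
rewrite kE qE /weight !psiE !toRD toRN b11 b22.
rewrite !(dotDl, dotDr, dotNl, dotNr) b11 b22 b12 b21 -/a -/c opprK oppr0.
rewrite !addr0 !add0r => h.
apply: le_trans h _; rewrite le_eqVlt; apply/orP; left; apply/eqP; ring.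
Qed.

End psi_theory.

(** * Borel sets are H^1-measurable *)

Section hausdorff_metric.
Context {R : realType} {n : nat}.
Local Notation E := 'rV[R]_n.
Local Open Scope ereal_scope.
Implicit Types A B X : set E.

Lemma le_ediam A B : A `<=` B -> ediam A <= ediam B.
Proof.
move=> AB; apply: le_ereal_sup; apply: setUS => _ [x Ax [y Ay <-]].
by exists x; [exact: AB|exists y => //; exact: AB].
Qed.

Lemma enorm_le_ediam A x y : A x -> A y -> (enorm (x - y))%:E <= ediam A.
Proof.
by move=> Ax Ay; apply: ereal_sup_ubound; right; exists x => //; exists y.
Qed.

Lemma ediam_le A (d : R) : (0 <= d)%R ->
  (forall x y, A x -> A y -> (enorm (x - y) <= d)%R) -> ediam A <= d%:E.
Proof.
move=> d0 h; apply: ge_ereal_sup => _ [->|[x Ax [y Ay <-]]]; rewrite lee_fin//.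
exact: h.
Qed.

Lemma hausdorff1_pre_nonincr A (d e : R) : (d <= e)%R ->
  hausdorff1_pre e A <= hausdorff1_pre d A.
Proof.
move=> de; apply: ereal_inf_le_tmp => _ [F [AF dF] <-]; exists F => //.
by split=> // k; rewrite (le_trans (dF k))// lee_fin.
Qed.

(** A cover by sets of diameter less than [d] has no member that meets both sets, so it splits into
    a cover of [A] and a cover of [B]. *)
Lemma hausdorff1_metric A B (d : R) : (0 < d)%R ->
  (forall x y, A x -> B y -> (d <= enorm (x - y))%R) ->
  hausdorff1 A + hausdorff1 B <= hausdorff1 (A `|` B).
Proof.
move=> d0 AB.
have pre e : (0 < e)%R -> (e < d)%R ->
    hausdorff1_pre e A + hausdorff1_pre e B <= hausdorff1 (A `|` B).
  move=> e0 ed; apply: le_trans (hausdorff1_pre_le _ e0).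
  apply: le_ereal_inf_tmp => _ [F [ABF eF] <-].
  (* [G C k] is [F k] if [F k] meets [C], and empty otherwise. *)
  pose G C k := [set x | F k x /\ exists2 y, F k y & C y].
  have GF C k : G C k `<=` F k by move=> x [].
  have cover C : C `<=` A `|` B -> hausdorff1_pre e C <= \sum_(k <oo) ediam (G C k).
    move=> CAB; apply: ereal_inf_lbound; exists (G C) => //; split.
      by move=> x Cx; have [k _ Fkx] := ABF _ (CAB _ Cx); exists k => //;
        split => //; exists x.
    by move=> k; apply: le_trans (eF k); exact/le_ediam/GF.
  have cA := cover A (@subsetUl _ _ _); have cB := cover B (@subsetUr _ _ _).
  rewrite (le_trans (leeD cA cB))// -nneseriesD//; last 2 first.
  - by move=> *; exact: ediam_ge0.
  - by move=> *; exact: ediam_ge0.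
  apply: lee_nneseries => [k _|k _].
    by rewrite adde_ge0// ediam_ge0.
  have [[x Fx Ax]|nA] := pselect (exists2 x, F k x & A x); last first.
    rewrite (_ : G A k = set0); first by rewrite ediam0 add0e; exact/le_ediam/GF.
    by apply/seteqP; split => // y [_ [z Fz Az]]; apply: nA; exists z.
  rewrite (_ : G B k = set0); first by rewrite ediam0 adde0; exact/le_ediam/GF.
  apply/seteqP; split => // y [_ [z Fz Bz]].
  have := enorm_le_ediam Fx Fz; rewrite leNgt => /negP; apply.
  by rewrite (le_lt_trans (eF k))// lte_fin (lt_le_trans ed)// AB.
have H0 C : -oo < hausdorff1 C by rewrite (lt_le_trans _ (hausdorff1_ge0 C)).
(* The suprema over the two mesh sizes are taken one after the other; each time the other summand,
   once known to be finite, is moved across the inequality. *)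
have [hB|hB] := eqVneq (hausdorff1 B) +oo.
  rewrite (_ : hausdorff1 (A `|` B) = +oo) ?leey//.
  by apply/eqP; rewrite -leye_eq -hB; apply: le_hausdorff1; exact: subsetUr.
have fB : hausdorff1 B \is a fin_num by rewrite ge0_fin_numE ?ltey ?hausdorff1_ge0.
rewrite -leeBrDr//; apply: ge_ereal_sup => _ [e1 /= e10 <-].
rewrite leeBrDr//.
have fA : hausdorff1_pre e1 A <= hausdorff1 (A `|` B).
  by rewrite (le_trans (hausdorff1_pre_le _ e10))// le_hausdorff1//; exact: subsetUl.
have [hA|hA] := eqVneq (hausdorff1_pre e1 A) +oo.
  by move: fA; rewrite hA leye_eq => /eqP ->; rewrite leey.
have fA' : hausdorff1_pre e1 A \is a fin_num.
  by rewrite ge0_fin_numE ?ltey ?hausdorff1_pre_ge0.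
rewrite addeC -leeBrDr//; apply: ge_ereal_sup => _ [e2 /= e20 <-].
rewrite leeBrDr// addeC.
pose e := Num.min (Num.min e1 e2) (d / 2)%R.
have e0 : (0 < e)%R by rewrite !lt_min e10 e20 divr_gt0.
have ed : (e < d)%R by rewrite gt_min ltr_pdivrMr// ltr_pMr// ltr1n orbT.
apply: le_trans (pre _ e0 ed); apply: leeD; apply: hausdorff1_pre_nonincr.
  by rewrite !ge_min lexx.
by rewrite !ge_min lexx orbT.
Qed.

(** Inner parallel sets, the exhaustion of Caratheodory's criterion. *)
Definition deep (U : set E) (k : nat) : set E :=
  [set x | forall y, ~ U y -> (k.+1%:R^-1 <= enorm (x - y))%R].

Lemma deep_sub U k : deep U k `<=` U.
Proof.
move=> x Ux; apply/not_notP => /Ux.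
by rewrite subrr enorm0 leNgt invr_gt0 ltr0n.
Qed.

Lemma deep_incr U k : deep U k `<=` deep U k.+1.
Proof.
move=> x Ux y /Ux; apply: le_trans.
by rewrite lef_pV2 ?posrE ?ltr0n// ler_nat.
Qed.

Lemma deep_mono U k l : (k <= l)%N -> deep U k `<=` deep U l.
Proof.
by move=> /subnK <-; elim: (l - k)%N => // m ih x /ih; exact: deep_incr.
Qed.

Lemma deep_sep U k x y : deep U k x -> ~ deep U k.+1 y ->
  (k.+1%:R^-1 - k.+2%:R^-1 <= enorm (x - y))%R.
Proof.
move=> Ux /existsNP[z /not_implyP[Uz /negP]]; rewrite -ltNge => yz.
rewrite lerBlDr (le_trans (Ux _ Uz))// (le_trans (enorm_triangle x y z))//.
by rewrite lerD2l ltW.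
Qed.

Lemma deep_gap_gt0 k : (0 < k.+1%:R^-1 - k.+2%:R^-1 :> R)%R.
Proof. by rewrite subr_gt0 ltf_pV2 ?posrE ?ltr0n// ltr_nat. Qed.

Lemma bigcup_deep U : open U -> U = \bigcup_k deep U k.
Proof.
move=> oU; apply/seteqP; split => [x Ux|x [k _]]; last exact: deep_sub.
have /nbhs_ballP[e /= e0 xeU] : nbhs x U by exact: open_nbhs_nbhs.
exists (Num.truncn e^-1); first by [].
move=> y Uy; rewrite leNgt; apply/negP => xy; apply/Uy/xeU.
rewrite -ball_normE/=; apply: le_lt_trans (le_norm_enorm _) _.
apply: lt_le_trans xy _.
rewrite invf_ple ?posrE ?ltr0n//.
by apply/ltW; have := truncn_le e^-1; rewrite -truncn_lt_nat// ?invr_ge0 ?ltW.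
Qed.

(** Only every second layer is taken: the omitted one keeps a layer at positive distance from all
    shallower ones, so [hausdorff1_metric] adds the measures up. The offset [s] selects the
    parity. *)
Lemma hausdorff1_telescope U X (s : nat) k :
  hausdorff1 (X `&` deep U s) +
  \sum_(0 <= l < k) hausdorff1 (X `&` (deep U (s + l.*2.+2) `\` deep U (s + l.*2.+1)))
  <= hausdorff1 (X `&` deep U (s + k.*2)).
Proof.
elim: k => [|k ih]; first by rewrite big_nil adde0 addn0.
rewrite big_nat_recr; last by [].
rewrite addeA; apply: le_trans (leeD2r _ ih) _.
set A := _ `&` _; set B := _ `&` _.
have AB x y : A x -> B y ->
    ((s + k.*2).+1%:R^-1 - (s + k.*2).+2%:R^-1 <= enorm (x - y))%R.
  by move=> [_ Ux] [_ [_]]; rewrite addnS; exact: deep_sep.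
apply: le_trans (hausdorff1_metric (deep_gap_gt0 _) AB) _.
apply: le_hausdorff1 => x [[Xx Ux]|[Xx [Ux _]]]; split => //.
  by rewrite doubleS !addnS; do 2 apply: deep_incr.
Qed.

(** Caratheodory's criterion. The parts of [X] in [deep U k] and outside [U] are a positive distance
    apart, so their measures add up; the rest of [X] lies in layers of summable measure and
    disappears as k grows. *)
Lemma open_caratheodory U : open U -> (@hausdorff1 R n).-caratheodory U.
Proof.
move=> oU; apply: le_caratheodory_measurable => X.
rewrite -[leLHS]/(hausdorff1 (X `&` U) + hausdorff1 (X `&` ~` U)).
rewrite -[leRHS]/(hausdorff1 X).
have [->|hX] := eqVneq (hausdorff1 X) +oo; first by rewrite leey.
have XU k : hausdorff1 (X `&` deep U k) + hausdorff1 (X `&` ~` U) <= hausdorff1 X.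
  apply: le_trans (hausdorff1_metric (d := k.+1%:R^-1) _ _) _.
  - by rewrite invr_gt0 ltr0n.
  - by move=> x y [_ Ux] [_ /Ux].
  - by apply: le_hausdorff1 => x [] [].
pose D s l := X `&` (deep U (s + l.*2.+2) `\` deep U (s + l.*2.+1)).
have tail s : \sum_(k <= l <oo) hausdorff1 (D s l) @[k --> \oo] --> 0.
  apply: nneseries_tail_cvg => [|*]; last exact: hausdorff1_ge0.
  apply: (@le_lt_trans _ _ (hausdorff1 X)); last by rewrite ltey.
  apply: lime_le; first by apply: is_cvg_nneseries => *; exact: hausdorff1_ge0.
  near=> k; apply: le_trans (le_hausdorff1 (@subIsetl _ X (deep U (s + k.*2)))).
  apply: le_trans (hausdorff1_telescope U X s k).
  by rewrite -[leLHS]add0e leeD// hausdorff1_ge0.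
have cover k : X `&` U `<=` X `&` deep U k.*2.+1 `|`
    (\bigcup_l D 0%N (l + k)%N `|` \bigcup_l D 1%N (l + k)%N).
  move=> x [Xx]; rewrite {1}(bigcup_deep oU) => -[m0 _ Um0].
  have /ex_minnP[m /asboolP Um mmin] : exists m, `[< deep U m x >].
    by exists m0; apply/asboolP.
  have [mk|km] := leqP m k.*2.+1.
    by left; split => //; exact: deep_mono Um.
  (* [m] is the first depth at which [x] appears, so [x] lies in the layer between m - 1 and m; the
     parity of [m] decides between the families [D 0] and [D 1]. *)
  right; have [l ml] : exists l, m = (l.*2.+2 + odd m)%N /\ (k <= l)%N.
    by exists (m./2).-1; lia.
  have Um' : ~ deep U m.-1 x.
    by move=> h; have := mmin m.-1; rewrite asboolT// => /(_ isT); lia.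
  case: ml => ml kl; case: (odd m) ml => ml.
    right; exists (l - k)%N => //; split => //; rewrite subnK//.
    by split; [rewrite add1n (_ : l.*2.+3 = m)//; lia|
               rewrite add1n (_ : l.*2.+2 = m.-1)//; lia].
  left; exists (l - k)%N => //; split => //; rewrite subnK//.
  by split; [rewrite add0n (_ : l.*2.+2 = m)//; lia|
             rewrite add0n (_ : l.*2.+1 = m.-1)//; lia].
have le_tail k s : hausdorff1 (\bigcup_l D s (l + k)%N) <=
    \sum_(k <= l <oo) hausdorff1 (D s l).
  rewrite -(nneseries_addn (f := fun l => hausdorff1 (D s l))).
    exact: hausdorff1_sigma_subadditive.
  by move=> ?; exact: hausdorff1_ge0.
have bound k : hausdorff1 (X `&` U) + hausdorff1 (X `&` ~` U) <=
    hausdorff1 X + (\sum_(k <= l <oo) hausdorff1 (D 0%N l) +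
                    \sum_(k <= l <oo) hausdorff1 (D 1%N l)).
  apply: le_trans (leeD2r _ (le_hausdorff1 (cover k))) _.
  apply: le_trans (leeD2r _ (outer_measureU2 _ _ _)) _.
  rewrite addeAC; apply: leeD; first exact: XU.
  by apply: le_trans (outer_measureU2 _ _ _) _; apply: leeD; exact: le_tail.
have lim : hausdorff1 X + (\sum_(k <= l <oo) hausdorff1 (D 0%N l) +
    \sum_(k <= l <oo) hausdorff1 (D 1%N l)) @[k --> \oo] --> hausdorff1 X.
  rewrite -[X in _ --> X]adde0 -[X in _ + X]adde0.
  apply: cvgeD => //; first by rewrite adde0 fin_num_adde_defl.
    exact: cvg_cst.
  exact: cvgeD.
rewrite -(cvg_lim _ lim)//; apply: lime_ge; first by apply/cvg_ex; eexists; exact: lim.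
by near=> k; exact: bound.
Unshelve. all: by end_near. Qed.

Lemma borel_H1_measurable A : <<s open >> A -> measurable (A : set (H1space R n)).
Proof. by apply: smallest_sub => //; [exact: sigma_algebra_measurable|exact: open_caratheodory]. Qed.

Lemma open_H1_measurable A : open A -> measurable (A : set (H1space R n)).
Proof. exact: open_caratheodory. Qed.

Lemma closed_H1_measurable A : closed A -> measurable (A : set (H1space R n)).
Proof.
by move=> cA; rewrite -[A]setCK; apply: measurableC; exact/open_H1_measurable/closed_openC.
Qed.

End hausdorff_metric.

Section continuity.
Context {R : realType} {T : topologicalType} {V : normedModType R}.

Lemma fun_continuousD (f g : T -> V) :
  continuous f -> continuous g -> continuous (fun x => f x + g x).
Proof. by move=> cf cg x; apply: (@continuousD _ _ _ f g); [exact: cf|exact: cg]. Qed.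

Lemma fun_continuousB (f g : T -> V) :
  continuous f -> continuous g -> continuous (fun x => f x - g x).
Proof. by move=> cf cg x; apply: (@continuousB _ _ _ f g); [exact: cf|exact: cg]. Qed.

Lemma fun_continuousM (f g : T -> R) :
  continuous f -> continuous g -> continuous (fun x => f x * g x).
Proof. by move=> cf cg x; apply: (@continuousM _ _ f g); [exact: cf|exact: cg]. Qed.

End continuity.

(** * H^1 along a line is Lebesgue measure *)

Section line_hausdorff.
Context {R : realType} {n : nat}.
Local Notation E := 'rV[R]_n.
Implicit Types (p v : E).

Lemma continuous_H1_measurable (f : E -> R) : continuous f ->
  measurable_fun [set: H1space R n] f.
Proof.
move=> cf; apply: (measurability _ (measurable_realfun.RGenOpens.measurableE R)).
move=> _ [_ [a [b ->] <-]]; rewrite setTI; apply: open_H1_measurable; apply: open_comp; last exact: interval_open.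
by move=> y _; exact: cf.
Qed.

Lemma dot_continuous v : continuous (fun x : E => dot x v).
Proof.
apply: continuous_big => [|i _]; first exact: add_continuous.
by apply: fun_continuousM; [exact: coord_continuous|exact: cst_continuous].
Qed.

Definition line_map p v (s : R) : E := p + s *: v.
Definition line_coord p v (x : E) : R := dot (x - p) v.

Lemma line_coord_continuous p v : continuous (line_coord p v).
Proof.
rewrite (_ : line_coord p v = (fun x => dot x v - dot p v)); last first.
  by apply/funext => x; rewrite /line_coord dotBl.
by apply: fun_continuousB; [exact: dot_continuous|exact: cst_continuous].
Qed.

Lemma line_map_continuous p v : continuous (line_map p v).
Proof.
apply: fun_continuousD; first exact: cst_continuous.
exact: scalel_continuous.
Qed.

Lemma line_mapK p v : enorm v = 1 -> cancel (line_map p v) (line_coord p v).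
Proof.
move=> v1 s; rewrite /line_coord /line_map addrAC subrr add0r dotZl.
by rewrite -sqr_enorm v1 expr1n mulr1.
Qed.

Lemma line_coord_le p v x y : enorm v = 1 ->
  line_coord p v x - line_coord p v y <= enorm (x - y).
Proof.
move=> v1; rewrite /line_coord -dotBl opprD addrACA subrr addr0.
by rewrite (le_trans (ler_norm _))// (le_trans (dot_le _ _))// v1 mulr1.
Qed.

Lemma enorm_line_map p v s r : enorm v = 1 ->
  enorm (line_map p v s - line_map p v r) = `|s - r|.
Proof.
by move=> v1; rewrite /line_map opprD addrACA subrr add0r -scalerBl enormZ v1 mulr1.
Qed.

Lemma range_line_map p v : enorm v = 1 ->
  range (line_map p v) = [set x | line_map p v (line_coord p v x) = x].
Proof.
move=> v1; apply/seteqP; split=> [_ [s _ <-]/=|x /= <-].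
  by rewrite line_mapK.
by exists (line_coord p v x).
Qed.

Lemma range_line_map_measurable p v : enorm v = 1 ->
  measurable (range (line_map p v) : set (H1space R n)).
Proof.
move=> v1; pose d (x : E) := line_map p v (line_coord p v x) - x.
have cd : continuous d.
  apply: fun_continuousB => x; last exact: cvg_id.
  apply: (@continuous_comp _ _ _ (line_coord p v) (line_map p v)).
    exact: line_coord_continuous.
  exact: line_map_continuous.
have cld : closed (d @^-1` [set 0]).
  by apply: closed_comp => [x _|]; [exact: cd|exact/accessible_closed_set1/hausdorff_accessible/norm_hausdorff].
have -> : range (line_map p v) = d @^-1` [set 0].
  rewrite range_line_map//; apply/seteqP; split=> x /=.
    by rewrite /d => ->; rewrite subrr.
  by move/eqP; rewrite subr_eq0 => /eqP.
exact: closed_H1_measurable.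
Qed.

Local Open Scope ereal_scope.

Lemma hausdorff1_line_map_le p v (a b : R) : enorm v = 1%R -> (a <= b)%R ->
  hausdorff1 (line_map p v @` `]a, b]) <= (b - a)%:E.
Proof.
move=> v1 ab; apply: ge_ereal_sup => _ [d /= d0 <-].
pose N := (Num.truncn ((b - a) / d)).+1.
pose h := ((b - a) / N%:R)%R.
have N0 : (0 < N%:R :> R)%R by rewrite ltr0n.
have h0 : (0 <= h)%R by rewrite divr_ge0// subr_ge0.
have hd : (h <= d)%R.
  rewrite ler_pdivrMr// mulrC -ler_pdivrMr//; apply/ltW; exact: truncnS_gt.
pose F (k : nat) : set E := if (k < N)%N then
  line_map p v @` `[(a + k%:R * h)%R, (a + k.+1%:R * h)%R] else set0.
have dF k : ediam (F k) <= (if (k < N)%N then h%:E else 0).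
  rewrite /F; case: ifP => _; last by rewrite ediam0.
  apply: ediam_le => // _ _ [s sk <-] [r rk <-]; rewrite enorm_line_map//.
  move: sk rk; rewrite /= !in_itv/= -natr1 => /andP[? ?] /andP[? ?].
  by rewrite ler_norml; apply/andP; split; lra.
apply: (@le_trans _ _ (\sum_(k <oo) ediam (F k))).
  apply: ereal_inf_lbound; exists F => //; split; last first.
    move=> k; apply: le_trans (dF k) _.
    by case: ifP => _; rewrite lee_fin// ltW.
  move=> _ [s /= + <-]; rewrite in_itv/= => /andP[as_ sb].
  have ab' : (a < b)%R by apply: lt_le_trans sb.
  have h0' : (0 < h)%R by rewrite divr_gt0// subr_gt0.
  have ba : (b - a = N%:R * h)%R by rewrite /h mulrC divfK// gt_eqF.
  pose k := Num.truncn ((s - a) / h).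
  have sa0 : (0 <= (s - a) / h)%R by rewrite divr_ge0// subr_ge0 ltW.
  have /andP[k1 k2] := truncn_itv sa0.
  move: k1 k2; rewrite ler_pdivlMr// ltr_pdivrMr// => k1 k2.
  have [kN|kN] := ltnP k N.
    exists k => //; rewrite /F kN; exists s => //=; rewrite in_itv/=.
    by apply/andP; split; [rewrite -/k in k1; lra|rewrite -/k in k2; lra].
  (* Only s = b leads here, and it belongs to the last closed piece. *)
  exists N.-1 => //; rewrite /F ltnSn; exists s => //=; rewrite in_itv/=.
  have kN' : (N%:R * h <= k%:R * h)%R by rewrite ler_wpM2r// ler_nat.
  rewrite -/k in k1.
  have NN : (N.-1%:R * h <= N%:R * h)%R by rewrite ler_wpM2r// ler_nat leq_pred.
  have -> : N.-1.+1 = N by [].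
  by apply/andP; split; lra.
apply: lime_le; first by apply: is_cvg_nneseries => *; exact: ediam_ge0.
apply: nearW => m; apply: (@le_trans _ _ ((minn m N)%:R * h)%:E).
  elim: m => [|m ih]; first by rewrite big_nil min0n mul0r.
  rewrite big_nat_recr; last by [].
  apply: le_trans (leeD ih (dF m)) _; case: ifP => mN; rewrite -EFinD lee_fin.
    rewrite (minn_idPl mN) (minn_idPl (ltnW mN)) -natr1; lra.
  rewrite addr0 ler_wpM2r// ler_nat; move: mN; lia.
have -> : (b - a = N%:R * h)%R by rewrite /h mulrC divfK// gt_eqF.
by rewrite lee_fin ler_wpM2r// ler_nat geq_minr.
Qed.

(** Projection to the line does not increase diameters. Each projected set is enlarged to the closed
    interval from its infimum to its supremum, which is measurable and no longer than the diameter,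
    and subadditivity of Lebesgue measure concludes. *)
Lemma hausdorff1_line_map_ge p v (a b : R) : enorm v = 1%R -> (a <= b)%R ->
  (b - a)%:E <= hausdorff1 (line_map p v @` `]a, b]).
Proof.
(* The mesh 1 makes all diameters in the cover finite. *)
move=> v1 ab; apply: le_trans (hausdorff1_pre_le _ ltr01).
apply: le_ereal_inf_tmp => _ [F [abF dF] <-].
pose P k := line_coord p v @` F k.
pose I k : set R := if pselect (F k !=set0) then `[inf (P k), sup (P k)]%classic else set0.
pose D k := fine (ediam (F k)).
have DE k : ediam (F k) = (D k)%:E.
  rewrite fineK// ge0_fin_numE ?ediam_ge0//.
  by apply: le_lt_trans (dF k) _; rewrite ltry.
have PD k x y : P k x -> P k y -> (x - y <= D k)%R.
  move=> [x' Fx <-] [y' Fy <-]; apply: le_trans (line_coord_le _ _ _ v1) _.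
  by rewrite -lee_fin -DE; exact: enorm_le_ediam.
have mI k : measurable (I k) by rewrite /I; case: pselect => ?; [exact: measurable_itv|exact: measurable0].
have supP k : F k !=set0 -> has_sup (P k).
  move=> [x Fx]; split; first by exists (line_coord p v x), x.
  exists (line_coord p v x + D k)%R => y Py.
  by have := PD k y (line_coord p v x) Py (ex_intro2 _ _ x Fx erefl); lra.
have infP k : F k !=set0 -> has_inf (P k).
  move=> [x Fx]; split; first by exists (line_coord p v x), x.
  exists (line_coord p v x - D k)%R => y Py.
  by have := PD k (line_coord p v x) y (ex_intro2 _ _ x Fx erefl) Py; lra.
have lI k : lebesgue_measure (I k) <= ediam (F k).
  rewrite DE /I; case: pselect => [F0|nF]; last first.
    by rewrite measure0 lee_fin fine_ge0 ?ediam_ge0.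
  have [x Px] := (supP _ F0).1.
  rewrite lebesgue_measure_itv/= lte_fin; case: ifPn => _; last first.
    by rewrite lee_fin fine_ge0 ?ediam_ge0.
  rewrite lee_fin lerBlDl; apply: sup_le_ub; first by exists x.
  move=> y Py; rewrite -lerBlDr; apply: lb_le_inf; first by exists x.
  by move=> z Pz; have := PD _ _ _ Py Pz; lra.
have abI : `]a, b]%classic `<=` \bigcup_k I k.
  move=> s sab; have [k _ Fk] := abF _ (ex_intro2 _ _ s sab erefl).
  exists k => //; rewrite /I; case: pselect => [F0|nF]; last first.
    by case: nF; exists (line_map p v s).
  have Ps : P k s by exists (line_map p v s) => //; rewrite line_mapK.
  rewrite /= in_itv/=; apply/andP; split.
    by apply: ge_inf => //; exact: (infP _ F0).2.
  by apply: ub_le_sup => //; exact: (supP _ F0).2.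
have <- : lebesgue_measure `]a, b]%classic = (b - a)%:E.
  rewrite lebesgue_measure_itv/= lte_fin; case: ifPn => //.
  rewrite -leNgt => ba.
  by rewrite (_ : b = a) ?subrr//; apply/eqP; rewrite eq_le ba.
apply: (@le_trans _ _ (\sum_(k <oo) lebesgue_measure (I k))).
  exact: measure_sigma_subadditive.
exact: lee_nneseries.
Qed.

End line_hausdorff.

Section line_integral.
Context {R : realType} {n : nat}.
Local Notation E := 'rV[R]_n.
Local Notation H1 := (@H1 R n).
Implicit Types (p v : E).
Local Open Scope ereal_scope.

Lemma line_coord_measurable p v :
  measurable_fun [set: H1space R n] (line_coord p v : _ -> measurableTypeR R).
Proof. exact/continuous_H1_measurable/line_coord_continuous. Qed.

Lemma line_image p v (D : set R) : enorm v = 1%R ->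
  line_map p v @` D = line_coord p v @^-1` D `&` range (line_map p v).
Proof.
move=> v1; apply/seteqP; split=> [_ [s Ds <-]|x [/= + [s sT sx]]].
  by split; [rewrite /= line_mapK|exists s].
by rewrite -sx line_mapK// => Ds; exists s.
Qed.

Lemma line_preimage_measurable p v (D : set (measurableTypeR R)) :
  measurable D -> measurable (line_coord p v @^-1` D : set (H1space R n)).
Proof.
by move=> mD; rewrite -[X in measurable X]setTI; exact: line_coord_measurable.
Qed.

Lemma line_image_measurable p v (D : set (measurableTypeR R)) : enorm v = 1%R ->
  measurable D -> measurable (line_map p v @` D : set (H1space R n)).
Proof.
move=> v1 mD; rewrite line_image//; apply: measurableI.
  exact: line_preimage_measurable.
exact: range_line_map_measurable.
Qed.

(** H^1 restricted to the line and transported by [line_coord] agrees with Lebesgue measure on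
    half-open intervals, hence on all measurable sets. *)
Lemma H1_line p v (D : set (measurableTypeR R)) : enorm v = 1%R -> measurable D ->
  H1 (line_map p v @` D) = lebesgue_measure D.
Proof.
move=> v1.
pose Hline := mrestr H1 (range_line_map_measurable p v1).
have mc := line_coord_measurable p v.
pose c := line_coord p v : H1space R n -> measurableTypeR R.
unshelve refine (let nu : {measure set (measurableTypeR R) -> \bar R} :=
  pushforward Hline c in _); first exact: mc.
have nuE A : nu A = H1 (line_map p v @` A).
  exact: (congr1 H1 (esym (line_image p A v1))).
move=> mD; rewrite -nuE; apply/esym.
apply: lebesgue_measure_unique => // X [[a b] _ <-] /=; rewrite nuE.
have [ab|ba] := leP a b.
  rewrite lebesgue_measure_itv/= lte_fin.
  have -> : (if (a < b)%R then b%:E - a%:E else 0) = (b - a)%:E.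
    case: ifPn => //; rewrite -leNgt => ba.
    by rewrite (_ : b = a) ?subrr//; apply/eqP; rewrite eq_le ba.
  apply/eqP; rewrite eq_le; apply/andP; split.
    exact: hausdorff1_line_map_ge.
  exact: hausdorff1_line_map_le.
by rewrite set_itv_ge ?bnd_simp -?leNgt ?ltW// image_set0 !measure0.
Qed.

(** The transported measure turns the integral into one over the whole preimage of [D]; off the line
    the restricted measure vanishes. *)
Lemma integral_line p v (D : set (measurableTypeR R)) (f : E -> R) :
  enorm v = 1%R -> measurable D ->
  measurable_fun [set: measurableTypeR R] (fun s => f (line_map p v s)) ->
  H1.-integrable (line_map p v @` D) (fun x => (f x)%:E) ->
  \int[H1]_(x in line_map p v @` D) (f x)%:E =
  \int[lebesgue_measure]_(s in D) (f (line_map p v s))%:E.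
Proof.
move=> v1 mD mf fint.
set G := range (line_map p v); have mG := range_line_map_measurable p v1.
pose Hline := mrestr H1 mG.
have mc := line_coord_measurable p v.
pose c := line_coord p v : H1space R n -> measurableTypeR R.
unshelve refine (let nu : {measure set (measurableTypeR R) -> \bar R} :=
  pushforward Hline c in _); first exact: mc.
have mcD := line_preimage_measurable p v mD.
have mL := line_image_measurable p v1 mD.
pose g (s : R) := (f (line_map p v s))%:E.
have mg : measurable_fun [set: measurableTypeR R] (fun s => (f (line_map p v s))%:E).
  exact/measurable_EFinP.
have mgc := measurableT_comp mg mc.
have DG : c @^-1` D `\` ~` G = line_map p v @` D.
  by rewrite setDE setCK line_image.
have HlineC : Hline (~` G) = 0.
  by rewrite /Hline /mrestr setICl measure0.
have HlineE (h : H1space R n -> \bar R) :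
    \int[Hline]_(x in line_map p v @` D) h x = \int[H1]_(x in line_map p v @` D) h x.
  apply: eq_measure_integral => A mA AL; apply: (congr1 H1); apply: setIidl.
  by move=> x /AL [s _ <-]; exists s.
have gcE x : (line_map p v @` D) x -> (g \o c) x = (f x)%:E.
  by move=> [s _ <-] /=; rewrite /g /c line_mapK.
have Hint : Hline.-integrable (c @^-1` D) (g \o c).
  apply/integrableP; split; first exact: measurable_funTS.
  have mabs : measurable_fun (c @^-1` D) (fun x => `|(g \o c) x|).
    by apply: measurableT_comp => //; exact: measurable_funTS.
  have -> := @ge0_negligible_integral _ _ R Hline _ _ _ (measurableC mG) mcD mabs
    (fun x _ => abse_ge0 _) HlineC.
  rewrite DG HlineE; move/integrableP : fint => [_]; apply: le_lt_trans.
  rewrite le_eqVlt; apply/orP; left; apply/eqP; apply: eq_integral => x xD.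
  by rewrite gcE//; exact: set_mem.
transitivity (\int[nu]_(s in D) g s); last first.
  apply: eq_measure_integral => A mA _.
  exact: (etrans (congr1 H1 (esym (line_image p A v1))) (H1_line p v1 mA)).
have -> : \int[nu]_(s in D) g s = \int[Hline]_(x in c @^-1` D) (g \o c) x.
  exact: (integral_pushforward mc mg Hint mD).
rewrite (negligible_integral (measurableC mG) mcD Hint HlineC) DG HlineE.
by apply: eq_integral => x xD; rewrite gcE//; exact: set_mem.
Qed.

End line_integral.

(** * Smooth cut-off functions *)

Section flat_functions.
Context {R : realType}.
Implicit Types (P : {poly R}) (x y : R).

Definition flat P x : R := if 0 < x then P.[x^-1] * expR (- x^-1) else 0.

(** For x > 0 the derivative of P(1/x) exp (-1/x) is x^(-2) (P - P')(1/x) exp (-1/x). *)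
Definition flat_deriv P : {poly R} := 'X^2 * (P - deriv P).

Lemma exp_bounds_pow y k : 0 <= y -> y ^+ k <= k`!%:R * expR y.
Proof.
case: k => [|k] y0; first by rewrite expr0 fact0 mul1r (le_trans _ (expR_ge1Dx y))// lerDl.
have := expR_ge1Dxn k y0; rewrite -ler_pdivrMl ?ltr0n ?fact_gt0// mulrC; lra.
Qed.

(** Makes the difference quotient at 0 tend to 0. With y = 1/x, the k-th coefficient is controlled
    by y^(k+2) <= (k+2)! exp y. *)
Lemma flat_quadratic P : exists2 C, 0 <= C & forall x, `|flat P x| <= C * x ^+ 2.
Proof.
exists (\sum_(k < size P) `|P`_k| * (k.+2)`!%:R).
  by apply: sumr_ge0 => k _; rewrite mulr_ge0.
move=> x; rewrite /flat; case: ifPn => [x0|_]; last first.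
  by rewrite normr0 mulr_ge0 ?sqr_ge0 ?sumr_ge0// => k _; rewrite mulr_ge0.
have y0 : 0 < x^-1 by rewrite invr_gt0.
set y := x^-1 in y0 *.
have -> : x = y^-1 by rewrite invrK.
rewrite normrM (ger0_norm (expR_ge0 _)) expRN exprVn.
rewrite ler_pdivrMr ?expR_gt0// mulrAC ler_pdivlMr ?exprn_gt0//.
rewrite horner_coef mulr_suml; apply: le_trans.
  apply: ler_wpM2r; [exact: sqr_ge0|exact: ler_norm_sum].
rewrite !mulr_suml; apply: ler_sum => k _.
rewrite normrM normrX (ger0_norm (ltW y0)) -!mulrA ler_wpM2l//.
by rewrite -exprD addn2 exp_bounds_pow// ltW.
Qed.

Lemma is_derive_flat P x : is_derive x 1 (flat P) (flat (flat_deriv P) x).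
Proof.
have [x0|x0|<-] := ltgtP 0 x.
- apply: (@near_eq_is_derive R R R (fun z : R => P.[z^-1] * expR (- z^-1))).
    near=> z; rewrite /flat ifT//; near: z; exact: lt_nbhsr.
  have xn0 : x != 0 by rewrite gt_eqF.
  have dV : is_derive x 1 (fun z : R => z^-1) (- x ^- 2).
    have did : is_derive x (1 : R) (@id R) 1 by exact: is_derive_id.
    by have := @is_deriveV R id x 1 1 xn0 did; rewrite scaler1.
  have dP := @is_derive1_comp R (horner P) (fun z => z^-1) x _ _ _ dV.
  have dE := @is_derive1_comp R expR (fun z => - z^-1) x _ _ _ (is_deriveN dV).
  apply: is_derive_eq; rewrite /flat x0 /flat_deriv !hornerE.
  rewrite -![_ *: _]/(_ * _) !exprVn; ring.
- apply: (@near_eq_is_derive R R R (cst 0)).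
    near=> z; rewrite /flat ifN// -leNgt ltW//; near: z; exact: lt_nbhsl.
  by rewrite /flat ifN ?lt_asym ?x0//; [exact: is_derive_cst|rewrite -leNgt ltW].
- have -> : flat (flat_deriv P) 0 = 0 by rewrite /flat ltxx.
  have [C C0 fC] := flat_quadratic P.
  suff h : (fun h : R => h^-1 *: ((flat P \o shift 0) (h *: (1 : R)) - flat P 0))
      @ 0^' --> (0 : R).
    apply: DeriveDef; first by apply/cvg_ex; exists 0.
    by rewrite /derive; exact: cvg_lim h.
  apply/cvgrPdist_le => e e0; near=> h.
  rewrite sub0r normrN /= addr0 scaler1 [flat P 0]/flat ltxx subr0.
  rewrite normrM normfV.
  have h0 : h != 0 by near: h; exact: nbhs_dnbhs_neq.
  rewrite ler_pdivrMl ?normr_gt0//; apply: le_trans (fC _) _.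
  rewrite -(real_normK (num_real h)) expr2 mulrC -mulrA ler_wpM2l//.
  have h1 : `|h| <= e / (C + 1).
    near: h; apply: dnbhs0_le; rewrite divr_gt0//; lra.
  have C1 : 0 < C + 1 by lra.
  rewrite mulrC; apply: le_trans (_ : (C + 1) * `|h| <= e).
    by rewrite ler_wpM2r// lerDl.
  by rewrite mulrC -ler_pdivlMr.
Unshelve. all: by end_near. Qed.

Lemma flat_continuous P : continuous (flat P).
Proof.
move=> x; apply/differentiable_continuous/derivable1_diffP.
by have [] := is_derive_flat P x.
Qed.

Lemma flat0 P x : x <= 0 -> flat P x = 0.
Proof. by rewrite /flat ltNge => ->. Qed.

End flat_functions.

Section smooth_functions.
Context {R : realType} {n : nat}.
Local Notation E := 'rV[R]_n.
Implicit Types (f g phi : E -> R) (k : nat).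

Lemma derivable_flat_comp P f (x v : E) : derivable f x v ->
  derivable (fun y => flat P (f y)) x v /\
  'D_v (fun y => flat P (f y)) x = flat (flat_deriv P) (f x) * 'D_v f x.
Proof.
move=> df; have D (h : E -> R) : 'D_v h x = 'D_1 (fun s : R => h (s *: v + x)) 0.
  rewrite /derive; set g1 := fun h => h^-1 *: _; set g2 := fun h => h^-1 *: _.
  suff -> : g1 = g2 by [].
  by rewrite funeqE /g1 /g2 => s /=; rewrite addr0 scale0r add0r [_%:A]mulr1.
have /derivable1P df1 := df.
have dF : is_derive (f (0 *: v + x)) (1 : R) (flat P) (flat (flat_deriv P) (f x)).
  by rewrite scale0r add0r; exact: is_derive_flat.
have dg : is_derive (0 : R) (1 : R) (fun s : R => f (s *: v + x)) ('D_v f x).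
  by rewrite D; exact: derivableP.
have [h1 h2] := @is_derive1_comp R (flat P) (fun s : R => f (s *: v + x)) 0 _ _ dF dg.
by split; [apply/derivable1P|rewrite D].
Qed.

Lemma CkW k f : Ck k.+1 f -> Ck k f.
Proof.
elim: k f => [|k ih] f [cf df]; first by split.
by split => // j; have [d1 d2] := df j; split => //; exact: ih.
Qed.

Lemma Ck_continuous k f : Ck k f -> continuous f.
Proof. by case: k => [|k] []. Qed.

Lemma Ck_cst k (c : R) : Ck k (fun _ : E => c).
Proof.
elim: k c => [|k ih] c; first by split; [exact: cst_continuous|].
split; first exact: cst_continuous.
move=> j; split => [x|]; first exact: derivable_cst.
rewrite (_ : pderiv j _ = fun=> 0); first exact: ih.
by apply/funext => x; rewrite /pderiv derive_cst.
Qed.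

Lemma CkD k f g : Ck k f -> Ck k g -> Ck k (fun x => f x + g x).
Proof.
elim: k f g => [|k ih] f g [cf df] [cg dg].
  by split => //; exact: fun_continuousD.
split; first exact: fun_continuousD.
move=> j; have [df1 df2] := df j; have [dg1 dg2] := dg j; split=> [x|].
  exact: (@derivableD _ _ _ f g x).
rewrite (_ : pderiv j _ = fun x => pderiv j f x + pderiv j g x); first exact: ih.
by apply/funext => x; rewrite /pderiv (@deriveD _ _ _ f g x).
Qed.

Lemma CkM k f g : Ck k f -> Ck k g -> Ck k (fun x => f x * g x).
Proof.
elim: k f g => [|k ih] f g hf hg; have cf := Ck_continuous hf;
    have cg := Ck_continuous hg.
  by split => //; exact: fun_continuousM.
split; first exact: fun_continuousM.
have hf' := CkW hf; have hg' := CkW hg; case: hf => _ df; case: hg => _ dg.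
move=> j; have [df1 df2] := df j; have [dg1 dg2] := dg j; split=> [x|].
  exact: (@derivableM _ _ f g x).
rewrite (_ : pderiv j _ = fun x => f x * pderiv j g x + g x * pderiv j f x).
  by apply: CkD; apply: ih.
by apply/funext => x; rewrite /pderiv (@deriveM _ _ f g x).
Qed.

Lemma Ck_flat k P f : Ck k f -> Ck k (fun x => flat P (f x)).
Proof.
elim: k P f => [|k ih] P f hf; have cf := Ck_continuous hf.
  by split => // x; apply: continuous_comp; [exact: cf|exact: flat_continuous].
split; first by move=> x; apply: continuous_comp; [exact: cf|exact: flat_continuous].
have hf' := CkW hf; case: hf => _ df.
move=> j; have [df1 df2] := df j; split=> [x|].
  by have [] := derivable_flat_comp P (df1 x).
rewrite (_ : pderiv j _ = fun x => flat (flat_deriv P) (f x) * pderiv j f x).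
  by apply: CkM => //; exact: ih.
by apply/funext => x; rewrite /pderiv; have [] := derivable_flat_comp P (df1 x).
Qed.

Lemma coord_derive (i : 'I_n) (x v : E) :
  derivable (fun y : E => y 0 i) x v /\ 'D_v (fun y : E => y 0 i) x = v 0 i.
Proof.
suff h : (fun h : R => h^-1 *: (((fun y : E => y 0 i) \o shift x) (h *: v) - x 0 i))
      @ 0^' --> v 0 i.
  by split; [apply/cvg_ex; exists (v 0 i)|exact: cvg_lim h].
apply: cvg_near_cst; near=> h.
have h0 : h != 0 by near: h; exact: nbhs_dnbhs_neq.
by rewrite /= !mxE addrK /GRing.scale/= mulKf.
Unshelve. all: by end_near. Qed.

Lemma Ck_coord k (i : 'I_n) : Ck k (fun x : E => x 0 i).
Proof.
have c : continuous (fun x : E => x 0 i) by exact: coord_continuous.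
case: k => [|k]; first by split.
split => // j; split => [x|]; first by have [] := coord_derive i x (delta_mx 0 j).
rewrite (_ : pderiv j _ = fun=> (delta_mx 0 j : E) 0 i); first exact: Ck_cst.
by apply/funext => x; rewrite /pderiv; have [] := coord_derive i x (delta_mx 0 j).
Qed.

Lemma Ck_sum k (I : Type) (r : seq I) (f : I -> E -> R) :
  (forall i, Ck k (f i)) -> Ck k (fun x => \sum_(i <- r) f i x).
Proof.
move=> hf; elim: r => [|i r ih].
  by under eq_fun do rewrite big_nil; exact: Ck_cst.
by under eq_fun do rewrite big_cons; exact: CkD.
Qed.

Lemma Ck_dot k : Ck k (fun x : E => dot x x).
Proof. by apply: Ck_sum => i; apply: CkM; exact: Ck_coord. Qed.

Lemma dotxx_continuous : continuous (fun x : E => dot x x).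
Proof. exact: Ck_continuous (Ck_dot 0). Qed.

Lemma enorm_lt_sqr (x : E) (r : R) : 0 <= r -> (enorm x < r) = (dot x x < r ^+ 2).
Proof. by move=> r0; rewrite -sqr_enorm ltr_sqr ?nnegrE ?enorm_ge0. Qed.

Lemma enorm_le_sqr (x : E) (r : R) : 0 <= r -> (enorm x <= r) = (dot x x <= r ^+ 2).
Proof. by move=> r0; rewrite -sqr_enorm ler_sqr ?nnegrE ?enorm_ge0. Qed.

Lemma open_enorm_lt (r : R) : open [set x : E | enorm x < r].
Proof.
have [r0|r0] := leP 0 r; last first.
  rewrite (_ : mkset _ = set0); first exact: open0.
  by apply/seteqP; split => // x /=; rewrite ltNge (le_trans (ltW r0) (enorm_ge0 _)).
rewrite (_ : mkset _ = (fun x : E => dot x x) @^-1` [set s | s < r ^+ 2]).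
  by apply: open_comp => [x _|]; [exact: dotxx_continuous|exact: open_lt].
by apply/seteqP; split => x /=; rewrite enorm_lt_sqr.
Qed.

Lemma closed_enorm_le (r : R) : closed [set x : E | enorm x <= r].
Proof.
have [r0|r0] := leP 0 r; last first.
  rewrite (_ : mkset _ = set0); first exact: closed0.
  by apply/seteqP; split => // x /=; rewrite leNgt (lt_le_trans r0 (enorm_ge0 _)).
rewrite (_ : mkset _ = (fun x : E => dot x x) @^-1` [set s | s <= r ^+ 2]).
  by apply: closed_comp => [x _|]; [exact: dotxx_continuous|exact: closed_le].
by apply/seteqP; split => x /=; rewrite enorm_le_sqr.
Qed.

Lemma compact_enorm_le (r : R) : compact [set x : E | enorm x <= r].
Proof.
apply: bounded_closed_compact; last exact: closed_enorm_le.
exists r; split; first exact: num_real.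
move=> M rM x /= xr; apply: le_trans (le_norm_enorm x) _.
by rewrite (le_trans xr)// ltW.
Qed.

Lemma test_function_eball (phi : E -> R) (r s : R) : r < s ->
  (forall k, Ck k phi) -> (forall x, r < enorm x -> phi x = 0) ->
  test_function (eball 0 s) phi.
Proof.
move=> rs cphi phi0.
have sub : closure [set x | phi x != 0] `<=` [set x | enorm x <= r].
  rewrite [X in _ `<=` X]((closure_id _).1 (@closed_enorm_le r)).
  apply: closure_subset => x /=; apply: contra_neqT.
  by rewrite -ltNge => /phi0.
split => //; last by move=> x /sub /=; rewrite /eball /= subr0; move=> h; exact: le_lt_trans rs.
apply: (subclosed_compact _ (@compact_enorm_le r) sub); exact: closed_closure.
Qed.

(** The linear test function x_l, multiplied by a cut-off that is 1 on the ball of radius [r] and 0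
    outside that of radius [s]. *)
Lemma coord_cutoff (l : 'I_n) (r s : R) : 0 < r -> r < s ->
  exists phi : E -> R, [/\ forall k, Ck k phi,
    forall x, s < enorm x -> phi x = 0 &
    forall x, enorm x < r -> forall j, pderiv j phi x = (j == l)%:R].
Proof.
move=> r0 rs; set c : R := flat 1 1.
have c0 : 0 < c by rewrite /c /flat ltr01 hornerE mul1r expR_gt0.
have rs2 : 0 < s ^+ 2 - r ^+ 2 by rewrite subr_gt0 ltr_sqr ?nnegrE//; lra.
(* [u] is at most 0 on the inner ball, where [xi] is then 1, and at least 1 outside the outer ball,
   where the argument of the outer [flat 1] is then at most 0. *)
pose u (x : E) := (s ^+ 2 - r ^+ 2)^-1 * (dot x x + - r ^+ 2).
pose xi (x : E) := c^-1 * flat 1 (1 + (- c^-1) * flat 1 (u x)).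
have Cxi k : Ck k xi.
  apply: CkM; first exact: Ck_cst.
  apply: Ck_flat; apply: CkD; first exact: Ck_cst.
  apply: CkM; first exact: Ck_cst.
  apply: Ck_flat; apply: CkM; first exact: Ck_cst.
  by apply: CkD; [exact: Ck_dot|exact: Ck_cst].
exists (fun x : E => x 0 l * xi x); split.
- by move=> k; apply: CkM => //; exact: Ck_coord.
- move=> x; have s0 : 0 <= s by lra.
  rewrite ltNge enorm_le_sqr// -ltNge => sx.
  have u1 : 1 <= u x by rewrite /u ler_pdivlMl// mulr1; lra.
  rewrite /xi (flat0 _ (x := 1 + _)) ?mulr0// mulNr subr_le0.
  rewrite ler_pdivlMl// mulr1 /c /flat ltr01 ifT; last by lra.
  by rewrite !hornerE ler_expR lerN2 invr1 invf_le1//; lra.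
- move=> x xr j.
  have rx : \near x, (fun x : E => x 0 l * xi x) x = (fun x : E => x 0 l) x.
    have : nbhs x [set y : E | enorm y < r].
      by apply: open_nbhs_nbhs; split => //; exact: open_enorm_lt.
    apply: filterS => y /= yr; rewrite (_ : xi y = 1) ?mulr1//.
    rewrite /xi (flat0 _ (x := u y)) ?mulr0 ?addr0 ?mulVf ?gt_eqF//.
    rewrite /u pmulr_rle0 ?invr_gt0// subr_le0 ltW//.
    by rewrite -enorm_lt_sqr// ltW.
  rewrite /pderiv (near_eq_derive _ rx) (coord_derive l x (delta_mx 0 j)).2.
  by rewrite mxE eqxx/= eq_sym.
Qed.

End smooth_functions.

(** * Integrating a gradient along a segment *)

Section directional_derivative.
Context {R : realType} {n : nat}.
Local Notation E := 'rV[R]_n.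
Implicit Types (f phi : E -> R) (x y v : E).

Lemma is_derive_line f y v (s : R) : derivable f (line_map y v s) v ->
  is_derive s (1 : R) (fun r => f (line_map y v r)) ('D_v f (line_map y v s)).
Proof.
move=> df; have e : (fun h : R => h^-1 *: (((fun r => f (line_map y v r)) \o shift s)
      (h *: (1 : R)) - f (line_map y v s))) =
    (fun h : R => h^-1 *: ((f \o shift (line_map y v s)) (h *: v) -
      f (line_map y v s))).
  apply/funext => h /=; rewrite [h *: 1]mulr1 /line_map.
  by rewrite scalerDl addrCA.
by apply: DeriveDef; rewrite /derivable /derive e.
Qed.

Lemma mean_value (g dg : R -> R) (a : R) :
  (forall s : R, is_derive s (1 : R) g (dg s)) ->
  exists2 c, `|c| <= `|a| & g a - g 0 = dg c * a.
Proof.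
move=> hg; have cg : continuous g.
  by move=> s; apply/differentiable_continuous/derivable1_diffP; have [] := hg s.
have [a0|a0] := leP 0 a.
  have [|c] := MVT_segment a0 (fun s _ => hg s); first exact: continuous_subspaceT.
  rewrite in_itv/= => /andP[c0 ca] ->; exists c; last by rewrite subr0.
  by rewrite !ger0_norm.
have [|c] := MVT_segment (ltW a0) (fun s _ => hg s); first exact: continuous_subspaceT.
rewrite in_itv/= => /andP[ca c0] h; exists c.
  by rewrite (ltr0_norm a0) ler0_norm// lerN2.
by rewrite -opprB h sub0r mulrN opprK.
Qed.

(** Vertices of a path from 0 to [v] parallel to the axes: [Ck] speaks of partial derivatives
    only. *)
Definition trunc_row (k : nat) v : E := \row_j (if (j < k)%N then v 0 j else 0).

Lemma trunc_rowS k (kn : (k < n)%N) v :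
  trunc_row k.+1 v = trunc_row k v + v 0 (Ordinal kn) *: delta_mx 0 (Ordinal kn).
Proof.
apply/rowP => j; rewrite !mxE eqxx/= ltnS leq_eqVlt.
case: (eqVneq j (Ordinal kn)) => [->|jk] /=.
  by rewrite eqxx ltnn mulr1 add0r.
have /negbTE -> /= : nat_of_ord j != k by apply: contra_neq jk => jk; exact/val_inj.
by rewrite mulr0 addr0.
Qed.

Lemma norm_trunc_row k v : `|trunc_row k v| <= `|v|.
Proof.
rewrite [leLHS]/Num.norm/= mx_normrE; apply/bigmax_leP; split=> // -[i j] _ /=.
by rewrite mxE; case: ifP => _; rewrite ?normr0// coord_le_norm.
Qed.

(** Along the path through the points x + h [trunc_row k v] one coordinate changes at a time, and
    the mean value theorem expresses each increment by a partial derivative near [x]. *)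
Lemma C1_increment phi x v (e d : R) : Ck 1 phi -> 0 <= e ->
  (forall j y, `|y - x| < d -> `|pderiv j phi y - pderiv j phi x| <= e) ->
  forall h : R, `|h| * (2 * `|v|) < d ->
  `|phi (x + h *: v) - phi x - h * \sum_j v 0 j * pderiv j phi x| <=
  `|h| * (\sum_j `|v 0 j|) * e.
Proof.
move=> [_ dphi] e0 hd h hv.
suff H k : (k <= n)%N ->
    `|phi (x + h *: trunc_row k v) - phi x -
      h * \sum_(j < n | (j < k)%N) v 0 j * pderiv j phi x| <=
    `|h| * (\sum_(j < n | (j < k)%N) `|v 0 j|) * e.
  have := H n (leqnn n); rewrite (_ : trunc_row n v = v); last first.
    by apply/rowP => j; rewrite mxE ltn_ord.
  by under [X in _ - _ * X]eq_bigl do rewrite ltn_ord;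
    under [X in _ * X * _]eq_bigl do rewrite ltn_ord.
elim: k => [|k ih] kn.
  rewrite !big_pred0 ?(mulr0, mul0r, subr0)//.
  rewrite (_ : trunc_row 0 v = 0) ?scaler0 ?addr0 ?subrr ?normr0//.
  by apply/rowP => j; rewrite !mxE.
pose o := Ordinal kn.
have sumS (F : 'I_n -> R) : \sum_(j < n | (j < k.+1)%N) F j =
    \sum_(j < n | (j < k)%N) F j + F o.
  rewrite (bigD1 o) ?ltnS//= addrC; congr (_ + _); apply: eq_bigl => j.
  rewrite ltnS leq_eqVlt; case: (eqVneq j o) => [->|jo] /=.
    by rewrite andbF ltnn.
  have /negbTE -> /= : nat_of_ord j != k by apply: contra_neq jo => jo; exact/val_inj.
  by rewrite andbT.
rewrite !sumS trunc_rowS -/o; set y := x + h *: trunc_row k v.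
set a := h * v 0 o; set w : E := delta_mx 0 o.
have -> : x + h *: (trunc_row k v + v 0 o *: w) = line_map y w a.
  by rewrite /line_map /y scalerDr scalerA addrA.
have ih' := ih (ltnW kn).
have dw (s : R) : is_derive s (1 : R) (fun r => phi (line_map y w r))
    (pderiv o phi (line_map y w s)).
  exact: (is_derive_line ((dphi o).1 (line_map y w s))).
have [c ca] := mean_value a dw.
rewrite {2}/line_map scale0r addr0 => mv.
have vo : `|v 0 o| <= `|v| by exact: coord_le_norm.
have w1 : `|w| <= 1.
  rewrite [leLHS]/Num.norm/= mx_normrE; apply/bigmax_leP; split=> // -[p q] _ /=.
  by rewrite !mxE; case: (_ && _); rewrite ?normr0 ?normr1.
(* The truncated vector and the current coordinate each contribute at most |h| |v|, whence the
   factor 2 in the hypothesis on [h]. *)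
have cd : `|line_map y w c - x| < d.
  apply: le_lt_trans hv; rewrite /line_map /y addrAC [x + _]addrC addrK.
  apply: le_trans (ler_normD _ _) _; rewrite !normrZ.
  have -> : `|h| * (2 * `|v|) = `|h| * `|v| + `|h| * `|v| by ring.
  apply: lerD; first by rewrite ler_wpM2l// norm_trunc_row.
  apply: le_trans (_ : `|c| * 1 <= _); first by rewrite ler_wpM2l.
  by rewrite mulr1 (le_trans ca)// normrM ler_wpM2l.
have := hd o _ cd.
set D := pderiv o phi (line_map y w c) in mv *; set D0 := pderiv o phi x => hD.
have -> : phi (line_map y w a) - phi x -
    h * (\sum_(j < n | (j < k)%N) v 0 j * pderiv j phi x + v 0 o * D0) =
    (phi y - phi x - h * \sum_(j < n | (j < k)%N) v 0 j * pderiv j phi x) +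
    a * (D - D0).
  by rewrite (_ : phi (line_map y w a) = phi y + D * a); [rewrite /a; ring|rewrite -mv; ring].
rewrite [X in _ <= X * _]mulrDr [leRHS]mulrDl; apply: le_trans (ler_normD _ _) _; apply: lerD => //.
by rewrite normrM /a normrM ler_wpM2l// mulr_ge0.
Qed.

Lemma C1_directional phi x v : Ck 1 phi ->
  is_derive x v phi (\sum_j v 0 j * pderiv j phi x).
Proof.
move=> cphi; set S := \sum_j _.
suff h : (fun h : R => h^-1 *: ((phi \o shift x) (h *: v) - phi x)) @ 0^' --> S.
  by apply: DeriveDef; [apply/cvg_ex; exists S|exact: cvg_lim h].
pose V := \sum_j `|v 0 j|; have V0 : 0 <= V by apply: sumr_ge0.
apply/cvgrPdist_le => e e0.
pose e' := e / (V + 1).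
have e'0 : 0 < e' by rewrite divr_gt0//; lra.
have cont j : continuous (pderiv j phi) by case: cphi => _ /(_ j) [_ []].
have : \forall y \near x, forall j, `|pderiv j phi y - pderiv j phi x| <= e'.
  apply: (@filter_forall _ _ (fun j y => `|pderiv j phi y - pderiv j phi x| <= e') _ (nbhs_filter x)) => j.
  have /cvgrPdist_le /(_ e' e'0) := cont j x.
  by apply: filterS => y; rewrite distrC.
move=> /nbhs_ballP[d /= d0 hd].
near=> h.
have h0 : h != 0 by near: h; exact: nbhs_dnbhs_neq.
have hv : `|h| * (2 * `|v|) < d.
  have h1 : `|h| <= d / (2 * `|v| + 1) / 2.
    by near: h; apply: dnbhs0_le; rewrite !divr_gt0// ltr_wpDl// mulr_ge0.
  have p : 0 < 2 * `|v| + 1 by rewrite ltr_wpDl// mulr_ge0.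
  rewrite -mulrA -invfM ler_pdivlMr in h1; last by rewrite mulr_gt0.
  have := normr_ge0 h; have := normr_ge0 v; nra.
have hd' j y : `|y - x| < d -> `|pderiv j phi y - pderiv j phi x| <= e'.
  by move=> yd; apply: hd; rewrite -ball_normE /= distrC.
have := C1_increment cphi (ltW e'0) hd' hv; rewrite -/S -/V => inc.
rewrite /= (addrC (h *: v)) distrC.
rewrite -[_ *: _]/(_ * _) -[S](mulKf h0) -mulrBr normrM normfV ler_pdivrMl ?normr_gt0//.
apply: le_trans inc _; have V1 : 0 < V + 1 by lra.
by rewrite -mulrA ler_wpM2l// /e' mulrA ler_pdivrMr// mulrC ler_pM2l// lerDl.
Unshelve. all: by end_near. Qed.

Local Notation H1 := (@H1 R n).

Lemma line_map_measurable f v x : continuous f ->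
  measurable_fun [set: measurableTypeR R] (fun s => f (line_map x v s)).
Proof.
move=> cf; apply: continuous_measurable_fun => s.
by apply: (@continuous_comp _ _ _ (line_map x v) f); [exact: line_map_continuous|exact: cf].
Qed.

Lemma bounded_on_segment f x v (a b : R) : continuous f ->
  exists M, forall s, s \in `[a, b] -> `|f (line_map x v s)| <= M.
Proof.
move=> cf; have [ab|ba] := leP a b; last first.
  exists 0 => s; rewrite in_itv/= => /andP[as_ sb].
  by have := le_lt_trans (le_trans as_ sb) ba; rewrite ltxx.
pose g (s : R) : R := `|f (line_map x v s)|.
have cg : continuous g.
  move=> s; apply: (@continuous_comp _ _ _ (fun s => f (line_map x v s)) Num.norm).
    by apply: (@continuous_comp _ _ _ (line_map x v) f); [exact: line_map_continuous|exact: cf].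
  exact: norm_continuous.
have ne : `[a, b]%classic !=set0 by exists a; rewrite /= in_itv/= lexx ab.
have [c _ hc] := @compact_EVT_max R R g `[a, b]%classic ne (@segment_compact R a b)
  (continuous_subspaceT cg).
by exists (g c) => s sab; apply: hc; rewrite inE.
Qed.

Lemma integrable_segment f x v (a b : R) : enorm v = 1 -> continuous f ->
  H1.-integrable (line_map x v @` `]a, b[) (fun y => (f y)%:E).
Proof.
move=> v1 cf; have mI : measurable (`]a, b[%classic : set (measurableTypeR R)) by [].
apply: measurable_bounded_integrable.
- exact: line_image_measurable.
- apply: (@le_lt_trans _ _ (lebesgue_measure (`]a, b[%classic : set R))).
    by rewrite le_eqVlt; apply/orP; left; apply/eqP; exact: H1_line.
  by rewrite lebesgue_measure_itv/=; case: ifP => _; rewrite -?EFinD ltry.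
- by apply: measurable_funTS; exact: continuous_H1_measurable.
- have [M hM] := bounded_on_segment x v a b cf.
  exists M; split; first exact: num_real.
  move=> N MN _ /= [s sab <-]; rewrite (le_trans (hM s _)) ?ltW//.
  by apply: subset_itv_oo_cc.
Qed.

(** The divergence of a segment is concentrated at its end points; this serves both for the diameter
    and for the edges of the network. *)
Lemma segment_FTC phi x v (a b : R) : enorm v = 1 -> a <= b -> Ck 1 phi ->
  \int[H1]_(y in line_map x v @` `]a, b[) (\sum_j v 0 j * pderiv j phi y) =
  phi (line_map x v b) - phi (line_map x v a).
Proof.
move=> v1 ab cphi; set S := fun y => \sum_j v 0 j * pderiv j phi y.
have cS : continuous S.
  apply: continuous_big => [|j _]; first exact: add_continuous.
  apply: fun_continuousM; first exact: cst_continuous.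
  by case: cphi => _ /(_ j) [_ []].
have mI : measurable (`]a, b[%classic : set (measurableTypeR R)) by [].
rewrite /Rintegral (integral_line v1 mI (line_map_measurable _ _ cS)
  (integrable_segment x a b v1 cS)).
move: ab; rewrite le_eqVlt => /predU1P[<-|ab].
  by rewrite set_itvoo0 integral_set0 subrr.
have dS (s : R) : is_derive s (1 : R) (fun r => phi (line_map x v r)) (S (line_map x v s)).
  have [d1 d2] := C1_directional (line_map x v s) v cphi.
  by have := is_derive_line d1; rewrite d2.
have cphi' : continuous (fun r : R => phi (line_map x v r)).
  by move=> s; apply/differentiable_continuous/derivable1_diffP; have [] := dS s.
have cSl : continuous (fun r : R => S (line_map x v r)).
  by move=> s; apply: (@continuous_comp _ _ _ (line_map x v) S);
    [exact: line_map_continuous|exact: cS].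
rewrite -(@integral_itv_bndoo _ a b _ true false); last first.
  by apply/measurable_EFinP; apply: measurable_funTS; exact: line_map_measurable.
rewrite (continuous_FTC2 ab (F := fun r => phi (line_map x v r)))//.
- exact: continuous_subspaceT.
- split; first by move=> s _; have [] := dS s.
    exact: cvg_at_right_filter (cphi' a).
  exact: cvg_at_left_filter (cphi' b).
- by move=> s _; rewrite derive1E; have [] := dS s.
Qed.

End directional_derivative.

(** * From equality of measures on sets to equality of integrals *)

Section equal_densities.
Context d (T : measurableType d) (R : realType).
Variable mu : {measure set T -> \bar R}.
Implicit Types (f F : T -> R) (g A C : set T).

Lemma integrable_mul g f F (M : R) : measurable g ->
  mu.-integrable g (EFin \o F) -> measurable_fun g f ->
  (forall x, g x -> `|f x| <= M) ->
  mu.-integrable g (EFin \o (fun x => f x * F x)).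
Proof.
move=> mg iF mf fM; have := @integrableMr _ _ _ mu g mg f (EFin \o F) mf _ iF.
apply; exists M; split; first exact: num_real.
by move=> N MN x /= gx; rewrite (le_trans (fM x gx))// ltW.
Qed.

Lemma Rintegral_sum (I : Type) (r : seq I) g (F : I -> T -> R) : measurable g ->
  (forall i, mu.-integrable g (EFin \o F i)) ->
  \int[mu]_(x in g) (\sum_(i <- r) F i x) = \sum_(i <- r) \int[mu]_(x in g) F i x.
Proof.
move=> mg iF; elim: r => [|i r ih].
  rewrite big_nil; under eq_Rintegral do rewrite big_nil.
  by rewrite Rintegral_cst// mul0r.
under eq_Rintegral do rewrite big_cons.
rewrite big_cons RintegralD// ?ih//.
have -> : EFin \o (fun x => \sum_(j <- r) F j x) =
    (fun x => \sum_(j <- r) (F j x)%:E)%E.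
  by apply/funext => x /=; rewrite sumEFin.
exact: (@integrable_sum _ _ _ mu g mg _ r xpredT (fun i x => (F i x)%:E) (fun i _ => iF i)).
Qed.

(** Replacing [f] by the constant [c] costs at most [e] times the total masses, and the constant
    contributes equally on both sides. *)
Lemma Rintegral_level (A A0 : set T) F F0 f (c e : R) :
  measurable A -> measurable A0 ->
  mu.-integrable A (EFin \o F) -> mu.-integrable A0 (EFin \o F0) ->
  measurable_fun setT f ->
  (forall x, A x \/ A0 x -> `|f x - c| <= e) ->
  \int[mu]_(x in A) F x = \int[mu]_(x in A0) F0 x ->
  `|\int[mu]_(x in A) (f x * F x) - \int[mu]_(x in A0) (f x * F0 x)| <=
  e * (\int[mu]_(x in A) `|F x| + \int[mu]_(x in A0) `|F0 x|).
Proof.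
move=> mA mA0 iF iF0 mf fc FF0.
have mfc (B : set T) : measurable_fun B (fun x => f x - c).
  by apply: measurable_funTS; exact: measurable_funB.
have part (B : set T) (G : T -> R) : measurable B -> mu.-integrable B (EFin \o G) ->
    (forall x, B x -> `|f x - c| <= e) ->
    \int[mu]_(x in B) (f x * G x) =
      \int[mu]_(x in B) ((f x - c) * G x) + c * \int[mu]_(x in B) G x /\
    `|\int[mu]_(x in B) ((f x - c) * G x)| <= e * \int[mu]_(x in B) `|G x|.
  move=> mB iG fB; have i1 := integrable_mul mB iG (mfc B) fB.
  have icG : mu.-integrable B (EFin \o (fun x => c * G x)).
    by apply: (integrable_mul (f := cst c) (M := `|c|)) => //; exact: measurable_cst.
  have iaG : mu.-integrable B (EFin \o (fun x => `|G x|)) by exact: integrable_norm.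
  have ieG : mu.-integrable B (EFin \o (fun x => e * `|G x|)).
    by apply: (integrable_mul (f := cst e) (M := `|e|)) => //; exact: measurable_cst.
  split.
    rewrite -RintegralZl// -RintegralD//; apply: eq_Rintegral => x _; ring.
  apply: le_trans (le_normr_Rintegral mB i1) _; rewrite -RintegralZl//.
  apply: le_Rintegral => //; first exact: integrable_norm.
  by move=> x Bx; rewrite normrM ler_wpM2r// fB.
have [-> h1] := part A F mA iF (fun x Ax => fc x (or_introl Ax)).
have [-> h2] := part A0 F0 mA0 iF0 (fun x Ax => fc x (or_intror Ax)).
rewrite FF0 opprD addrACA subrr addr0 mulrDr.
by apply: le_trans (ler_normB _ _) _; exact: lerD.
Qed.

(** The range of [f] is cut into slices of width [e]. On each slice [Rintegral_level] applies, and
    the errors sum to [e] times the total masses, with [e] arbitrary. *)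
Lemma Rintegral_eq_densities g g0 F F0 f (M : R) :
  measurable g -> measurable g0 ->
  mu.-integrable g (EFin \o F) -> mu.-integrable g0 (EFin \o F0) ->
  measurable_fun setT f -> (forall x, g x \/ g0 x -> `|f x| <= M) ->
  (forall a b : R, \int[mu]_(x in g `&` f @^-1` `[a, b[) F x =
                   \int[mu]_(x in g0 `&` f @^-1` `[a, b[) F0 x) ->
  \int[mu]_(x in g) (f x * F x) = \int[mu]_(x in g0) (f x * F0 x).
Proof.
move=> mg mg0 iF iF0 mf fM eqA.
have mfI a b : measurable (f @^-1` `[a, b[).
  by rewrite -[X in measurable X]setTI; exact: mf.
have mDI (D : set T) a b : measurable D -> measurable (D `&` f @^-1` `[a, b[).
  by move=> mD; exact: measurableI.
have iDI (D : set T) (G : T -> R) a b : measurable D ->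
    mu.-integrable D (EFin \o G) ->
    mu.-integrable (D `&` f @^-1` `[a, b[) (EFin \o G).
  move=> mD; apply: integrableS => //; exact: mDI.
have ifF : mu.-integrable g (EFin \o (fun x => f x * F x)).
  apply: (integrable_mul (M := M)) => //; first exact: measurable_funTS.
  by move=> x gx; apply: fM; left.
have ifF0 : mu.-integrable g0 (EFin \o (fun x => f x * F0 x)).
  apply: (integrable_mul (M := M)) => //; first exact: measurable_funTS.
  by move=> x gx; apply: fM; right.
pose K := \int[mu]_(x in g) `|F x| + \int[mu]_(x in g0) `|F0 x|.
have K0 : 0 <= K by rewrite addr_ge0// Rintegral_ge0.
suff H e : 0 < e -> `|\int[mu]_(x in g) (f x * F x) -
    \int[mu]_(x in g0) (f x * F0 x)| <= e * K.
  apply/eqP; rewrite -subr_eq0 -normr_le0; apply/ler_addgt0Pr => e e0.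
  have K1 : 0 < K + 1 by lra.
  have := H (e / (K + 1)); rewrite divr_gt0// => /(_ isT) /le_trans; apply.
  by rewrite add0r mulrAC ler_pdivrMr// ler_pM2l// lerDl.
move=> e0; pose Cm (m : nat) := f @^-1` `[- M, - M + m%:R * e[.
have [m Cm_eq] : exists m, forall x, g x \/ g0 x -> Cm m x.
  exists (Num.truncn ((M + M) / e)).+1 => x gx; rewrite /Cm/=.
  rewrite in_itv/=; have := fM x gx; rewrite ler_norml => /andP[-> fx]/=.
  have := truncnS_gt ((M + M) / e); rewrite ltr_pdivrMr//; lra.
have step k : `|\int[mu]_(x in g `&` Cm k) (f x * F x) -
    \int[mu]_(x in g0 `&` Cm k) (f x * F0 x)| <=
    e * (\int[mu]_(x in g `&` Cm k) `|F x| + \int[mu]_(x in g0 `&` Cm k) `|F0 x|).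
  elim: k => [|k ih].
    have -> : Cm 0%N = set0.
      by rewrite /Cm mul0r addr0 set_itvco0 preimage_set0.
    by rewrite !setI0 !Rintegral_set0 subrr normr0 addr0 mulr0.
  pose A := f @^-1` `[- M + k%:R * e, - M + k.+1%:R * e[.
  have ke : - M <= - M + k%:R * e by rewrite lerDl mulr_ge0// ltW.
  have ke' : - M + k%:R * e <= - M + k.+1%:R * e.
    by rewrite lerD2l ler_wpM2r ?(ltW e0)// ler_nat.
  have CmS : Cm k.+1 = Cm k `|` A.
    apply/seteqP; split => x /=; rewrite /Cm /A /= !in_itv/=.
      by move=> /andP[-> ->]; have [|] := ltP (f x) (- M + k%:R * e); [left|right].
    by move=> [/andP[-> h]|/andP[h ->]]; rewrite ?andbT/=;
      [exact: lt_le_trans h ke'|exact: le_trans ke h].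
  have split_ (D : set T) (G : T -> R) : measurable D ->
      mu.-integrable D (EFin \o G) ->
      \int[mu]_(x in D `&` Cm k.+1) G x =
      \int[mu]_(x in D `&` Cm k) G x + \int[mu]_(x in D `&` A) G x.
    move=> mD iG; rewrite CmS setIUr Rintegral_setU//.
    - exact: mDI.
    - exact: mDI.
    - by rewrite -setIUr -CmS; exact: iDI.
    - rewrite disj_set2E; apply/eqP; rewrite -subset0 => x [[_ /=]].
      rewrite /Cm /A /= in_itv/= => /andP[_ xk] [_]; rewrite in_itv/= => /andP[kx _].
      by have := lt_le_trans xk kx; rewrite ltxx.
  have lev : `|\int[mu]_(x in g `&` A) (f x * F x) -
      \int[mu]_(x in g0 `&` A) (f x * F0 x)| <=
      e * (\int[mu]_(x in g `&` A) `|F x| + \int[mu]_(x in g0 `&` A) `|F0 x|).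
    apply: (Rintegral_level (c := - M + k%:R * e)) => //.
    - exact: mDI.
    - exact: mDI.
    - exact: iDI.
    - exact: iDI.
    - move=> x gx; have : A x by case: gx => [] [].
      rewrite /A /= in_itv/= -natr1 mulrDl mul1r addrA => /andP[h1 h2].
      by rewrite ger0_norm ?subr_ge0// lerBlDl ltW.
    - exact: eqA.
  have s1 := split_ g (fun x => f x * F x) mg ifF.
  have s2 := split_ g0 (fun x => f x * F0 x) mg0 ifF0.
  have s3 := split_ g (fun x => `|F x|) mg (integrable_norm iF).
  have s4 := split_ g0 (fun x => `|F0 x|) mg0 (integrable_norm iF0).
  cbv beta in s1, s2, s3, s4; rewrite s1 s2 s3 s4.
  rewrite opprD addrACA [X in e * X]addrACA mulrDr.
  by apply: le_trans (ler_normD _ _) _; exact: lerD.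
have gE (D : set T) : (D `<=` g `|` g0) -> D `&` Cm m = D.
  by move=> Dg; apply: setIidl => x Dx; apply: Cm_eq; exact: Dg.
by have := step m; rewrite !gE.
Qed.

End equal_densities.

(** * Moments of a competitor *)

Section moments.
Context {R : realType} {n : nat}.
Local Notation E := 'rV[R]_n.
Local Notation H1 := (@H1 R n).
Implicit Types (x y t : E) (f phi : E -> R).

Lemma borel_set_sub (A B : set E) : <<s open >> A -> <<s open >> B ->
  <<s open >> (A `&` B).
Proof. exact: (@measurableI _ (g_sigma_algebraType (@open E)) A B). Qed.

Lemma borel_setD (A B : set E) : <<s open >> A -> <<s open >> B ->
  <<s open >> (A `\` B).
Proof. exact: (@measurableD _ (g_sigma_algebraType (@open E)) A B). Qed.

Lemma borel_open (A : set E) : open A -> <<s open >> A.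
Proof. exact: (@sub_sigma_algebra E setT open A). Qed.

Lemma borel_preimage f (a b : R) : continuous f -> <<s open >> (f @^-1` `[a, b[).
Proof.
move=> cf; rewrite (_ : _ @^-1` _ = f @^-1` [set s | s < b] `\` f @^-1` [set s | s < a]).
  by apply: borel_setD; apply: borel_open; apply: open_comp => [x _|];
    [exact: cf|exact: open_lt|exact: cf|exact: open_lt].
apply/seteqP; split => x /=; rewrite in_itv/=.
  by move=> /andP[xa xb]; split => //; apply/negP; rewrite -leNgt.
by move=> [-> /negP]; rewrite -leNgt => ->.
Qed.

Lemma eballE x (r : R) : eball 0 r x <-> enorm x < r.
Proof. by rewrite /eball /= subr0. Qed.

Lemma open_eball (c : E) (r : R) : open (eball c r).
Proof.
rewrite (_ : eball c r = (fun x => x - c) @^-1` [set x | enorm x < r])//.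
apply: open_comp; last exact: open_enorm_lt.
by move=> x _; apply: (@continuousB _ _ _ id (cst c)); [exact: cvg_id|exact: cst_continuous].
Qed.

(** By compactness the norm attains its maximum on the closed ball, which leaves room for a cut-off
    before the boundary of the larger ball. *)
Lemma closure_eball_sub (c : E) (r s : R) : 0 < r ->
  closure (eball c r) `<=` eball 0 s ->
  exists rho, [/\ 0 < rho, rho < s & eball c r `<=` [set x | enorm x < rho]].
Proof.
move=> r0 sub; set K := closure (eball c r).
have cK : compact K.
  apply: (subclosed_compact _ (@compact_enorm_le R n s)); first exact: closed_closure.
  by move=> x /sub /eballE /ltW.
have Kc : K c by apply: subset_closure; rewrite /eball /= subrr enorm0.
have [x xK xmax] := compact_EVT_max (ex_intro _ c Kc) cK
  (continuous_subspaceT (@dotxx_continuous R n)).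
have xs : enorm x < s by apply/eballE/sub/set_mem.
exists ((enorm x + s) / 2); have x0 := enorm_ge0 x; split; [lra|lra|].
move=> y cy /=; apply: (@le_lt_trans _ _ (enorm x)); last by lra.
rewrite -ler_sqr ?nnegrE ?enorm_ge0// !sqr_enorm; apply: xmax.
by apply/mem_set/subset_closure.
Qed.

Lemma continuous_bounded_ball f (r : R) : continuous f ->
  exists M, forall x, enorm x <= r -> `|f x| <= M.
Proof.
move=> cf; have [ne|ne] := pselect ([set x : E | enorm x <= r] !=set0); last first.
  by exists 0 => x xr; exfalso; apply: ne; exists x.
have cg : continuous (fun x => `|f x|).
  by move=> x; apply: (@continuous_comp _ _ _ f Num.norm); [exact: cf|exact: norm_continuous].
have [c _ hc] := compact_EVT_max ne (@compact_enorm_le R n r) (continuous_subspaceT cg).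
by exists `|f c| => x xr; apply: hc; rewrite inE.
Qed.

Lemma line_ball t : enorm t = 1 ->
  line t `&` eball 0 2^-1 = line_map 0 t @` `](- 2^-1), 2^-1[.
Proof.
move=> t1; apply/seteqP; split => [x [[s _ <-]] /eballE|_ [s /= s2 <-]].
  rewrite enormZ t1 mulr1 ltr_norml => /andP[s1 s2].
  by exists s; rewrite /= ?in_itv/= ?s1// /line_map add0r.
rewrite /line_map add0r; split; first by exists s.
apply/eballE; rewrite enormZ t1 mulr1 ltr_norml; by move: s2; rewrite in_itv.
Qed.

Lemma line_ball_measurable t : enorm t = 1 ->
  measurable (line t `&` eball 0 2^-1 : set (H1space R n)).
Proof. by move=> t1; rewrite line_ball//; exact: line_image_measurable. Qed.

Lemma H1_line_ball t : enorm t = 1 -> H1 (line t `&` eball 0 2^-1) = 1%E.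
Proof.
move=> t1; rewrite line_ball// H1_line// lebesgue_measure_itv/= lte_fin.
rewrite ifT; last by lra.
by rewrite -EFinD; congr (_%:E); lra.
Qed.

Lemma integrable_cst_line_ball t (k : R) : enorm t = 1 ->
  H1.-integrable (line t `&` eball 0 2^-1) (EFin \o cst k).
Proof.
move=> t1; rewrite line_ball//.
exact: (@integrable_segment R n (cst k) 0 t _ _ t1 (@cst_continuous _ _ k)).
Qed.

Lemma Rintegral_cst_line_ball t (k : R) : enorm t = 1 ->
  \int[H1]_(x in line t `&` eball 0 2^-1) k = k.
Proof.
move=> t1; rewrite Rintegral_cst; last exact: line_ball_measurable.
by have /= -> := H1_line_ball t1; rewrite mulr1.
Qed.

Lemma tensorE (b : 'rV[int]_n) (t : E) i j : tensor b t i j = (b 0 i)%:~R * t 0 j.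
Proof. by rewrite mxE. Qed.

Lemma integrable_tensor g (theta : _ -> 'rV[int]_n) (tau : _ -> E) i j :
  measurable g -> unit_tangent g tau ->
  H1.-integrable g (fun x => ((theta x 0 i)%:~R)%:E) ->
  H1.-integrable g (EFin \o (fun x => tensor (theta x) (tau x) i j)).
Proof.
move=> mg [mtau tau1 _] ith.
have -> : (fun x => tensor (theta x) (tau x) i j) =
    (fun x => tau x 0 j * (theta x 0 i)%:~R).
  by apply/funext => x; rewrite tensorE mulrC.
apply: (integrable_mul (M := 1)) => //.
by move=> x gx; rewrite -(tau1 x gx) coord_le_enorm.
Qed.

(** The competitor and the straight diameter are tested with the same cut-off of x_l. Both
    divergences vanish, and the gradient differs from the l-th basis vector only where the two
    measures agree; so the first moments agree, and the diameter has length 1. *)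
Lemma moment b t g theta tau : enorm t = 1 ->
  Mdf (eball 0 2^-1) g theta tau ->
  agrees_near_boundary (eball 0 2^-1) g theta tau b t ->
  forall i l, \int[H1]_(x in g) tensor (theta x) (tau x) i l = tensor b t i l.
Proof.
move=> t1 [gB [mg _] gtau ith df] [c [r [r0 rB agree]]] i l.
set B := eball 0 2^-1 in gB rB agree df *.
pose g0 : set (H1space R n) := line t `&` B; rewrite -/g0 in agree.
have mg0 : measurable g0 by exact: line_ball_measurable.
have [rho [rho0 rho2 crho]] := closure_eball_sub r0 rB.
pose s := (rho + 2^-1) / 2.
have [rs s2] : rho < s /\ s < 2^-1 by rewrite /s; split; lra.
have [phi [Cphi phi0 dphi]] := coord_cutoff l rho0 rs.
have tphi : test_function B phi by exact: test_function_eball s2 Cphi phi0.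
pose T j (x : H1space R n) := tensor (theta x) (tau x) i j.
have iT j : H1.-integrable g (EFin \o T j) by exact: integrable_tensor.
have iT0 j : H1.-integrable g0 (EFin \o cst (tensor b t i j)).
  exact: integrable_cst_line_ball.
have cd j : continuous (pderiv j phi) by case: (Cphi 1%N) => _ /(_ j) [_ []].
(* [f j] vanishes on [eball c r], the only place where the two measures may differ. *)
pose f j x := pderiv j phi x - (j == l)%:R.
have cf j : continuous (f j) by apply: fun_continuousB => //; exact: cst_continuous.
have mf j : measurable_fun [set: H1space R n] (f j) by exact: continuous_H1_measurable.
pose C := B `\` eball c r.
have bC : <<s open >> C by apply: borel_setD; apply: borel_open; exact: open_eball.
have mC : measurable (C : set (H1space R n)) by exact: borel_H1_measurable.
have bound j : exists M, forall x, B x -> `|f j x| <= M.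
  have [M hM] := continuous_bounded_ball 2^-1 (cf j).
  by exists M => x /eballE xB; apply: hM; exact: ltW.
have restr (D : set (H1space R n)) (F : H1space R n -> R) j : D `<=` B ->
    \int[H1]_(x in D) (f j x * F x) = \int[H1]_(x in D `&` C) (f j x * F x).
  move=> DB; rewrite Rintegral_mkcondr; apply: eq_Rintegral => x xD.
  rewrite patchE; case: ifPn => // xC.
  have cx : eball c r x.
    apply/not_notP => ncx; move/negP: xC; apply; apply/mem_set; split => //.
    by apply: DB; exact: set_mem.
  by rewrite /f dphi ?subrr ?mul0r//; exact: crho.
have key j : \int[H1]_(x in g) (f j x * T j x) =
    \int[H1]_(x in g0) (f j x * cst (tensor b t i j) x).
  rewrite restr// [RHS]restr; last by move=> x [].
  have [M hM] := bound j.
  apply: (Rintegral_eq_densities (M := M)) => //.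
  - exact: measurableI.
  - exact: measurableI.
  - by apply: integrableS (iT j) => //; exact: measurableI.
  - by apply: integrableS (iT0 j) => //; exact: measurableI.
  - by move=> x [[_ []]|[_ []]] xB _; exact: hM.
  - move=> a b'; rewrite -(setIA g C) -(setIA g0 C).
    have bA : <<s open >> (C `&` f j @^-1` `[a, b'[).
      by apply: borel_set_sub => //; exact: borel_preimage.
    have /matrixP /(_ i j) := agree _ bA (@subIsetl _ _ _).
    by rewrite mxE [RHS]mxE.
have split_ (D : set (H1space R n)) (F : 'I_n -> H1space R n -> R) :
    measurable D -> D `<=` B -> (forall j, H1.-integrable D (EFin \o F j)) ->
    \sum_j \int[H1]_(x in D) (pderiv j phi x * F j x) =
    \sum_j \int[H1]_(x in D) (f j x * F j x) + \int[H1]_(x in D) F l x.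
  move=> mD DB iF.
  have ifF j : H1.-integrable D (EFin \o (fun x => f j x * F j x)).
    have [M hM] := bound j; apply: (integrable_mul (M := M)) => //.
      exact: measurable_funTS.
    by move=> x /DB; exact: hM.
  have idF j : H1.-integrable D (EFin \o (fun x => (j == l)%:R * F j x)).
    by apply: (integrable_mul (f := cst (j == l)%:R) (M := `|(j == l)%:R|)) => //;
      exact: measurable_cst.
  rewrite [X in _ = _ + X](_ : _ = \sum_j (j == l)%:R * \int[H1]_(x in D) F j x).
    rewrite -big_split /=; apply: eq_bigr => j _.
    rewrite -RintegralZl// -RintegralD//; apply: eq_Rintegral => x _.
    by rewrite /f; ring.
  rewrite (bigD1 l)//= eqxx mul1r big1 ?addr0// => j /negbTE ->.
  by rewrite mul0r.
have eq1 := split_ g T mg gB iT.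
have eq2 := split_ g0 (fun j => cst (tensor b t i j)) mg0 (@subIsetr _ _ _) iT0.
move: eq1; rewrite df// (eq_bigr _ (fun j _ => key j)).
(* For the diameter the divergence identity follows from [segment_FTC], as [phi] vanishes at both
   end points. *)
have -> : \sum_j \int[H1]_(x in g0) (f j x * cst (tensor b t i j) x) =
    - \int[H1]_(x in g0) cst (tensor b t i l) x.
  apply/eqP; rewrite -addr_eq0 -eq2; apply/eqP.
  transitivity ((b 0 i)%:~R * \int[H1]_(x in g0) (\sum_j t 0 j * pderiv j phi x)).
    rewrite -RintegralZl//; last first.
      rewrite /g0 line_ball//; apply: integrable_segment => //.
      apply: continuous_big => [|j _]; first exact: add_continuous.
      by apply: fun_continuousM => //; exact: cst_continuous.
    have iP j : H1.-integrable g0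
        (EFin \o (fun x => pderiv j phi x * cst (tensor b t i j) x)).
      rewrite /g0 line_ball//; apply: integrable_segment => //.
      by apply: fun_continuousM => //; exact: cst_continuous.
    rewrite -(Rintegral_sum _ mg0 iP); apply: eq_Rintegral => x _.
    by rewrite mulr_sumr; apply: eq_bigr => j _; rewrite /= tensorE; ring.
  rewrite /g0 line_ball// segment_FTC//; last by lra.
  rewrite !phi0 ?subr0 ?mulr0//; rewrite /line_map add0r enormZ t1 mulr1 ?normrN.
  1-2: by rewrite ger0_norm ?invr_ge0.
move=> /esym/eqP; rewrite addrC subr_eq0 => /eqP ->.
exact: Rintegral_cst_line_ball.
Qed.

End moments.

(** * Lower bound *)

Section lower_bound.
Context {R : realType} {n : nat}.
Local Notation E := 'rV[R]_n.
Local Notation H1 := (@H1 R n).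
Local Notation psie eta := (homog_ext (psi eta)).

Definition split_energy (eta : R) (b1 b2 : 'rV[int]_n) (t z1 z2 : E) : R :=
  psie eta b1 z1 + psie eta b2 z2 + psie eta (b1 - b2) (2^-1 *: (z2 - z1)) +
  psie eta (b1 + b2) (t - 2^-1 *: (z1 + z2)).

Lemma split_energyZ eta b1 b2 a t z1 z2 :
  split_energy eta b1 b2 (a *: t) (a *: z1) (a *: z2) =
  `|a| * split_energy eta b1 b2 t z1 z2.
Proof.
rewrite /split_energy -scalerBr -scalerDr !scalerA !(mulrC _ a) -!scalerA.
by rewrite -scalerBr !psieZ; ring.
Qed.

Lemma split_energy_ge0 eta b1 b2 t z1 z2 : 0 <= eta ->
  0 <= split_energy eta b1 b2 t z1 z2.
Proof. by move=> e0; rewrite /split_energy !addr_ge0// psie_ge0. Qed.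

(** The two moment equations determine z3 and z4; the factor 1/2 in the minimisation problem comes
    from here. *)
Lemma split_moments (z1 z2 z3 z4 w : E) : z1 + (z4 + z3) = w -> z2 + (z4 - z3) = w ->
  z3 = 2^-1 *: (z2 - z1) /\ z4 = w - 2^-1 *: (z1 + z2).
Proof.
move=> h1 h2; split; apply/rowP => k.
  have := congr1 (fun v : E => v 0 k) h1; have := congr1 (fun v : E => v 0 k) h2.
  by rewrite !mxE; lra.
have := congr1 (fun v : E => v 0 k) h1; have := congr1 (fun v : E => v 0 k) h2.
by rewrite !mxE; lra.
Qed.

Section weighted_moment.
Variables (g : set (H1space R n)) (tau : H1space R n -> E).
Hypotheses (mg : measurable g) (gtau : unit_tangent g tau).

Let itau (c : H1space R n -> R) l : H1.-integrable g (EFin \o c) ->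
  H1.-integrable g (EFin \o (fun x => c x * tau x 0 l)).
Proof.
move=> ic; case: gtau => mtau tau1 _.
have -> : (fun x => c x * tau x 0 l) = (fun x => tau x 0 l * c x).
  by apply/funext => x; rewrite mulrC.
apply: (integrable_mul (M := 1)) => //.
by move=> x gx; rewrite -(tau1 x gx) coord_le_enorm.
Qed.

Definition weighted_moment (c : H1space R n -> R) : E :=
  \row_l \int[H1]_(x in g) (c x * tau x 0 l).

Lemma weighted_momentD c d : H1.-integrable g (EFin \o c) ->
  H1.-integrable g (EFin \o d) ->
  weighted_moment (fun x => c x + d x) = weighted_moment c + weighted_moment d.
Proof.
move=> ic id_; apply/rowP => l; rewrite !mxE -RintegralD//; try exact: itau.
by apply: eq_Rintegral => x _; rewrite mulrDl.
Qed.

Lemma weighted_momentZ a c : H1.-integrable g (EFin \o c) ->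
  weighted_moment (fun x => a * c x) = a *: weighted_moment c.
Proof.
move=> ic; apply/rowP => l; rewrite !mxE -RintegralZl//; try exact: itau.
by apply: eq_Rintegral => x _; rewrite mulrA.
Qed.

Lemma weighted_moment_dot (G : E) c : H1.-integrable g (EFin \o c) ->
  H1.-integrable g (EFin \o (fun x => c x * dot G (tau x))) /\
  dot G (weighted_moment c) = \int[H1]_(x in g) (c x * dot G (tau x)).
Proof.
move=> ic; have iG l : H1.-integrable g (EFin \o (fun x => G 0 l * (c x * tau x 0 l))).
  apply: (integrable_mul (f := cst (G 0 l)) (M := `|G 0 l|)) => //.
  exact: itau.
have eG x : c x * dot G (tau x) = \sum_l G 0 l * (c x * tau x 0 l).
  by rewrite mulr_sumr; apply: eq_bigr => l _; ring.
split.
  have -> : EFin \o (fun x => c x * dot G (tau x)) =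
      (fun x => \sum_l (G 0 l * (c x * tau x 0 l))%:E)%E.
    by apply/funext => x /=; rewrite sumEFin eG.
  exact: (@integrable_sum _ _ _ H1 g mg _ _ xpredT
    (fun l x => (G 0 l * (c x * tau x 0 l))%:E) (fun l _ => iG l)).
transitivity (\sum_l \int[H1]_(x in g) (G 0 l * (c x * tau x 0 l))).
  by apply: eq_bigr => l _; rewrite mxE -RintegralZl//; exact: itau.
by rewrite -Rintegral_sum//; apply: eq_Rintegral => x _; rewrite eG.
Qed.

End weighted_moment.

Lemma measurable_median0 d (T : measurableType d) (D : set T) (u v : T -> R) :
  measurable_fun D u -> measurable_fun D v ->
  measurable_fun D (fun x => median0 (u x) (v x)).
Proof.
move=> mu mv; apply: measurable_maxr; first exact: measurable_minr.
by apply: measurable_minr; [exact: measurable_cst|exact: measurable_maxr].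
Qed.

(** Jensen's inequality through supporting functionals: psi_e (b_k, z_k) = G_k . z_k is the integral
    of c_k G_k . tau, whose integrand is at most |c_k| psi (b_k, tau). The pointwise inequality
    bounds the sum over k by psi (theta, tau). *)
Lemma envelope_lower eta b1 b2 (beta : int) t g theta tau : 0 <= eta <= 1 ->
  enorm t = 1 ->
  dot (toR b1) (toR b1) = 1 :> R -> dot (toR b2) (toR b2) = 1 :> R ->
  dot (toR b1) (toR b2) = 0 :> R ->
  Mdf (eball 0 2^-1) g theta tau ->
  agrees_near_boundary (eball 0 2^-1) g theta tau (beta *: (b1 + b2)) t ->
  exists z1 z2, ((split_energy eta b1 b2 (beta%:~R *: t) z1 z2)%:E <=
    \int[H1]_(x in g) (psi eta (theta x) (tau x))%:E)%E.
Proof.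
move=> e01 t1 b11 b22 b12 hM hA.
have mom := moment t1 hM hA.
case: hM => _ [mg _] gtau ith _.
have [mtau tau1 _] := gtau.
have mth i : measurable_fun g (fun x => (theta x 0 i)%:~R : R).
  by apply/measurable_EFinP; exact: (measurable_int H1 (ith i)).
pose X (b : 'rV[int]_n) x : R := dot (toR b) (toR (theta x)).
have XE b x : X b x = \sum_i (b 0 i)%:~R * (theta x 0 i)%:~R.
  by apply: eq_bigr => i _; rewrite !mxE.
have iX b : H1.-integrable g (EFin \o X b).
  have -> : EFin \o X b = (fun x => \sum_i ((b 0 i)%:~R * (theta x 0 i)%:~R)%:E)%E.
    by apply/funext => x /=; rewrite sumEFin XE.
  apply: (@integrable_sum _ _ _ H1 g mg _ _ xpredT
    (fun i x => ((b 0 i)%:~R * (theta x 0 i)%:~R)%:E)) => i _.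
  by apply: (integrable_mul (f := cst (b 0 i)%:~R) (M := `|(b 0 i)%:~R|)) => //; exact: ith.
have mX b : measurable_fun g (X b).
  by apply/measurable_EFinP; exact: (measurable_int H1 (iX b)).
have momX b : weighted_moment g tau (X b) = dot (toR b) (toR (beta *: (b1 + b2))) *: t.
  apply/rowP => l; rewrite !mxE.
  have iT i : H1.-integrable g (EFin \o
      (fun x => (b 0 i)%:~R * tensor (theta x) (tau x) i l)).
    apply: (integrable_mul (f := cst (b 0 i)%:~R) (M := `|(b 0 i)%:~R|)) => //.
    exact: integrable_tensor.
  transitivity (\sum_i (b 0 i)%:~R * \int[H1]_(x in g) tensor (theta x) (tau x) i l).
    transitivity (\int[H1]_(x in g) \sum_i (b 0 i)%:~R * tensor (theta x) (tau x) i l).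
      apply: eq_Rintegral => x _; rewrite XE mulr_suml; apply: eq_bigr => i _.
      by rewrite tensorE mulrA.
    rewrite Rintegral_sum//; apply: eq_bigr => i _; rewrite RintegralZl//.
    exact: integrable_tensor.
  by rewrite mulr_suml; apply: eq_bigr => i _; rewrite mom tensorE !mxE mulrA.
have iD (u v : _ -> R) : H1.-integrable g (EFin \o u) -> H1.-integrable g (EFin \o v) ->
    H1.-integrable g (EFin \o (fun x => u x + v x)).
  by move=> iu iv; exact: (integrableD mg iu iv).
have imed u v (mu : measurable_fun g u) (mv : measurable_fun g v)
    (iu : H1.-integrable g (EFin \o u)) (iv : H1.-integrable g (EFin \o v)) :
    H1.-integrable g (EFin \o (fun x => median0 (u x) (v x))).
  apply: (le_integrable mg (g := EFin \o (fun x => `|u x| + `|v x|))).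
  - by apply/measurable_EFinP; exact: measurable_median0.
  - move=> x _ /=; rewrite lee_fin [leRHS]ger0_norm ?addr_ge0//.
    exact: norm_median0.
  - exact: iD (integrable_norm iu) (integrable_norm iv).
pose c4 x := dcoef4 (X b1 x) (X b2 x); pose c3 x := dcoef3 (X b1 x) (X b2 x).
pose c1 x := dcoef1 (X b1 x) (X b2 x); pose c2 x := dcoef2 (X b1 x) (X b2 x).
have i4 : H1.-integrable g (EFin \o c4) by exact: imed.
have iZ a (u : _ -> R) : H1.-integrable g (EFin \o u) ->
    H1.-integrable g (EFin \o (fun x => a * u x)).
  by move=> iu; apply: (integrable_mul (f := cst a) (M := `|a|)).
have iXN b : H1.-integrable g (EFin \o (fun x => - X b x)).
  have -> : (fun x => - X b x) = (fun x => -1 * X b x).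
    by apply/funext => x; rewrite mulN1r.
  exact: iZ.
have i3 : H1.-integrable g (EFin \o c3).
  exact: (imed (X b1) (fun x => - X b2 x) (mX b1) (measurable_funN (mX b2)) (iX b1) (iXN b2)).
have c1E x : X b1 x = c1 x + (c4 x + c3 x) by rewrite /c1 /dcoef1 /c4 /c3; ring.
have c2E x : X b2 x = c2 x + (c4 x + -1 * c3 x) by rewrite /c2 /dcoef2 /c4 /c3; ring.
have i1 : H1.-integrable g (EFin \o c1).
  have -> : c1 = (fun x => X b1 x + -1 * (c4 x + c3 x)).
    by apply/funext => x; rewrite c1E; ring.
  exact: (iD _ _ (iX b1) (iZ _ _ (iD _ _ i4 i3))).
have i2 : H1.-integrable g (EFin \o c2).
  have -> : c2 = (fun x => X b2 x + -1 * (c4 x + -1 * c3 x)).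
    by apply/funext => x; rewrite c2E; ring.
  exact: (iD _ _ (iX b2) (iZ _ _ (iD _ _ i4 (iZ _ _ i3)))).
pose z1 := weighted_moment g tau c1; pose z2 := weighted_moment g tau c2.
pose z3 := weighted_moment g tau c3; pose z4 := weighted_moment g tau c4.
have row1 : z1 + (z4 + z3) = beta%:~R *: t.
  rewrite -!weighted_momentD//; last exact: (iD _ _ i4 i3).
  rewrite -(_ : X b1 = fun x => c1 x + (c4 x + c3 x)); last exact/funext.
  by rewrite momX toRZ toRD dotZr dotDr b11 b12 addr0 mulr1.
have row2 : z2 + (z4 - z3) = beta%:~R *: t.
  rewrite -scaleN1r -weighted_momentZ// -!weighted_momentD//; try exact: (iZ _ _ i3).
    2: exact: (iD _ _ i4 (iZ _ _ i3)).
  rewrite -(_ : X b2 = fun x => c2 x + (c4 x + -1 * c3 x)); last exact/funext.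
  by rewrite momX toRZ toRD dotZr dotDr b22 (dotC (toR b2)) b12 add0r mulr1.
have [z3E z4E] := split_moments row1 row2.
exists z1, z2; rewrite /split_energy -z3E -z4E.
have [G1 G1z G1w] := psie_subgrad b1 z1 e01.
have [G2 G2z G2w] := psie_subgrad b2 z2 e01.
have [G3 G3z G3w] := psie_subgrad (b1 - b2) z3 e01.
have [G4 G4z G4w] := psie_subgrad (b1 + b2) z4 e01.
have [j1 d1] := weighted_moment_dot mg gtau G1 i1.
have [j2 d2] := weighted_moment_dot mg gtau G2 i2.
have [j3 d3] := weighted_moment_dot mg gtau G3 i3.
have [j4 d4] := weighted_moment_dot mg gtau G4 i4.
rewrite -G1z -G2z -G3z -G4z /z1 /z2 /z3 /z4 d1 d2 d3 d4.
have j12 := iD _ _ j1 j2; have j123 := iD _ _ j12 j3.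
have j1234 := iD _ _ j123 j4.
rewrite -!RintegralD//.
have e0 : 0 <= eta by case/andP: e01.
have mpsi : measurable_fun g (fun x => psi eta (theta x) (tau x)).
  have -> : (fun x => psi eta (theta x) (tau x)) =
    (fun x => \sum_i ((theta x 0 i)%:~R * (theta x 0 i)%:~R) +
       eta * (\sum_i ((theta x 0 i)%:~R * tau x 0 i)) ^+ 2).
    apply/funext => x; rewrite psiE; congr (_ + _ * _ ^+ 2);
      by apply: eq_bigr => i _; rewrite !mxE.
  apply: measurable_funD.
    by apply: measurable_sum => i; exact: measurable_funM.
  have mq : measurable_fun g (fun x => \sum_i ((theta x 0 i)%:~R * tau x 0 i)).
    by apply: measurable_sum => i; exact: measurable_funM.
  exact: (measurable_funM (measurable_cst eta) (measurable_funX 2 mq)).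
have le_psi x : g x -> c1 x * dot G1 (tau x) + c2 x * dot G2 (tau x) +
    c3 x * dot G3 (tau x) + c4 x * dot G4 (tau x) <= psi eta (theta x) (tau x).
  move=> gx; have ts := tau1 x gx.
  (* For negative [k] the functional is evaluated at - tau, using that psi_e is even. *)
  have term b G k : (forall w, dot G w <= psie eta b w) ->
      k * dot G (tau x) <= `|k| * psi eta b (tau x).
    move=> hG; rewrite -psieE_unit//; have [k0|k0] := leP 0 k.
      by rewrite ger0_norm// ler_wpM2l.
    rewrite ltr0_norm// -mulrNN -dotNr ler_wpM2l ?oppr_ge0 ?(ltW k0)//.
    by rewrite -psieN.
  apply: (le_trans _ (psi_ge_weight e01 ts b11 b22 b12 (x := X b1 x) (y := X b2 x) erefl erefl)).
  by rewrite !lerD// term.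
(* Membership in [Mdf] makes theta integrable but not its square, so the energy may be infinite. *)
have [ioo|ifin] := eqVneq (\int[H1]_(x in g) (psi eta (theta x) (tau x))%:E)%E +oo%E.
  by rewrite ioo leey.
rewrite /Rintegral fineK; last exact: (integrable_fin_num mg j1234).
have ipsi : H1.-integrable g (EFin \o (fun x => psi eta (theta x) (tau x))).
  apply/integrableP; split; first exact/measurable_EFinP.
  rewrite (eq_integral (fun x => (psi eta (theta x) (tau x))%:E)) ?ltey// => x _.
  by rewrite /= ger0_norm// psi_ge0.
apply: le_integral => // x /set_mem gx.
by rewrite lee_fin le_psi.
Qed.

End lower_bound.

(** * Existence of the minimum *)

Section minimum.
Context {R : realType} {n : nat}.
Local Notation E := 'rV[R]_n.
Local Notation psie eta := (homog_ext (psi eta)).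

Lemma psie_continuous eta (b : 'rV[int]_n) : 0 <= eta <= 1 ->
  continuous (fun z : E => psie eta b z).
Proof.
move=> e01 x; set L : R := 2 * dot (toR b) (toR b) * n%:R.
have L0 : 0 <= L by rewrite !mulr_ge0// dot_ge0.
have lip (y z : E) : psie eta b y <= psie eta b z + L * `|y - z|.
  apply: le_trans (psie_lipschitz b z y e01) _; rewrite lerD2l /L -[leRHS]mulrA.
  by rewrite ler_wpM2l ?enorm_le_norm// mulr_ge0// dot_ge0.
have FF : Filter (nbhs x) by exact: nbhs_filter.
apply/(@cvgrPdist_le _ _ _ (nbhs x) FF) => e e0; near=> y.
have xy : `|x - y| <= e / (L + 1).
  by near: y; apply: cvgr_dist_le; [exact: cvg_id|rewrite divr_gt0//; lra].
have L1 : 0 < L + 1 by lra.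
move: xy; rewrite ler_pdivlMr// => xy.
have := normr_ge0 (x - y); have := lip x y; have := lip y x; rewrite (distrC y x).
by rewrite ler_norml => *; apply/andP; split; nra.
Unshelve. all: by end_near. Qed.

Lemma split_energy_continuous eta b1 b2 (t : E) : 0 <= eta <= 1 ->
  continuous (fun z : E * E => split_energy eta b1 b2 t z.1 z.2).
Proof.
move=> e01.
have c1 : continuous (fun z : E * E => z.1) by move=> z; exact: cvg_fst.
have c2 : continuous (fun z : E * E => z.2) by move=> z; exact: cvg_snd.
have comp b (u : E * E -> E) : continuous u -> continuous (fun z => psie eta b (u z)).
  by move=> cu z; apply: (@continuous_comp _ _ _ u (fun y => psie eta b y));
    [exact: cu|exact: psie_continuous].
have scal (u : E * E -> E) : continuous u -> continuous (fun z => 2^-1 *: u z).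
  by move=> cu z; apply: (@continuous_comp _ _ _ u (fun y : E => 2^-1 *: y));
    [exact: cu|exact: scaler_continuous].
rewrite /split_energy; do 3 ?[apply: fun_continuousD]; apply: comp => //.
  by apply: scal; exact: fun_continuousB.
apply: fun_continuousB; first exact: cst_continuous.
by apply: scal; exact: fun_continuousD.
Qed.

(** Coercivity: for unit b1 and b2 the energy is at least |z1| and at least |z2|, so beyond the
    radius f (0, 0) it exceeds its value at the origin. *)
Lemma split_energy_min eta b1 b2 (t : E) : 0 <= eta <= 1 ->
  dot (toR b1) (toR b1) = 1 :> R -> dot (toR b2) (toR b2) = 1 :> R ->
  exists z1 z2, forall y1 y2,
    split_energy eta b1 b2 t z1 z2 <= split_energy eta b1 b2 t y1 y2.
Proof.
move=> e01 b11 b22; have e0 : 0 <= eta by case/andP: e01.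
pose f (z : E * E) := split_energy eta b1 b2 t z.1 z.2.
pose B := [set x : E | enorm x <= f (0, 0)]; pose K := B `*` B.
have K0 : K (0, 0) by split; rewrite /B /= enorm0; exact: split_energy_ge0.
have cK : compact K by apply: compact_setX; exact: compact_enorm_le.
have [z zK zmin] := compact_EVT_min (ex_intro _ _ K0) cK
  (continuous_subspaceT (@split_energy_continuous eta b1 b2 t e01)).
exists z.1, z.2 => y1 y2.
have [yK|yK] := pselect (K (y1, y2)); first by apply: (zmin (y1, y2)); exact: mem_set.
have le0 : f z <= f (0, 0) by apply: zmin; exact: mem_set.
apply: le_trans le0 _; rewrite leNgt; apply/negP => lt; apply: yK.
have h1 : enorm y1 <= psie eta b1 y1 by rewrite (le_trans _ (psie_ge b1 y1 e0))// b11 mul1r.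
have h2 : enorm y2 <= psie eta b2 y2 by rewrite (le_trans _ (psie_ge b2 y2 e0))// b22 mul1r.
have h3 := psie_ge0 (b1 - b2) (2^-1 *: (y2 - y1)) e0.
have h4 := psie_ge0 (b1 + b2) (t - 2^-1 *: (y1 + y2)) e0.
have h5 := enorm_ge0 y1; have h6 := enorm_ge0 y2.
have {}lt := ltW lt; rewrite /split_energy in lt.
by split; rewrite /B /=; apply: le_trans lt; lra.
Qed.

End minimum.

(** * Upper bound *)

Section generic_position.
Context {R : realType} {n : nat}.
Local Notation E := 'rV[R]_n.

Lemma poly_nonroot (p : {poly R}) (d : R) : p != 0 -> 0 < d ->
  exists s, [/\ 0 < s, s < d & p.[s] != 0].
Proof.
(* Distinct points strictly between 0 and [d]; [size p] of them are one more than the degree. *)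
move=> p0 d0; pose c (k : nat) := d / k.+2%:R.
have cinj : injective c.
  move=> k l /(mulfI (lt0r_neq0 d0)) /invr_inj /eqP; rewrite eqr_nat => /eqP.
  by case.
have [|] := boolP (all (root p) (map c (iota 0 (size p)))).
  move=> rp; have := max_poly_roots p0 rp.
  by rewrite map_inj_uniq ?iota_uniq// size_map size_iota ltnn => /(_ isT).
move=> /allPn[_ /mapP[k _ ->]] nr; exists (c k); split => //.
  by rewrite divr_gt0// ltr0n.
by rewrite ltr_pdivrMr ?ltr0n// ltr_pMr// ltr1n.
Qed.

Variables (i j : 'I_n) (ij : i != j).

(* A line meets this parabola in at most two points, so [w] can be moved off any
   finite set of lines by an arbitrarily small amount. *)
Definition parabola (w : E) (s : R) : E :=
  w + s *: delta_mx 0 i + s ^+ 2 *: delta_mx 0 j.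

Lemma parabola_i w s : parabola w s 0 i = w 0 i + s.
Proof. by rewrite !mxE !eqxx/= (negbTE ij) mulr1 mulr0 addr0. Qed.

Lemma parabola_j w s : parabola w s 0 j = w 0 j + s ^+ 2.
Proof. by rewrite !mxE !eqxx/= eq_sym (negbTE ij) mulr1 mulr0 addr0. Qed.

(** Eliminating [r] from the coordinates [i] and [j] leaves an equation for [s] of degree 2, or of
    degree 1 if [d] has no component along [i]. *)
Lemma parabola_line (w a d : E) : exists2 p : {poly R}, p != 0 &
  forall s r, parabola w s = a + r *: d -> p.[s] = 0.
Proof.
have [di|di] := eqVneq (d 0 i) 0; last first.
  exists ((d 0 j)%:P * ('X + (w 0 i - a 0 i)%:P) -
          (d 0 i)%:P * ('X^2 + (w 0 j - a 0 j)%:P)).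
    apply/eqP => /(congr1 (fun p : {poly R} => p`_2)).
    rewrite coefB !coefCM !coefD coefX coefXn !coefC/=.
    by rewrite !addr0 mulr0 mulr1 sub0r => /eqP; rewrite oppr_eq0 (negbTE di).
  move=> s r e; have := congr1 (fun v : E => v 0 i) e.
  have := congr1 (fun v : E => v 0 j) e; rewrite parabola_i parabola_j.
  rewrite !mxE !hornerE => hj hi.
  rewrite -[X in d 0 j * X]/(s + w 0 i - a 0 i).
  rewrite -[X in _ - d 0 i * X]/(s ^+ 2 + w 0 j - a 0 j).
  have -> : s + w 0 i - a 0 i = r * d 0 i by lra.
  have -> : s ^+ 2 + w 0 j - a 0 j = r * d 0 j by lra.
  by ring.
exists ('X + (w 0 i - a 0 i)%:P).
  by rewrite -size_poly_eq0 -[X in 'X + X]opprK -polyCN size_XsubC.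
move=> s r e; have := congr1 (fun v : E => v 0 i) e.
rewrite parabola_i !mxE di !hornerE => h.
have e' : s + w 0 i - a 0 i = 0 by lra.
exact: e'.
Qed.

Lemma avoid_lines (T : Type) (l : seq T) (a d : T -> E) (w : E) (e : R) : 0 < e ->
  exists q, enorm (q - w) < e /\
    forall k, (k < size l)%N -> forall x0 r, q <> a (nth x0 l k) + r *: d (nth x0 l k).
Proof.
move=> e0.
have [p p0 hp] : exists2 p : {poly R}, p != 0 & forall s, p.[s] != 0 ->
    forall k, (k < size l)%N -> forall x0 r,
      parabola w s <> a (nth x0 l k) + r *: d (nth x0 l k).
  elim: l => [|x l [p p0 hp]]; first by exists 1; [exact: oner_neq0|].
  have [q q0 hq] := parabola_line w (a x) (d x).
  exists (q * p); first by rewrite mulf_neq0.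
  move=> s; rewrite hornerM mulf_eq0 negb_or => /andP[qs ps] [|k] kl x0 r /=.
    by move=> /hq; apply/eqP.
  exact: hp.
(* For s < 1 the displacement is at most s + s^2 <= 2 s. *)
have d0 : 0 < Num.min 1 (e / 2) by rewrite lt_min ltr01 divr_gt0.
have [s [s0 + ps]] := poly_nonroot p0 d0; rewrite lt_min => /andP[s1 se].
exists (parabola w s); split; last exact: hp.
have unit_delta (k : 'I_n) : enorm (delta_mx 0 k : E) = 1.
  rewrite /enorm /dot (bigD1 k)//= big1 ?addr0 => [|l' lk].
    by rewrite !mxE !eqxx mulr1 sqrtr1.
  by rewrite !mxE eqxx (negbTE lk) mulr0.
have -> : parabola w s - w = s *: delta_mx 0 i + s ^+ 2 *: delta_mx 0 j.
  by apply/rowP => k; rewrite !mxE; ring.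
apply: le_lt_trans (enormD _ _) _.
rewrite !enormZ !unit_delta !mulr1 !ger0_norm ?sqr_ge0 ?ltW//.
have : s ^+ 2 <= s by rewrite expr2 ler_piMr ?ltW.
lra.
Qed.

(** Triples inside [F] are exempt, because the anchors have to stay on the diameter; [D] is the set
    of points already placed. *)
Definition noncollinear (V : eqType) (D F : {pred V}) (pos : V -> E) :=
  {in D &, injective pos} /\
  {in D & &, forall a b c, a != b -> c != a -> c != b ->
     ~~ [&& a \in F, b \in F & c \in F] ->
     forall s, pos c <> pos a + s *: (pos b - pos a)}.

(** Points outside [F] are moved one at a time, each off all lines through two points already
    placed. *)
Lemma generic_position (V : finType) (F : {pred V}) (pos : V -> E) (e : R) :
  0 < e -> {in F &, injective pos} ->
  exists pos' : V -> E, [/\ {in F, pos' =1 pos},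
    forall v, enorm (pos' v - pos v) < e & noncollinear predT F pos'].
Proof.
move=> e0 Finj.
suff H (l : seq V) : exists pos' : V -> E, [/\ {in F, pos' =1 pos},
    forall v, enorm (pos' v - pos v) < e &
    noncollinear [pred v | (v \in F) || (v \in l)] F pos'].
  have [pos' [h1 h2 [inj col]]] := H (enum V).
  exists pos'; split => //; split => [u v _ _|a b c _ _ _].
    by apply: inj; rewrite inE /= mem_enum orbT.
  by apply: col; rewrite inE /= mem_enum orbT.
elim: l => [|w l [pos1 [h1 h2 [inj col]]]].
  exists pos; split => //; first by move=> v; rewrite subrr enorm0.
  split=> [u v|a b c]; rewrite !inE/= ?orbF; first exact: Finj.
  by move=> -> -> ->.
have [wl|wl] := boolP ((w \in F) || (w \in l)).
  exists pos1; split => //; have e' v : (v \in [pred v | (v \in F) || (v \in w :: l)]) =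
      (v \in [pred v | (v \in F) || (v \in l)]).
    by rewrite !inE /=; case: eqVneq => // ->; rewrite wl orbT.
  split=> [u v|a b c]; rewrite !e'; first exact: inj.
  exact: col.
have [wF wl'] : w \notin F /\ w \notin l by apply/andP; rewrite -negb_or.
pose L := [seq x <- enum V | (x \in F) || (x \in l)].
have [q [qw qL]] := avoid_lines (allpairs pair L L)
  (fun x => pos1 x.1) (fun x => pos1 x.2 - pos1 x.1) (pos w) e0.
have qline a b r : (a \in F) || (a \in l) -> (b \in F) || (b \in l) ->
    q <> pos1 a + r *: (pos1 b - pos1 a).
  move=> aL bL; have abL : (a, b) \in allpairs pair L L.
    by apply: allpairs_f; rewrite mem_filter mem_enum andbT.
  have := qL (index (a, b) (allpairs pair L L)); rewrite index_mem => /(_ abL (a, b) r).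
  by rewrite nth_index.
(* The degenerate line through [a] and [a] is a point, which gives injectivity. *)
have qpt a : (a \in F) || (a \in l) -> q <> pos1 a.
  by move=> aL; have := qline a a 0 aL aL; rewrite scale0r addr0.
pose pos2 v := if v == w then q else pos1 v.
have pos2w : pos2 w = q by rewrite /pos2 eqxx.
have pos2N v : v != w -> pos2 v = pos1 v by rewrite /pos2 => /negbTE ->.
have D2 v : v \in [pred v | (v \in F) || (v \in w :: l)] -> v != w ->
    (v \in F) || (v \in l).
  by rewrite !inE /= => /orP[->//|/orP[->//|->]]; rewrite orbT.
exists pos2; split.
- by move=> v vF; rewrite pos2N ?h1//; apply: contraNneq wF => <-.
- by move=> v; rewrite /pos2; case: eqVneq => // ->.
split=> [u v uD vD|a b c aD bD cD ab ca cb nF s].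
  have [->|uw] := eqVneq u w; have [->|vw] := eqVneq v w => //.
  - by rewrite pos2w pos2N// => /qpt; case/(_ (D2 v vD vw)).
  - by rewrite pos2w pos2N// => /esym/qpt; case/(_ (D2 u uD uw)).
  - by rewrite !pos2N//; apply: inj; exact: D2.
have [cw|cw] := eqVneq c w.
  subst c; rewrite pos2w !pos2N//; try by rewrite eq_sym.
  by apply: qline; apply: D2 => //; rewrite eq_sym.
(* If the new point is one of the two that span the line, the affine relation is solved for it; the
   exceptional parameter would make the two old points coincide. *)
have [aw|aw] := eqVneq a w.
  subst a; rewrite pos2w !pos2N//; last by rewrite eq_sym.
  move=> e1; have bw : b != w by rewrite eq_sym.
  have [s1|s1] := eqVneq s 1.
    move: e1; rewrite s1 scale1r addrC subrK => /inj h; move/negP: cb; apply.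
    by apply/eqP/h; exact: D2.
  apply: (@qline c b (- s / (1 - s))) (D2 c cD cw) (D2 b bD bw) _.
  have s1' : 1 - s != 0 by rewrite subr_eq0 eq_sym.
  rewrite e1; apply/rowP => k; rewrite !mxE; field; exact: s1'.
have [bw|bw] := eqVneq b w; last first.
  by rewrite !pos2N//; apply: col => //; exact: D2.
subst b; rewrite pos2w !pos2N// => e1.
have [s0|s0] := eqVneq s 0.
  move: e1; rewrite s0 scale0r addr0 => /inj h; move/negP: ca; apply.
  by apply/eqP/h; exact: D2.
apply: (@qline a c s^-1) (D2 a aD aw) (D2 c cD cw) _.
by rewrite e1; apply/rowP => k; rewrite !mxE; field.
Qed.

End generic_position.

(** * Null sets and the tangent condition *)

Section transversal.
Context {R : realType} {n : nat}.
Local Notation E := 'rV[R]_n.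

Lemma hausdorff1_subsingleton (A : set E) : (forall x y, A x -> A y -> x = y) ->
  hausdorff1 A = 0%E.
Proof.
move=> hA; apply/eqP; rewrite eq_le hausdorff1_ge0 andbT.
apply: ge_ereal_sup => _ [d /= d0 <-]; apply: ereal_inf_lbound.
have A0 : ediam A = 0%E.
  apply/eqP; rewrite eq_le ediam_ge0 andbT; apply: ediam_le => // x y Ax Ay.
  by rewrite (hA x y)// subrr enorm0.
exists (fun k : nat => if k == 0%N then A else set0).
  split; first by move=> x Ax; exists 0%N.
  by move=> k; case: ifP => _; rewrite ?A0 ?ediam0 lee_fin ltW.
by rewrite eseries0// => k _ _; case: ifP => _; rewrite ?A0 ?ediam0.
Qed.

Lemma hausdorff1_bigcup0 (A : nat -> set E) : (forall k, hausdorff1 (A k) = 0%E) ->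
  hausdorff1 (\bigcup_k A k) = 0%E.
Proof.
move=> h; apply/eqP; rewrite eq_le hausdorff1_ge0 andbT.
by apply: le_trans (hausdorff1_sigma_subadditive A) _; rewrite eseries0// => k _ _.
Qed.

Lemma hausdorff1_sub0 (A B : set E) : A `<=` B -> hausdorff1 B = 0%E -> hausdorff1 A = 0%E.
Proof.
move=> AB B0; apply/eqP; rewrite eq_le hausdorff1_ge0 andbT -B0; exact: le_hausdorff1.
Qed.

Lemma hausdorff1_setU0 (A B : set E) : hausdorff1 A = 0%E -> hausdorff1 B = 0%E ->
  hausdorff1 (A `|` B) = 0%E.
Proof.
move=> A0 B0; apply/eqP; rewrite eq_le hausdorff1_ge0 andbT.
apply: (@le_trans _ _ (hausdorff1 A + hausdorff1 B)%E); first exact: outer_measureU2.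
by rewrite A0 B0 adde0.
Qed.

(* A zero where the derivative does not vanish is the only zero in some interval
   with rational end points. *)
Lemma transversal_zeros_null (c : R -> E) (f : R -> R) (S : set R) :
  (forall s, S s -> f s = 0 /\
     exists2 m, m != 0 & (fun h => h^-1 * (f (h + s) - f s)) @ 0^' --> m) ->
  hausdorff1 (c @` S) = 0%E.
Proof.
move=> hS.
pose A (k : nat) : set E := if (unpickle k : option (rat * rat)) is Some q then
  c @` [set s | [/\ S s, ratr q.1 < s, s < ratr q.2 &
     forall r, ratr q.1 < r -> r < ratr q.2 -> f r = 0 -> r = s]] else set0.
apply: (@hausdorff1_sub0 _ (\bigcup_k A k)); last first.
  apply: hausdorff1_bigcup0 => k; rewrite /A; case: (unpickle k) => [q|]; last exact: hausdorff1_0.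
  apply: hausdorff1_subsingleton => _ _ [s [Ss s1 s2 us] <-] [r [Sr r1 r2 ur] <-].
  by congr c; apply: ur => //; have [] := hS _ Ss.
move=> _ [s Ss <-]; have [fs [m m0 hm]] := hS _ Ss.
have : \forall h \near 0^', h^-1 * (f (h + s) - f s) != 0 by exact: (cvgr_neq0 m hm m0).
move=> /nbhs_ballP[d /= d0 hd].
have hd' r : s - d < r -> r < s + d -> f r = 0 -> r = s.
  move=> r1 r2 fr; apply/eqP; apply: contraT => rs.
  have := hd (r - s); rewrite -ball_normE /= sub0r normrN ltr_norml.
  rewrite subrK fr fs subrr mulr0 eqxx => h; apply: h; last by rewrite subr_eq0.
  by apply/andP; split; lra.
have ds1 : s - d < s by rewrite ltrBlDr ltrDl.
have ds2 : s < s + d by rewrite ltrDl.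
have [q1] := rat_in_itvoo ds1; rewrite in_itv/= => /andP[q1d q1s].
have [q2] := rat_in_itvoo ds2; rewrite in_itv/= => /andP[q2s q2d].
exists (pickle (q1, q2)); first exact: I.
rewrite /A pickleK; exists s => //; split => //.
by move=> r r1 r2; apply: hd'; [exact: lt_trans r1|exact: lt_trans r2 _].
Qed.

(** Where [c] meets the line with a velocity not parallel to it, some coordinate of the component
    orthogonal to [v] has a zero with nonvanishing derivative. *)
Lemma C1_transversal_null (c : R -> E) (p v : E) : enorm v = 1 -> C1_curve c ->
  H1 [set x | range (line_map p v) x /\
        exists s, c s = x /\ ~ line v (derive1 c s)] = 0%E.
Proof.
move=> v1 [dc _].
(* The l-th coordinate of the component of [y] orthogonal to [v]. *)
pose L (l : 'I_n) (y : E) := y 0 l - dot y v * v 0 l.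
have LB l y z : L l (y - z) = L l y - L l z by rewrite /L dotBl !mxE; ring.
have LZ l a y : L l (a *: y) = a * L l y by rewrite /L dotZl !mxE; ring.
have cL l : continuous (L l).
  apply: fun_continuousB; first exact: coord_continuous.
  by apply: fun_continuousM; [exact: dot_continuous|exact: cst_continuous].
pose S l := [set s | L l (c s - p) = 0 /\ L l (derive1 c s) != 0].
apply: (@hausdorff1_sub0 _ (\bigcup_k \bigcup_(l in [set l : 'I_n | val l = k]) c @` S l)).
  move=> _ [[r _ <-] [s [cs nl]]].
  have [l nz] : exists l, L l (derive1 c s) != 0.
    apply/not_existsP => h; apply: nl; exists (dot (derive1 c s) v) => //.
    apply/rowP => l; rewrite mxE; apply/esym/eqP; rewrite -subr_eq0.
    by have /negP := h l; rewrite negbK.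
  exists (val l) => //; exists l => //; exists s => //; split => //.
  rewrite cs /line_map addrAC subrr add0r LZ /L -sqr_enorm v1 expr1n mul1r subrr.
  by rewrite mulr0.
apply: hausdorff1_bigcup0 => k.
have [kn|kn] := ltnP k n; last first.
  rewrite (_ : bigcup _ _ = set0) ?hausdorff1_0//; apply/seteqP; split => // x [l /= lk].
  by move: (ltn_ord l); rewrite [nat_of_ord l]lk ltnNge kn.
apply: (@hausdorff1_sub0 _ (c @` S (Ordinal kn))).
  by move=> x [l /= lk]; rewrite (_ : l = Ordinal kn)//; exact/val_inj.
set l := Ordinal kn; apply: (@transversal_zeros_null c (fun s => L l (c s - p))).
move=> s [s0 s1]; split => //; exists (L l (derive1 c s)) => //.
have hc : (fun h : R => h^-1 *: (c (h + s) - c s)) @ 0^' --> derive1 c s.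
  have e : (fun h : R => h^-1 *: (c (h + s) - c s)) =
      (fun h : R => h^-1 *: ((c \o shift s) (h *: (1 : R)) - c s)).
    by apply/funext => h /=; rewrite [h *: 1]mulr1.
  by have := dc s; rewrite /derivable -e.
have -> : (fun h => h^-1 * (L l (c (h + s) - p) - L l (c s - p))) =
    (fun h => L l (h^-1 *: (c (h + s) - c s))).
  by apply/funext => h; rewrite -LB LZ opprB addrA subrK.
exact: (continuous_cvg _ (cL l _) hc).
Qed.

End transversal.

Section union_integral.
Context d (T : measurableType d) (R : realType).
Variable mu : {measure set T -> \bar R}.

Lemma integrable_Rintegral_bigsetU (I : choiceType) (r : seq I) (D : I -> set T) (F : T -> R) :
  (forall i, measurable (D i)) -> (forall i j, i != j -> D i `&` D j = set0) ->
  (forall i, mu.-integrable (D i) (EFin \o F)) -> uniq r ->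
  mu.-integrable (\big[setU/set0]_(i <- r) D i) (EFin \o F) /\
  \int[mu]_(x in \big[setU/set0]_(i <- r) D i) F x =
    \sum_(i <- r) \int[mu]_(x in D i) F x.
Proof.
move=> mD dD iF; elim: r => [_|i r ih /andP[ir /ih [ih1 ih2]]].
  by rewrite !big_nil Rintegral_set0; split => //; apply: integrable_set0.
have mU : measurable (\big[setU/set0]_(i <- r) D i) by exact: bigsetU_measurable.
have dU : [disjoint D i & \big[setU/set0]_(i <- r) D i].
  rewrite disj_set2E; apply/eqP; rewrite -subset0 => x [Dx].
  rewrite -bigcup_seq => -[j /= jr Dj].
  have ij : i != j by apply: contraNneq ir => ->.
  by have : (D i `&` D j) x by []; rewrite dD.
have iU : mu.-integrable (D i `|` \big[setU/set0]_(i <- r) D i) (EFin \o F).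
  have /integrableP[m1 b1] := iF i; have /integrableP[m2 b2] := ih1.
  have mF : measurable_fun (D i `|` \big[setU/set0]_(i <- r) D i) (EFin \o F).
    by apply/measurable_funU.
  apply/integrableP; split => //.
  rewrite ge0_integral_setU//; first by rewrite lte_add_pinfty.
  by apply: measurableT_comp.
by rewrite !big_cons; split => //; rewrite Rintegral_setU// ih2.
Qed.

End union_integral.

(** * The measure carried by a finite network of segments *)

Section network.
Context {R : realType} {n : nat}.
Local Notation E := 'rV[R]_n.
Local Notation H1 := (@H1 R n).
Local Notation psie eta := (homog_ext (psi eta)).
Variables (I : finType) (P Q : I -> E) (b : I -> 'rV[int]_n).
Hypothesis PQ : forall e, P e != Q e.

Definition elen e := enorm (Q e - P e).
Definition edir e : E := (elen e)^-1 *: (Q e - P e).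
Definition edge e : set (H1space R n) := line_map (P e) (edir e) @` `]0, elen e[.

Hypothesis edge_null : forall e f, e != f -> H1 (edge e `&` edge f) = 0%E.

Lemma elen_gt0 e : 0 < elen e.
Proof. by rewrite enorm_gt0 subr_eq0 eq_sym. Qed.

Lemma enorm_edir e : enorm (edir e) = 1.
Proof.
by rewrite enormZ gtr0_norm ?invr_gt0 ?elen_gt0// mulVf// gt_eqF// elen_gt0.
Qed.

Lemma elenZ e : elen e *: edir e = Q e - P e.
Proof. by rewrite scalerA mulfV ?scale1r// gt_eqF// elen_gt0. Qed.

Lemma edge_end e : line_map (P e) (edir e) (elen e) = Q e.
Proof. by rewrite /line_map elenZ addrC subrK. Qed.

Lemma edge_measurable e : measurable (edge e).
Proof. by apply: line_image_measurable; [exact: enorm_edir|]. Qed.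

Lemma H1_edge e : H1 (edge e) = (elen e)%:E.
Proof.
rewrite /edge H1_line ?enorm_edir// lebesgue_measure_itv/= lte_fin elen_gt0.
by rewrite sube0.
Qed.

(** Removed from the edges so that every remaining point lies on one edge only, which makes the
    multiplier and the tangent well defined. *)
Definition crossings : set (H1space R n) :=
  \big[setU/set0]_(p : I * I | p.1 != p.2) (edge p.1 `&` edge p.2).

Lemma crossings_measurable : measurable crossings.
Proof.
by apply: bigsetU_measurable => p _; apply: measurableI; exact: edge_measurable.
Qed.

Lemma crossings_null : H1 crossings = 0%E.
Proof.
rewrite /crossings; elim/big_ind: _ => [|A B A0 B0|p]; [exact: hausdorff1_0| |].
  exact: hausdorff1_setU0.
exact: edge_null.
Qed.

Definition arc e : set (H1space R n) := edge e `\` crossings.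

Lemma arc_measurable e : measurable (arc e).
Proof. by apply: measurableD; [exact: edge_measurable|exact: crossings_measurable]. Qed.

Lemma arc_disjoint e f : e != f -> arc e `&` arc f = set0.
Proof.
move=> ef; apply/seteqP; split => // x [[ex nx] [fx _]]; apply: nx.
rewrite /crossings -bigcup_seq_cond; exists (e, f) => //=.
by rewrite mem_index_enum.
Qed.

Definition network : set (H1space R n) := \big[setU/set0]_(e : I) arc e.
Definition edge_at x : option I := [pick e | `[< arc e x >]].
Definition net_theta x : 'rV[int]_n := if edge_at x is Some e then b e else 0.
Definition net_tau x : E := if edge_at x is Some e then edir e else 0.

Lemma edge_atE e x : arc e x -> edge_at x = Some e.
Proof.
move=> ex; rewrite /edge_at; case: pickP => [f /asboolP fx|/(_ e)]; last first.
  by rewrite asboolT.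
congr Some; apply/eqP; apply: contraT => fe.
by have := arc_disjoint fe; rewrite -subset0 => /(_ x); case.
Qed.

Lemma network_measurable : measurable network.
Proof. by apply: bigsetU_measurable => e _; exact: arc_measurable. Qed.

(** The crossings form a null set, so the integrals over the disjoint arcs equal those over whole
    edges. *)
Lemma network_integral (A : set (H1space R n)) (F : E -> R) (f : I -> E -> R) :
  measurable A -> (forall e x, arc e x -> F x = f e x) ->
  (forall e, H1.-integrable (edge e) (EFin \o f e)) ->
  H1.-integrable (network `&` A) (EFin \o F) /\
  \int[H1]_(x in network `&` A) F x = \sum_e \int[H1]_(x in edge e `&` A) f e x.
Proof.
move=> mA Ff iF.
have mD e : measurable (arc e `&` A) by apply: measurableI => //; exact: arc_measurable.
have dD e e' : e != e' -> (arc e `&` A) `&` (arc e' `&` A) = set0.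
  by move=> ee'; rewrite setIACA arc_disjoint// set0I.
have ifA e : H1.-integrable (edge e `&` A) (EFin \o f e).
  apply: integrableS (iF e) => //; first exact: edge_measurable.
  by apply: measurableI => //; exact: edge_measurable.
have iFA e : H1.-integrable (arc e `&` A) (EFin \o f e).
  apply: integrableS (iF e) => //; first exact: edge_measurable.
  by move=> x [[]].
have eqF e : {in arc e `&` A, F =1 f e} by move=> x /set_mem [ex _]; exact: Ff.
have iFD e : H1.-integrable (arc e `&` A) (EFin \o F).
  have h : {in arc e `&` A, EFin \o f e =1 EFin \o F}.
    by move=> x xD; rewrite /= (eqF e).
  exact: (eq_integrable (mD e) _ _ h (iFA e)).
have [h1 h2] := integrable_Rintegral_bigsetU mD dD iFD (index_enum_uniq I).
have -> : network `&` A = \big[setU/set0]_(e <- index_enum I) (arc e `&` A).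
  by rewrite /network big_distrl.
split => //; rewrite h2; apply: eq_bigr => e _.
rewrite (eq_Rintegral _ (eqF e)); congr fine.
rewrite [RHS](negligible_integral crossings_measurable _ (ifA e) crossings_null).
  by rewrite (_ : (edge e `&` A) `\` crossings = arc e `&` A)// /arc !setDE setIAC.
by apply: measurableI => //; exact: edge_measurable.
Qed.

(** Interior points of the edge are proper convex combinations, so one of the end points may lie on
    the sphere. *)
Lemma edge_ball e : (forall e, enorm (P e) <= 2^-1) -> (forall e, enorm (Q e) <= 2^-1) ->
  (enorm (P e) < 2^-1) || (enorm (Q e) < 2^-1) -> edge e `<=` eball 0 2^-1.
Proof.
move=> hP hQ hPQ _ [s /= + <-]; rewrite in_itv/= => /andP[s0 sl].
have l0 := elen_gt0 e; set k := s / elen e.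
have k0 : 0 < k by rewrite divr_gt0.
have k1 : k < 1 by rewrite ltr_pdivrMr// mul1r.
have -> : line_map (P e) (edir e) s = (1 - k) *: P e + k *: Q e.
  rewrite /line_map /edir scalerA -/k scalerBr scalerBl scale1r.
  by rewrite [k *: Q e - _]addrC addrA.
apply/eballE; apply: le_lt_trans (enormD _ _) _; rewrite !enormZ.
rewrite !gtr0_norm//; last by lra.
have := hP e; have := hQ e; case/orP: hPQ => h1 h2 h3; nra.
Qed.

Lemma network_unit_tangent : unit_tangent network net_tau.
Proof.
have tauE e x : arc e x -> net_tau x = edir e by rewrite /net_tau => /edge_atE ->.
have inarc x : network x -> exists e, arc e x.
  by rewrite /network -bigcup_pred => -[e _ ex]; exists e.
split.
- move=> j; have [h _] := @network_integral setT (fun x => net_tau x 0 j)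
    (fun e _ => edir e 0 j) measurableT (fun e x ex => congr1 (fun v : E => v 0 j) (tauE e x ex))
    (fun e => integrable_segment (P e) _ _ (enorm_edir e) (@cst_continuous _ _ (edir e 0 j))).
  by rewrite setIT in h; apply/measurable_EFinP; exact: (measurable_int H1 h).
- by move=> x /inarc [e ex]; rewrite (tauE e x ex) enorm_edir.
- move=> c Cc.
  apply: (@hausdorff1_sub0 _ _ _ (\big[setU/set0]_(e : I) [set x |
      range (line_map (P e) (edir e)) x /\
      exists s, c s = x /\ ~ line (edir e) (derive1 c s)])).
    move=> x [/inarc [e ex] [s [cs ns]]]; rewrite -bigcup_pred; exists e => //; split.
      by case: ex => -[r _ <-] _; exists r.
    by exists s; split => //; rewrite -(tauE e x ex).
  elim/big_ind: _ => [|X Y X0 Y0|e _]; [exact: hausdorff1_0|exact: hausdorff1_setU0|].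
  exact: C1_transversal_null (enorm_edir e) Cc.
Qed.

Lemma line_map_lipschitz (p v : E) : lipschitz (line_map p v).
Proof.
apply: (@klipschitzW _ _ _ `|v|).
  exact: (@globally_properfilter _ _ (0, 0)).
move=> [x y] _ /=; rewrite /line_map opprD addrACA subrr add0r -scalerBl normrZ.
by rewrite mulrC.
Qed.

Lemma network_rectifiable : rectifiable1 network.
Proof.
split; first exact: network_measurable.
exists (fun k => if [pick e | nat_of_ord (enum_rank e) == k] is Some e
  then line_map (P e) (edir e) else line_map 0 0); split.
  by move=> k; case: pickP => [e _|_]; exact: line_map_lipschitz.
rewrite (_ : _ `\` _ = set0) ?measure0//; apply/seteqP; split => // x [].
rewrite /network -bigcup_pred => -[e _ [[r _ rx] _]]; apply.
exists (nat_of_ord (enum_rank e)) => //=; case: pickP => [f /eqP /val_inj /enum_rank_inj ->|/(_ e)].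
  by exists r.
by rewrite eqxx.
Qed.

Lemma Rintegral_edge_cst e (A : set (H1space R n)) (k : R) :
  H1.-integrable (edge e) (EFin \o cst k).
Proof. exact: (integrable_segment (P e) _ _ (enorm_edir e) (@cst_continuous _ _ k)). Qed.

Lemma net_thetaE e x : arc e x -> net_theta x = b e.
Proof. by rewrite /net_theta => /edge_atE ->. Qed.

Lemma net_tauE e x : arc e x -> net_tau x = edir e.
Proof. by rewrite /net_tau => /edge_atE ->. Qed.

(** By [segment_FTC] the divergence condition becomes Kirchhoff's law at the vertices. Vertices on
    the sphere are exempt, since test functions vanish there. *)
Lemma network_Mdf :
  (forall e, enorm (P e) <= 2^-1) -> (forall e, enorm (Q e) <= 2^-1) ->
  (forall e, (enorm (P e) < 2^-1) || (enorm (Q e) < 2^-1)) ->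
  (forall phi : E -> R, (forall x, 2^-1 <= enorm x -> phi x = 0) ->
     forall i, \sum_e (b e 0 i)%:~R * (phi (Q e) - phi (P e)) = 0) ->
  Mdf (eball 0 2^-1) network net_theta net_tau.
Proof.
move=> hP hQ hPQ kirchhoff; split.
- move=> x; rewrite /network -bigcup_pred => -[e _ [ex _]].
  exact: (edge_ball hP hQ (hPQ e)) ex.
- exact: network_rectifiable.
- exact: network_unit_tangent.
- move=> i; have [h _] := @network_integral setT (fun x => (net_theta x 0 i)%:~R)
    (fun e => cst (b e 0 i)%:~R) measurableT
    (fun e x ex => congr1 (fun v : 'rV[int]_n => (v 0 i)%:~R : R) (net_thetaE ex))
    (fun e => Rintegral_edge_cst e setT _).
  by rewrite setIT in h.
- move=> phi [Cphi _ supp] i.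
  have phi0 x : 2^-1 <= enorm x -> phi x = 0.
    move=> xB; apply/eqP; apply: contraT => nz.
    have /supp /eballE : closure [set x | phi x != 0] x by exact: subset_closure.
    by rewrite ltNge xB.
  have cd j : continuous (pderiv j phi) by case: (Cphi 1%N) => _ /(_ j) [_ []].
  pose f j e x := pderiv j phi x * (edir e 0 j * (b e 0 i)%:~R).
  have cf j e : continuous (f j e).
    by apply: fun_continuousM => //; exact: cst_continuous.
  have if_ j e : H1.-integrable (edge e) (EFin \o f j e).
    exact: (integrable_segment (P e) _ _ (enorm_edir e) (cf j e)).
  have fE j e x : arc e x ->
      pderiv j phi x * tensor (net_theta x) (net_tau x) i j = f j e x.
    by move=> ex; rewrite (net_thetaE ex) (net_tauE ex) tensorE /f; ring.
  rewrite (eq_bigr (fun j => \sum_e \int[H1]_(x in edge e) f j e x)); last first.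
    move=> j _; have [_] := @network_integral setT _ _ measurableT (fE j) (if_ j).
    by rewrite setIT => ->; apply: eq_bigr => e _; rewrite setIT.
  rewrite exchange_big /= -[RHS](kirchhoff phi phi0 i); apply: eq_bigr => e _.
  have := segment_FTC (P e) (enorm_edir e) (ltW (elen_gt0 e)) (Cphi 1%N).
  rewrite edge_end {2}/line_map scale0r addr0 => <-.
  rewrite -RintegralZl//; last first.
  + apply: (integrable_segment (P e) _ _ (enorm_edir e)).
    apply: continuous_big => [|j _]; first exact: add_continuous.
    by apply: fun_continuousM => //; exact: cst_continuous.
  + exact: edge_measurable.
  rewrite -(Rintegral_sum _ (edge_measurable e) (fun j => if_ j e)).
  apply: eq_Rintegral => x _; rewrite mulr_sumr; apply: eq_bigr => j _.
  by rewrite /f; ring.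
Qed.

Lemma network_energy eta :
  (\int[H1]_(x in network) (psi eta (net_theta x) (net_tau x))%:E =
    (\sum_e psie eta (b e) (Q e - P e))%:E)%E.
Proof.
have [h] := @network_integral setT (fun x => psi eta (net_theta x) (net_tau x))
  (fun e => cst (psi eta (b e) (edir e))) measurableT
  (fun e x ex => congr2 (psi eta) (net_thetaE ex) (net_tauE ex))
  (fun e => Rintegral_edge_cst e setT _).
rewrite setIT in h * => h2.
rewrite -(fineK (integrable_fin_num network_measurable h)).
congr (_%:E); apply: etrans h2 _; apply: eq_bigr => e _.
rewrite setIT Rintegral_cst; last exact: edge_measurable.
have /= -> := H1_edge e.
rewrite -elenZ psieZ (psieE_unit _ _ (enorm_edir e)) /= mulrC.
by rewrite gtr0_norm// elen_gt0.
Qed.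

Lemma network_line_measure (A : set (H1space R n)) : measurable A ->
  line_measure network net_theta net_tau A =
  \matrix_(i, j) \sum_e tensor (b e) (edir e) i j * fine (H1 (edge e `&` A)).
Proof.
move=> mA; apply/matrixP => i j; rewrite !mxE.
have [_ ->] := @network_integral A
  (fun x => tensor (net_theta x) (net_tau x) i j)
  (fun e => cst (tensor (b e) (edir e) i j)) mA
  (fun e x ex => congr2 (fun u v => tensor u v i j) (net_thetaE ex) (net_tauE ex))
  (fun e => Rintegral_edge_cst e setT _).
apply: eq_bigr => e _; rewrite Rintegral_cst//.
by apply: measurableI => //; exact: edge_measurable.
Qed.

End network.

(** * Edges of a graph in general position *)

Section graph.
Context {R : realType} {n : nat}.
Local Notation E := 'rV[R]_n.
Local Notation H1 := (@H1 R n).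

Lemma line_two_points (p q p' q' x y : E) (s1 s2 r1 r2 : R) : x <> y ->
  x = p + s1 *: q -> y = p + s2 *: q -> x = p' + r1 *: q' -> y = p' + r2 *: q' ->
  (exists s, p' = p + s *: q) /\ (exists s, p' + q' = p + s *: q).
Proof.
move=> xy x1 y1 x2 y2.
have rr : r2 - r1 != 0.
  by rewrite subr_eq0; apply/eqP => e; apply: xy; rewrite x2 y2 e.
have q'E : q' = ((s2 - s1) / (r2 - r1)) *: q.
  have e : (r2 - r1) *: q' = (s2 - s1) *: q.
    rewrite !scalerBl; have := y2; rewrite y1 => e2; have := x2; rewrite x1 => e1.
    apply/rowP => k; have := congr1 (fun v : E => v 0 k) e1.
    by have := congr1 (fun v : E => v 0 k) e2; rewrite !mxE; lra.
  by rewrite mulrC -scalerA -e scalerA mulVf// scale1r.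
set m := _ / _ in q'E.
have p'E : p' = p + (s1 - r1 * m) *: q.
  apply/rowP => k; have := congr1 (fun v : E => v 0 k) x2.
  by rewrite x1 q'E !mxE; lra.
split; first by exists (s1 - r1 * m).
exists (s1 - r1 * m + m); rewrite {1}p'E q'E -addrA -scalerDl.
by [].
Qed.

Lemma edgeP (I : finType) (P Q : I -> E) e x : P e != Q e -> edge P Q e x ->
  exists s, x = P e + s *: (Q e - P e).
Proof.
move=> PQ [s _ <-]; exists (s / elen P Q e).
by rewrite /line_map /edir scalerA.
Qed.

Section edges.
Variables (V I : finType) (F : {pred V}) (pos : V -> E) (tl hd : I -> V) (rk : V -> nat).
Hypotheses (gen : noncollinear predT F pos)
  (rk_lt : forall e, (rk (tl e) < rk (hd e))%N)
  (ends_inj : injective (fun e => (tl e, hd e))).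
Let P e := pos (tl e).
Let Q e := pos (hd e).

Lemma graph_tl_hd e : tl e != hd e.
Proof. by apply: contraTneq (rk_lt e) => ->; rewrite ltnn. Qed.

Lemma graph_PQ e : P e != Q e.
Proof.
by apply: contraNneq (graph_tl_hd e) => h; apply/eqP; exact: gen.1 h.
Qed.

(** Two edges that share two points lie on one line, so an end of [f] that is not an end of [e]
    would be collinear with the ends of [e]. *)
Lemma graph_edges_null :
  (forall e f, e != f -> tl e \in F -> hd e \in F -> tl f \in F -> hd f \in F ->
     edge P Q e `&` edge P Q f = set0) ->
  forall e f, e != f -> H1 (edge P Q e `&` edge P Q f) = 0%E.
Proof.
move=> hF e f ef.
have [/and4P[h1 h2 h3 h4]|nF] := boolP [&& tl e \in F, hd e \in F, tl f \in F & hd f \in F].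
  by rewrite hF// measure0.
(* If both ends of [e] are in [F], an end of [f] outside [F] serves. Otherwise some end of [f] is
   not an end of [e]: edges with the same two ends are oriented alike by the rank, hence equal. *)
have [w [wf wt wh wF]] : exists w, [/\ (w == tl f) || (w == hd f), w != tl e, w != hd e &
    ~~ [&& tl e \in F, hd e \in F & w \in F]].
  have [/andP[te he]|eF] := boolP ((tl e \in F) && (hd e \in F)).
    move: nF; rewrite te he /= negb_and => /orP[wF|wF].
      exists (tl f); split => //; first by rewrite eqxx.
      - by apply: contraNneq wF => ->.
      - by apply: contraNneq wF => ->.
    exists (hd f); split => //; first by rewrite eqxx orbT.
    - by apply: contraNneq wF => ->.
    - by apply: contraNneq wF => ->.
  have eF' w : ~~ [&& tl e \in F, hd e \in F & w \in F].
    by rewrite andbA negb_and eF.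
  have [/orP|] := boolP ((tl f == tl e) || (tl f == hd e)); last first.
    by rewrite negb_or => /andP[? ?]; exists (tl f); rewrite eqxx.
  have [/orP|] := boolP ((hd f == tl e) || (hd f == hd e)); last first.
    by rewrite negb_or => /andP[? ?] _; exists (hd f); rewrite eqxx orbT.
  have re := rk_lt e; have rf := rk_lt f.
  move=> [/eqP h|/eqP h] [/eqP t|/eqP t]; rewrite h t ?ltnn in rf => //.
  - by move: (ltn_trans re rf); rewrite ltnn.
  - by move/eqP: ef; case; apply: ends_inj; rewrite /= h t.
apply: hausdorff1_subsingleton => x y [ex fx] [ey fy]; apply/not_notP => xy.
have [s1 x1] := edgeP (graph_PQ e) ex; have [s2 y1] := edgeP (graph_PQ e) ey.
have [r1 x2] := edgeP (graph_PQ f) fx; have [r2 y2] := edgeP (graph_PQ f) fy.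
have [[s hs] [s' hs']] := line_two_points xy x1 y1 x2 y2.
have col := gen.2 (tl e) (hd e) w isT isT isT (graph_tl_hd e) wt wh wF.
case/orP: wf => /eqP wE; subst w; first exact: (col s) hs.
by apply: (col s'); rewrite -[RHS]hs' addrC subrK.
Qed.

End edges.

Lemma end_edge (I : finType) (P Q : I -> E) e (t : E) (a c : R) : enorm t = 1 -> a < c ->
  P e = a *: t -> Q e = c *: t ->
  edir P Q e = t /\ edge P Q e = line_map 0 t @` `]a, c[.
Proof.
move=> t1 ac Pe Qe.
have l : elen P Q e = c - a.
  by rewrite /elen Pe Qe -scalerBl enormZ t1 mulr1 ger0_norm//; lra.
have dE : edir P Q e = t.
  rewrite /edir l Pe Qe -scalerBl scalerA mulVf ?scale1r//; lra.
split => //; rewrite /edge dE l Pe; apply/seteqP; split => _ [s /= + <-];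
  rewrite in_itv/= => /andP[s0 s1].
  exists (a + s); first by rewrite /= in_itv/=; apply/andP; split; lra.
  by rewrite /line_map add0r scalerDl.
exists (s - a); first by rewrite /= in_itv/=; apply/andP; split; lra.
by rewrite /line_map add0r -scalerDl addrC subrK.
Qed.

Lemma edge_sub_ball (I : finType) (P Q : I -> E) e (r : R) : P e != Q e ->
  enorm (P e) < r -> enorm (Q e) < r -> edge P Q e `<=` eball 0 r.
Proof.
move=> PQ hP hQ _ [s /= + <-]; rewrite in_itv/= => /andP[s0 sl].
have l0 : 0 < elen P Q e by rewrite /elen enorm_gt0 subr_eq0 eq_sym.
set k := s / elen P Q e.
have k0 : 0 < k by rewrite divr_gt0.
have k1 : k < 1 by rewrite ltr_pdivrMr// mul1r.
have -> : line_map (P e) (edir P Q e) s = (1 - k) *: P e + k *: Q e.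
  rewrite /line_map /edir scalerA -/k scalerBr scalerBl scale1r.
  by rewrite [k *: Q e - _]addrC addrA.
apply/eballE; apply: le_lt_trans (enormD _ _) _; rewrite !enormZ.
rewrite !gtr0_norm//; last by lra.
nra.
Qed.

End graph.

(** * Combinatorics of the ladder *)

Section ladder.
Context {R : realType} {n : nat}.
Local Notation E := 'rV[R]_n.
Local Notation H1 := (@H1 R n).
Local Notation psie eta := (homog_ext (psi eta)).
Variables (m N : nat).

Definition vertex : finType := ((bool * bool) + ('I_m * 'I_N.+1 * 'I_4))%type.
(** The connectors [inr (inl (k, _))] have length zero before the perturbation: they tie the movable
    ends of the chains to the fixed anchors that all chains share. *)
Definition link : finType := (bool + ('I_m * bool + 'I_m * 'I_N * 'I_6))%type.

(* [inner] distinguishes the points where the network leaves the diameter from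
   the end points of the diameter. *)
Definition anchor (side inner : bool) : vertex := inl (side, inner).
Definition corner (k : 'I_m) (l : nat) (r : nat) : vertex := inr (k, inord l, inord r).

(* Edge [c] of a cell goes from corner [cell_tail c] to corner [cell_head c];
   edge 5 ends at corner 0 of the next cell. *)
Definition cell_tail (c : nat) := nth 0%N [:: 0; 0; 1; 1; 2; 3]%N c.
Definition cell_head (c : nat) := nth 0%N [:: 1; 2; 2; 3; 3; 0]%N c.

Lemma cell_tail_lt c : (cell_tail c < 4)%N.
Proof. by case: c => [|[|[|[|[|[|[|?]]]]]]]. Qed.

Lemma cell_head_lt c : (cell_head c < 4)%N.
Proof. by case: c => [|[|[|[|[|[|[|?]]]]]]]. Qed.

Definition link_tail (e : link) : vertex :=
  match e with
  | inl side => anchor side side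
  | inr (inl (k, false)) => anchor false true
  | inr (inl (k, true)) => corner k N 0
  | inr (inr (k, l, c)) => corner k l (cell_tail c)
  end.

Definition link_head (e : link) : vertex :=
  match e with
  | inl side => anchor side (~~ side)
  | inr (inl (k, false)) => corner k 0 0
  | inr (inl (k, true)) => anchor true true
  | inr (inr (k, l, c)) => corner k (if c == 5%N :> nat then l.+1 else l) (cell_head c)
  end.

(** Increases along every link. Corners have rank at most 4 N + 5, as l <= N and r <= 3, so the
    right-hand anchors get 4 N + 6 and 4 N + 7. *)
Definition vertex_rank (v : vertex) : nat :=
  match v with
  | inl (false, inner) => inner
  | inl (true, inner) => (4 * N + 7 - inner)%N
  | inr (k, l, r) => (2 + 4 * l + r)%N
  end.

Definition anchors : {pred vertex} := [pred v | if v is inl _ then true else false].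

Lemma link_rank e : (vertex_rank (link_tail e) < vertex_rank (link_head e))%N.
Proof.
case: e => [[|]|[[k [|]]|[[k l] c]]] //=.
- lia.
- by rewrite !inordK//; lia.
- have h1 : (l < N.+1)%N by have := ltn_ord l; lia.
  have h2 : (l.+1 < N.+1)%N by rewrite ltnS.
  case: c => [[|[|[|[|[|[|//]]]]]] ci];
    rewrite /cell_tail /cell_head /= (inordK h1) ?(inordK h2) !inordK//; lia.
Qed.

Lemma link_inj : injective (fun e => (link_tail e, link_head e)).
Proof.
have inordI (p a b : nat) : (a <= p)%N -> (b <= p)%N -> inord a = inord b :> 'I_p.+1 -> a = b.
  by move=> ap bp /(congr1 val); rewrite /= !inordK.
move=> [[|]|[[k [|]]|[[k l] c]]] [[|]|[[k' [|]]|[[k' l'] c']]] //=;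
  try (by case); try (by case=> ->); try (by case=> _ ->).
case=> <- /inordI h1 h2 _ _ h4.
have ll := ltn_ord l; have ll' := ltn_ord l'.
have {}h1 : val l = val l' by apply: h1; lia.
have lE : l = l' by exact/val_inj.
have tE : cell_tail c = cell_tail c' by move: h2 => /inordI; apply; exact: cell_tail_lt.
have hE : cell_head c = cell_head c' by move: h4 => /inordI; apply; exact: cell_head_lt.
rewrite lE; congr (inr (inr (_, _, _))); apply: val_inj.
by move: tE hE; clear; case: c => [[|[|[|[|[|[|//]]]]]] ?]; case: c' => [[|[|[|[|[|[|//]]]]]] ?].
Qed.

Variables (sigma : int) (b1 b2 : 'rV[int]_n).
Let b12 := m%:Z *: (sigma *: (b1 + b2)).

(** Corners 0, 1, 3, 2 form a parallelogram with sides z1/2 and z2/2. b1 runs along both sides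
    parallel to z1, b2 along both parallel to z2, b1 - b2 along the diagonal from 1 to 2, and b1 +
    b2 leaves from corner 3; the charges balance at each corner. *)
Definition cell_charge (c : nat) : 'rV[int]_n :=
  nth 0 [:: b1; b2; b1 - b2; b2; b1; b1 + b2] c.

Definition link_charge (e : link) : 'rV[int]_n :=
  match e with
  | inl _ => b12
  | inr (inl _) => sigma *: (b1 + b2)
  | inr (inr (_, _, c)) => sigma *: cell_charge c
  end.

Lemma sum_link (G : link -> R) : \sum_e G e = G (inl false) + G (inl true) +
  \sum_(k < m) (G (inr (inl (k, false))) + G (inr (inl (k, true))) +
    \sum_(l < N) \sum_(c < 6) G (inr (inr (k, l, c)))).
Proof.
rewrite big_sumType/= big_bool [X in X + _ = _]addrC; congr (_ + _).
rewrite big_sumType/= big_split; congr (_ + _).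
  transitivity (\sum_(p : 'I_m * bool) G (inr (inl (p.1, p.2)))).
    by apply: eq_bigr => -[].
  rewrite -(pair_bigA _ (fun k s => G (inr (inl (k, s))))).
  by apply: eq_bigr => k _; rewrite big_bool addrC.
transitivity (\sum_(p : 'I_m * 'I_N * 'I_6) G (inr (inr (p.1.1, p.1.2, p.2)))).
  by apply: eq_bigr => -[[]].
rewrite -(pair_bigA _ (fun (kl : 'I_m * 'I_N) c => G (inr (inr (kl.1, kl.2, c)))))/=.
by rewrite -(pair_bigA _ (fun k l => \sum_(c < 6) G (inr (inr (k, l, c))))).
Qed.

Lemma sum_cell (G : 'I_6 -> R) : \sum_(c < 6) G c =
  G (inord 0) + G (inord 1) + G (inord 2) + G (inord 3) + G (inord 4) + G (inord 5).
Proof.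
rewrite 6!big_ord_recr big_ord0 /= add0r.
by do 5?[congr (_ + _)]; congr G; apply/val_inj; rewrite /= inordK.
Qed.

(** A cell acts as a single edge of charge sigma (b1 + b2) from its corner 0 to that of the next
    cell, so a chain telescopes. *)
Lemma kirchhoff (f : vertex -> R) i :
  f (anchor false false) = 0 -> f (anchor true false) = 0 ->
  \sum_e (link_charge e 0 i)%:~R * (f (link_head e) - f (link_tail e)) = 0.
Proof.
move=> f0 f1; rewrite sum_link /= f0 f1.
pose s : R := (sigma * (b1 0 i + b2 0 i))%:~R.
have cells (k : 'I_m) : \sum_(l < N) \sum_(c < 6)
    (((sigma *: cell_charge c) 0 i)%:~R *
    (f (corner k (if c == 5%N :> nat then l.+1 else l) (cell_head c)) -
     f (corner k l (cell_tail c)))) = s * (f (corner k N 0) - f (corner k 0 0)).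
  transitivity (\sum_(l < N) s * (f (corner k l.+1 0) - f (corner k l 0))).
    apply: eq_bigr => l _; rewrite sum_cell !inordK//= !mxE /s.
    by rewrite !(rmorphM, rmorphD, rmorphN) /=; ring.
  rewrite -mulr_sumr -(big_mkord xpredT (fun l => f (corner k l.+1 0) - f (corner k l 0))).
  by rewrite telescope_sumr.
rewrite (eq_bigr (fun=> s * (f (anchor true true) - f (anchor false true)))); last first.
  by move=> k _; rewrite cells !mxE -/s; ring.
rewrite sumr_const card_ord !mxE -mulr_natl.
have -> : (m%:Z * (sigma * (b1 0 i + b2 0 i)))%:~R = m%:R * s by rewrite rmorphM.
by ring.
Qed.

End ladder.

(** * The perturbed ladder is a competitor *)

Section ladder_competitor.
Context {R : realType} {n : nat}.
Local Notation E := 'rV[R]_n.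
Local Notation H1 := (@H1 R n).
Local Notation psie eta := (homog_ext (psi eta)).
Variables (m N : nat) (sigma : int) (b1 b2 : 'rV[int]_n) (t : E) (rho r0 : R).
Local Notation vertex := (vertex m N).
Local Notation link := (link m N).
Local Notation tl := (@link_tail m N).
Local Notation hd := (@link_head m N).
Local Notation charge := (@link_charge n m N sigma b1 b2).
Hypotheses (t1 : enorm t = 1) (rho0 : 0 < rho) (rho_r0 : rho < r0) (r0_half : r0 < 2^-1).

Definition anchor_abscissa (side inner : bool) : R :=
  (if side then 1 else -1) * (if inner then rho else 2^-1).

Variable pos : vertex -> E.
Hypotheses (pos_anchor : forall side inner,
    pos (anchor m N side inner) = anchor_abscissa side inner *: t)
  (pos_corner : forall v, enorm (pos (inr v)) < r0)
  (gen : noncollinear predT (@anchors m N) pos).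

Local Notation P := (fun e => pos (tl e)).
Local Notation Q := (fun e => pos (hd e)).

Let PQ e : P e != Q e.
Proof. exact: (graph_PQ gen (@link_rank m N)). Qed.

Lemma end_link side : edir P Q (inl side) = t /\
  edge P Q (inl side) = line_map 0 t @` (if side then `]rho, 2^-1[ else `]- 2^-1, - rho[)%classic.
Proof.
have lt2 : rho < 2^-1 by exact: lt_trans r0_half.
by case: side; apply: end_edge; rewrite ?pos_anchor /anchor_abscissa ?mul1r ?mulN1r ?ltrN2.
Qed.

Lemma end_links_disjoint : edge P Q (inl false) `&` edge P Q (inl true) = set0.
Proof.
rewrite (end_link false).2 (end_link true).2; apply/seteqP; split => // x [].
move=> [s + <-] [s' + /(congr1 (fun y => dot y t))].
rewrite /= !in_itv/= /line_map !add0r !dotZl => /andP[_ h1] /andP[h2 _].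
have -> : dot t t = 1 by rewrite -sqr_enorm t1 expr1n.
by rewrite !mulr1 => ss; move: rho0; lra.
Qed.

Lemma enorm_line_map0 s : enorm (line_map 0 t s) = `|s|.
Proof. by rewrite /line_map add0r enormZ t1 mulr1. Qed.

Let edge_null e f : e != f -> H1 (edge P Q e `&` edge P Q f) = 0%E.
Proof.
(* Only the two end pieces have both ends among the anchors, and they are disjoint. *)
apply: (graph_edges_null gen (@link_rank m N) (@link_inj m N)) => {}e {}f.
have disj := end_links_disjoint.
case: e => [[|]|[[k [|]]|[[k l] c]]]; case: f => [[|]|[[k' [|]]|[[k' l'] c']]] //= _ _ _ _ _.
by rewrite setIC.
Qed.

Lemma enorm_anchor side inner :
  enorm (pos (anchor m N side inner)) = if inner then rho else 2^-1.
Proof.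
rewrite pos_anchor enormZ t1 mulr1 normrM; case: side; case: inner;
  by rewrite ?normrN normr1 mul1r ger0_norm// ltW.
Qed.

Lemma ladder_Mdf : Mdf (eball 0 2^-1) (network P Q) (net_theta P Q charge) (net_tau P Q).
Proof.
have bnd v : enorm (pos v) <= 2^-1.
  case: v => [[side inner]|v]; last by rewrite ltW// (lt_trans (pos_corner v)).
  rewrite [enorm _]enorm_anchor; case: inner => //.
  by rewrite ltW// (lt_trans rho_r0).
apply: (@network_Mdf R n _ P Q charge PQ edge_null).
- move=> e; exact: bnd.
- move=> e; exact: bnd.
- move=> e; case: e => [[|]|[[k [|]]|[[k l] c]]] /=; rewrite ?enorm_anchor ?(lt_trans rho_r0)//=.
  + by rewrite orbT.
  + by rewrite orbT.
  + by rewrite (lt_trans (pos_corner _)).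
- move=> phi phi0 i.
  have phi_anchor side : phi (pos (anchor m N side false)) = 0.
    by apply: phi0; rewrite enorm_anchor.
  have := @kirchhoff R n m N sigma b1 b2 (fun v => phi (pos v)) i
    (phi_anchor false) (phi_anchor true).
  exact.
Qed.

Lemma inner_link_ball e : edge P Q (inr e) `<=` eball 0 r0.
Proof.
apply: edge_sub_ball => //; case: e => [[k [|]]|[[k l] c]] /=;
  by rewrite ?enorm_anchor// pos_corner.
Qed.

(** All links other than the end pieces stay in the ball of radius [r0]; outside it the two end
    pieces cover exactly the diameter. *)
Lemma ladder_agrees : agrees_near_boundary (eball 0 2^-1) (network P Q)
  (net_theta P Q charge) (net_tau P Q) (m%:Z *: (sigma *: (b1 + b2))) t.
Proof.
exists 0, r0; split; first exact: lt_trans rho_r0.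
  move=> x xr; apply/eballE; suff: [set x | enorm x <= r0] x by move/le_lt_trans; apply.
  have /closure_id -> := @closed_enorm_le R n r0.
  by move: x xr; apply: closure_subset => x /eballE /ltW.
move=> A Abor AB; have mA := borel_H1_measurable Abor.
rewrite (@network_line_measure R n _ P Q charge PQ edge_null _ mA).
apply/matrixP => i j; rewrite !mxE.
have mL := line_ball_measurable t1.
have mE := edge_measurable PQ.
transitivity (tensor (m%:Z *: (sigma *: (b1 + b2))) t i j *
    fine (H1 (line t `&` eball 0 2^-1 `&` A))); last first.
  by rewrite -Rintegral_cst//; exact: measurableI.
rewrite sum_link [X in _ + X]big1 ?addr0; last first.
  move=> k _.
  have inner e : tensor (charge (inr e)) (edir P Q (inr e)) i j *
      fine (H1 (edge P Q (inr e) `&` A)) = 0.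
    rewrite (_ : edge P Q (inr e) `&` A = set0) ?measure0 ?mulr0//.
    apply/seteqP; split => // x [xe /AB[_]]; apply; exact: inner_link_ball xe.
  rewrite !inner !add0r; apply: big1 => l _; apply: big1 => c _; exact: inner.
rewrite !(end_link _).1 -mulrDr; congr (_ * _).
have fin s : H1 (edge P Q (inl s) `&` A) \is a fin_num.
  rewrite ge0_fin_numE ?measure_ge0//.
  apply: (@le_lt_trans _ _ (H1 (edge P Q (inl s)))).
    by apply: le_measure; rewrite ?inE//; exact: measurableI.
  by rewrite H1_edge// ltry.
rewrite -fineD// -measureU; [|exact: measurableI|exact: measurableI|]; last first.
  by rewrite setIACA end_links_disjoint set0I.
congr (fine (H1 _)); rewrite (end_link false).2 (end_link true).2 (line_ball t1).
apply/seteqP; split => x.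
  move=> [[[s sI <-] As]|[[s sI <-] As]]; split => //; exists s => //;
    by move: sI rho0 rho_r0 r0_half; rewrite /= !in_itv/= => /andP[h1 h2]; lra.
move=> [[s + xE] Ax]; have [_ nx] := AB _ Ax.
have {nx} : rho < `|s|.
  rewrite -enorm_line_map0 xE ltNge; apply/negP => h; apply: nx; apply/eballE.
  exact: le_lt_trans h rho_r0.
rewrite /= in_itv/= lter_normr => h1 h2; have [s0|s0] := leP 0 s.
  by right; split => //; exists s => //=; rewrite in_itv/=; lra.
by left; split => //; exists s => //=; rewrite in_itv/=; lra.
Qed.

Lemma ladder_envelope eta :
  (H1_elliptic_envelope (psi eta) (m%:Z *: (sigma *: (b1 + b2))) t <=
   (\sum_e psie eta (charge e) (pos (hd e) - pos (tl e)))%:E)%E.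
Proof.
apply: ereal_inf_lbound; exists (network P Q), (net_theta P Q charge), (net_tau P Q).
split; [exact: ladder_Mdf|exact: ladder_agrees|].
by rewrite (@network_energy R n _ P Q charge PQ edge_null).
Qed.

End ladder_competitor.

(** * Position and energy of the unperturbed ladder *)

Section ladder_position.
Context {R : realType} {n : nat}.
Local Notation E := 'rV[R]_n.
Local Notation psie eta := (homog_ext (psi eta)).
Variables (m N : nat) (sigma : int) (b1 b2 : 'rV[int]_n) (t : E) (rho : R) (z1 z2 : E).
Local Notation charge := (@link_charge n m N sigma b1 b2).

Definition cell_corner (r : nat) : E :=
  nth 0 [:: 0; 2^-1 *: z1; 2^-1 *: z2; 2^-1 *: (z1 + z2)] r.

Definition ladder_position (v : vertex m N) : E :=
  match v with
  | inl (side, inner) => anchor_abscissa rho side inner *: t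
  | inr (k, l, r) =>
      (- rho + 2 * rho * (l%:R / N%:R)) *: t + (2 * rho / N%:R) *: cell_corner r
  end.
Arguments ladder_position : simpl never.
Local Notation pos := ladder_position.

Lemma ladder_position_anchor side inner :
  pos (anchor m N side inner) = anchor_abscissa rho side inner *: t.
Proof. by []. Qed.

Lemma ladder_position_corner (k : 'I_m) l r : (l <= N)%N -> (r < 4)%N ->
  pos (corner N k l r) =
  (- rho + 2 * rho * (l%:R / N%:R)) *: t + (2 * rho / N%:R) *: cell_corner r.
Proof. by move=> lN r4; rewrite /pos /corner !inordK. Qed.

(** A cell is the minimisation diagram scaled by 2 rho / N, so by homogeneity N of them cost 2 rho
    times the split energy for every N; the end pieces have total length 1 - 2 rho. *)
Lemma ladder_position_energy eta : (0 < N)%N -> 0 <= rho <= 2^-1 ->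
  (forall b (z : E), psie eta (sigma *: b) z = psie eta b z) ->
  \sum_e psie eta (charge e) (pos (link_head e) - pos (link_tail e)) =
  (1 - 2 * rho) * psie eta (m%:Z *: (sigma *: (b1 + b2))) t +
  m%:R * (2 * rho * split_energy eta b1 b2 t z1 z2).
Proof.
move=> N0 /andP[rho0 rho2] sigmaE.
have N0' : N%:R != 0 :> R by rewrite pnatr_eq0 -lt0n.
rewrite sum_link; congr (_ + _).
  rewrite /link_head /link_tail /anchor /pos /anchor_abscissa/= -!scalerBl !psieZ -mulrDl.
  by rewrite !ger0_norm; [congr (_ * _); field|lra|lra].
rewrite (eq_bigr (fun=> 2 * rho * split_energy eta b1 b2 t z1 z2)); last first.
  move=> k _.
  (* The connectors have length zero and cost nothing. *)
  rewrite [X in X + _ + _](_ : _ = 0); last first.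
    rewrite /link_head /link_tail ladder_position_corner// ladder_position_anchor /= /anchor_abscissa.
    rewrite mul0r mulr0 addr0 scaler0 addr0 -scalerBl (_ : _ - _ = 0) ?scale0r ?psie0//.
    by ring.
  rewrite [X in _ + X + _](_ : _ = 0) ?add0r; last first.
    rewrite /link_head /link_tail ladder_position_corner// ladder_position_anchor /= /anchor_abscissa.
    rewrite scaler0 addr0 -scalerBl (_ : _ - _ = 0) ?scale0r ?psie0//.
    by field.
  rewrite (eq_bigr (fun=> 2 * rho / N%:R * split_energy eta b1 b2 t z1 z2)); last first.
    move=> l _; have lN := ltn_ord l.
    have h0 : 0 <= 2 * rho / N%:R by rewrite divr_ge0// mulr_ge0.
    have cellE b (c d : nat) w : (c < 4)%N -> (d < 4)%N -> cell_corner d - cell_corner c = w ->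
        psie eta (sigma *: b) (pos (corner N k l d) - pos (corner N k l c)) =
        2 * rho / N%:R * psie eta b w.
      move=> c4 d4 <-; rewrite sigmaE !ladder_position_corner ?(ltnW lN)//.
      by rewrite opprD addrACA subrr add0r -scalerBr psieZ ger0_norm.
    rewrite sum_cell /link_head /link_tail /link_charge !inordK//=.
    rewrite (cellE b1 _ _ (2^-1 *: z1))//; last by rewrite /cell_corner /= subr0.
    rewrite (cellE b2 _ _ (2^-1 *: z2))//; last by rewrite /cell_corner /= subr0.
    rewrite (cellE (b1 - b2) _ _ (2^-1 *: (z2 - z1)))//; last first.
      by rewrite /cell_corner /= scalerBr.
    rewrite (cellE b2 _ _ (2^-1 *: z2))//; last first.
      by rewrite /cell_corner /= scalerDr addrC addKr.
    rewrite (cellE b1 _ _ (2^-1 *: z1))//; last first.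
      by rewrite /cell_corner /= scalerDr addrK.
    rewrite [psie eta (_ *: (b1 + b2)) _](_ : _ = 2 * rho / N%:R *
        psie eta (b1 + b2) (t - 2^-1 *: (z1 + z2))).
      rewrite /split_energy !psieZ ger0_norm ?invr_ge0//.
      by field.
    rewrite sigmaE !ladder_position_corner ?(ltnW lN)// /cell_corner /=.
    rewrite -{3}(ger0_norm h0) -psieZ; congr (psie _ _ _).
    by apply/rowP => q; rewrite !mxE -natr1; field.
  by rewrite sumr_const card_ord -mulr_natl; field.
by rewrite sumr_const card_ord -[LHS]mulr_natl.
Qed.

Lemma enorm_ladder_position v : (0 < N)%N -> enorm t = 1 -> 0 <= rho <= 2^-1 ->
  enorm (pos (inr v)) <= rho + (enorm z1 + enorm z2) / N%:R.
Proof.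
case: v => [[k l] r] N0 t1 /andP[rho0 rho2] /=.
have N0' : 0 < N%:R :> R by rewrite ltr0n.
have lN : l%:R / N%:R <= 1 :> R by rewrite ler_pdivrMr// mul1r ler_nat -ltnS.
have l0 : 0 <= l%:R / N%:R :> R by rewrite divr_ge0.
apply: le_trans (enormD _ _) _; apply: lerD.
  rewrite enormZ t1 mulr1 ler_norml; apply/andP; split.
    by have : 0 <= rho * (l%:R / N%:R) by [exact: mulr_ge0]; lra.
  have : rho * (l%:R / N%:R) <= rho * 1 by exact: ler_wpM2l.
  by lra.
rewrite enormZ ger0_norm; last by rewrite divr_ge0// mulr_ge0.
rewrite mulrAC ler_wpM2r ?invr_ge0//.
have n1 := enorm_ge0 z1; have n2 := enorm_ge0 z2.
have corner_le : enorm (cell_corner r) <= 2^-1 * (enorm z1 + enorm z2).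
  rewrite /cell_corner; case: r => [[|[|[|[|//]]]] ?]/=; rewrite ?enorm0 ?enormZ ?ger0_norm//.
  - by lra.
  - by lra.
  - by lra.
  - by have := enormD z1 z2; lra.
have : 2 * rho * enorm (cell_corner r) <= 1 * enorm (cell_corner r).
  by apply: ler_wpM2r; [exact: enorm_ge0|lra].
by have := enorm_ge0 (cell_corner r); lra.
Qed.

End ladder_position.

(** * The two bounds combined *)

Section envelope.
Context {R : realType} {n : nat}.
Local Notation E := 'rV[R]_n.
Local Notation psie eta := (homog_ext (psi eta)).

Lemma anchor_position_inj m N (t : E) (rho : R) (z1 z2 : E) : enorm t = 1 ->
  0 < rho -> rho < 2^-1 ->
  {in @anchors m N &, injective (@ladder_position R n m N t rho z1 z2)}.
Proof.
move=> t1 rho0 rho2 [[s a]|//] [[s' a']|//] _ _.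
rewrite /ladder_position /anchor_abscissa => /(congr1 (fun y => dot y t)).
rewrite !dotZl -sqr_enorm t1 expr1n !mulr1.
by case: s; case: a; case: s'; case: a' => // h; exfalso; move: h rho0 rho2; lra.
Qed.

(** The excess over the split energy has two sources, the end pieces and the perturbation; each is
    allowed e / 2. *)
Lemma envelope_upper eta (i j : 'I_n) (b1 b2 : 'rV[int]_n) (beta : int) (t z1 z2 : E) :
  i != j -> 0 <= eta <= 1 -> enorm t = 1 ->
  (H1_elliptic_envelope (psi eta) (beta *: (b1 + b2)) t <=
   (`|beta|%:~R * split_energy eta b1 b2 t z1 z2)%:E)%E.
Proof.
move=> ij e01 t1.
pose m := `|beta|%N; pose sigma : int := if beta < 0 then -1 else 1.
have msigma : m%:Z * sigma = beta by rewrite /m /sigma; case: ltP; lia.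
have mE : `|beta|%:~R = m%:R :> R by rewrite -abszE.
have sigmaE b (z : E) : psie eta (sigma *: b) z = psie eta b z.
  by rewrite /sigma; case: ifP => _; rewrite ?scaleN1r ?psieNl ?scale1r.
have eta0 : 0 <= eta by case/andP: e01.
apply/lee_addgt0Pr => e e0.
set S := split_energy _ _ _ _ _ _; have S0 : 0 <= S by exact: split_energy_ge0.
pose K := psie eta (beta *: (b1 + b2)) t; have K0 : 0 <= K by exact: psie_ge0.
(* The end pieces have total length 2 d and cost 2 d K; [d <= 4^-1] keeps [rho] positive. *)
have [d [d0 d4 dK]] : exists d : R, [/\ 0 < d, d <= 4^-1 & 2 * d * K <= e / 2].
  have h : 0 < e / (4 * (K + 1)) by rewrite divr_gt0//; lra.
  exists (Num.min 4^-1 (e / (4 * (K + 1)))); split.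
  - by rewrite lt_min h invr_gt0//= ltr0n.
  - by rewrite ge_min lexx.
  - have le2 : Num.min 4^-1 (e / (4 * (K + 1))) <= e / (4 * (K + 1)).
      by rewrite ge_min lexx orbT.
    apply: (@le_trans _ _ (2 * (e / (4 * (K + 1))) * (K + 1))).
      by apply: ler_pM => //; [rewrite mulr_ge0// le_min ltW//=; lra|lra|lra].
    by rewrite le_eqVlt (_ : _ == _)//; apply/eqP; field; lra.
pose rho := 2^-1 - d; pose r0 := 2^-1 - d / 2.
have [N Nd] : exists N, (enorm z1 + enorm z2) / N.+1%:R <= d / 4.
  have h : 0 <= (enorm z1 + enorm z2) / (d / 4).
    by rewrite divr_ge0 ?addr_ge0 ?enorm_ge0//; lra.
  exists (Num.bound ((enorm z1 + enorm z2) / (d / 4))).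
  have := archi_boundP h; set M := Num.bound _ => hM.
  have M1 : M%:R <= M.+1%:R :> R by rewrite ler_nat.
  rewrite ler_pdivrMr ?ltr0n// mulrC -ler_pdivrMr; last by lra.
  by rewrite ltW// (lt_le_trans hM).
pose charge := @link_charge n m N.+1 sigma b1 b2.
pose D := \sum_e dot (toR (charge e)) (toR (charge e)) : R.
have D0 : 0 <= D by apply: sumr_ge0 => a _; exact: dot_ge0.
(* Moving the vertices by [q] changes an edge vector by at most 2 q, and psi_e (b, .) has Lipschitz
   constant 2 |b|^2; in total this costs 4 q D. *)
pose q := Num.min (d / 4) (e / (8 * (D + 1))).
have q0 : 0 < q by rewrite lt_min !divr_gt0//; lra.
have qd : q <= d / 4 by rewrite ge_min lexx.
have qD : 4 * q * D <= e / 2.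
  have le2 : q <= e / (8 * (D + 1)) by rewrite ge_min lexx orbT.
  apply: (@le_trans _ _ (4 * (e / (8 * (D + 1))) * (D + 1))).
    by apply: ler_pM => //; [rewrite mulr_ge0// ltW|lra|lra].
  by rewrite le_eqVlt (_ : _ == _)//; apply/eqP; field; lra.
pose pos0 := @ladder_position R n m N.+1 t rho z1 z2.
have rho0 : 0 < rho by rewrite /rho; lra.
have rho2 : rho < 2^-1 by rewrite /rho; lra.
have [pos [posF posq gen]] := generic_position ij q0
  (@anchor_position_inj m N.+1 t rho z1 z2 t1 rho0 rho2).
have := @ladder_envelope R n m N.+1 sigma b1 b2 t rho r0 t1 rho0 _ _ pos _ _ gen eta.
rewrite scalerA msigma => H; apply: le_trans (H _ _ _ _) _.
- by rewrite /rho /r0; lra.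
- by rewrite /r0; lra.
- by move=> side inner; rewrite posF.
- move=> v; rewrite -(subrK (pos0 (inr v)) (pos (inr v))).
  apply: le_lt_trans (enormD _ _) _.
  have hv : enorm (pos0 (inr v)) <= rho + (enorm z1 + enorm z2) / N.+1%:R.
    by apply: enorm_ladder_position => //; rewrite !ltW.
  (* The margin d / 2 between [rho] and [r0] is shared by the perturbation and the width of the
     cells. *)
  have -> : r0 = d / 4 + (rho + d / 4) by rewrite /r0 /rho; field.
  apply: ltr_leD; first exact: lt_le_trans (posq _) qd.
  by apply: le_trans hv _; rewrite lerD2l.
rewrite -EFinD lee_fin mE.
apply: (@le_trans _ _ (\sum_e (psie eta (charge e) (pos0 (link_head e) - pos0 (link_tail e)) +
    4 * q * dot (toR (charge e)) (toR (charge e))))).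
  apply: ler_sum => a _.
  apply: le_trans (psie_lipschitz _ (pos0 (link_head a) - pos0 (link_tail a)) _ e01) _.
  rewrite lerD2l; set u := dot _ _; have u0 : 0 <= u by exact: dot_ge0.
  rewrite (_ : 4 * q * u = 2 * u * (q + q)); last by ring.
  apply: ler_wpM2l; first by rewrite mulr_ge0.
  rewrite opprB addrACA addrC.
  rewrite (_ : _ + _ = (pos (link_head a) - pos0 (link_head a)) -
      (pos (link_tail a) - pos0 (link_tail a))); last first.
    by apply/rowP => k; rewrite !mxE; ring.
  apply: le_trans (enormD _ _) _; rewrite enormN.
  by apply: lerD; apply: ltW.
rewrite big_split/= -mulr_sumr -/D ladder_position_energy//; last first.
  by rewrite !ltW.
rewrite scalerA msigma -/K -/S.
have -> : 1 - 2 * rho = 2 * d by rewrite /rho; field.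
have : m%:R * (2 * rho * S) <= m%:R * S.
  by apply: ler_wpM2l => //; apply: ler_piMl => //; rewrite /rho; lra.
by lra.
Qed.

(** The lower bound concerns the problem with beta t in place of t; rescaling z1 and z2 by 1/beta
    takes out the factor |beta|. *)
Lemma envelope_split eta (i j : 'I_n) (b1 b2 : 'rV[int]_n) (beta : int) (t : E) :
  i != j -> 0 <= eta <= 1 -> enorm t = 1 ->
  dot (toR b1) (toR b1) = 1 :> R -> dot (toR b2) (toR b2) = 1 :> R ->
  dot (toR b1) (toR b2) = 0 :> R ->
  exists m : R,
    is_min [set split_energy eta b1 b2 t z.1 z.2 | z in [set: E * E]] m /\
    H1_elliptic_envelope (psi eta) (beta *: (b1 + b2)) t = (`|beta|%:~R * m)%:E.
Proof.
move=> ij e01 t1 b11 b22 b12; have eta0 : 0 <= eta by case/andP: e01.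
have [z1 [z2 zmin]] := split_energy_min t e01 b11 b22.
exists (split_energy eta b1 b2 t z1 z2); split.
  by split; [exists (z1, z2)|move=> _ [y _ <-]].
apply/eqP; rewrite eq_le (envelope_upper _ _ _ _ _ ij)//=.
apply: le_ereal_inf_tmp => _ [g [theta [tau [Mg agr ->]]]].
have [y1 [y2]] := envelope_lower e01 t1 b11 b22 b12 Mg agr.
apply: le_trans; rewrite lee_fin.
have [->|beta0] := eqVneq beta 0; first by rewrite normr0 mul0r split_energy_ge0.
have beta0' : beta%:~R != 0 :> R by rewrite intr_eq0.
have -> : split_energy eta b1 b2 (beta%:~R *: t) y1 y2 =
    `|beta|%:~R * split_energy eta b1 b2 t (beta%:~R^-1 *: y1) (beta%:~R^-1 *: y2).
  rewrite intr_norm -split_energyZ !scalerA.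
  by rewrite mulfV// !scale1r.
by apply: ler_wpM2l; rewrite ?ler0z.
Qed.

End envelope.

Lemma dot_toR_basis_vec (R : realType) (n : nat) (i : 'I_n) (b : 'rV[int]_n) :
  dot (toR (basis_vec i)) (toR b) = (b 0 i)%:~R :> R.
Proof.
rewrite /dot (bigD1 i)//= big1 => [|k ki]; first by rewrite !mxE !eqxx mul1r addr0.
by rewrite !mxE eqxx (negbTE ki) mul0r.
Qed.

Theorem lemma4p5 (R : realType) (n : nat) (eta : R)
    (heta : 0 <= eta <= 1) (hn : (n <= 9)%N)
    (beta : int) (t : 'rV[R]_n) (ht : enorm t = 1)
    (i j : 'I_n) (hij : i != j) :
  let e := @basis_vec n in
  let psie := homog_ext (psi eta) in
  (exists m : R,
    is_min [set psie (e i) z.1 + psie (e j) z.2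
                + psie (e i - e j) (2^-1 *: (z.2 - z.1))
                + psie (e i + e j) (t - 2^-1 *: (z.1 + z.2))
           | z in [set: 'rV[R]_n * 'rV[R]_n]] m /\
    H1_elliptic_envelope (psi eta) (beta *: (e i + e j)) t
      = (`|beta|%:~R * m)%:E) /\
  (exists m : R,
    is_min [set psie (e i) z.1 + psie (- e j) z.2
                + psie (e i + e j) (2^-1 *: (z.2 - z.1))
                + psie (e i - e j) (t - 2^-1 *: (z.1 + z.2))
           | z in [set: 'rV[R]_n * 'rV[R]_n]] m /\
    H1_elliptic_envelope (psi eta) (beta *: (e i - e j)) t
      = (`|beta|%:~R * m)%:E).
Proof.
move=> e psie.
have ee k l : dot (toR (e k)) (toR (e l)) = (k == l)%:R :> R.
  by rewrite dot_toR_basis_vec mxE eqxx eq_sym; case: (_ == _).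
split; first by apply: (envelope_split _ hij) => //; rewrite ee ?eqxx// (negbTE hij).
(* The second identity is the case b2 = - e_j, in which e_i - e_j and e_i + e_j exchange their
   roles. *)
have := @envelope_split R n eta i j (e i) (- e j) beta t hij heta ht.
rewrite /split_energy opprK !toRN !dotNl !dotNr opprK !ee !eqxx (negbTE hij) oppr0.
exact.
Qed.
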